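(* Suppose that the following conditions hold: (i) $\rho_1:= \int_{0}^{\infty} ds \int_{s}^{\infty} \alpha(x-s) g'(x-s,1-) G(dx)< 1$; (ii) there exists a constant $\alpha_{1}\in (0,\infty)$ such that the function $t\mapsto e^{\alpha_{1} t}[1-G(t)]$ is directly Riemann integrable over $[0,\infty)$ and $\int_{0}^{\infty} e^{\alpha_{1} s} ds \int_{s}^{\infty} \alpha(x-s) g'(x-s,1-) G(dx) = 1$; (iii) $\int_{0}^{\infty} e^{2\alpha_1 x} G(dx)<\infty$ and $\|g''(\cdot,1-)\|<\infty$; (iv) $\int_{\mathfrak{N}(0,\infty)^\circ} L(d \nu) \big(\int_{0}^{\infty} e^{\alpha_{1} x} \nu(dx)\big)^2 <\infty$. Let $Y=(Y_t:t\ge0)$, under $\mathbf{P}_\sigma$, be a càdlàg realization of the $(\alpha,g,G,\psi)$-process started from $\sigma$ at time zero, and let $Z_t=\int_0^tY_s\,ds$. Then for any $\sigma \in \mathfrak{N}(0, \infty)$ and $f \in B(0, \infty)$ we have, almost surely with respect to $\mathbf{P}_{\sigma}$, $$\frac{1}{t}\langle Z_{t},f\rangle\rightarrow \int_{\mathfrak{N}(0,\infty)^{\circ}}\langle \nu, \Pi_{\infty}f\rangle L(d \nu),\quad \text{as } t\rightarrow\infty,$$ where $\Pi_\infty f(x)=\int_0^\infty\pi_sf(x)\,ds$.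
   Context: Notation. $\mathbb{N}=\{0,1,2,\ldots\}$; ''positive'' means nonnegative. $\mathfrak{M}(0,\infty)$ is the set of finite Borel measures on $(0,\infty)$ with the weak convergence topology, $\mathfrak{N}(0,\infty)$ its subset of integer-valued measures, $\mathfrak{N}(0,\infty)^\circ=\mathfrak{N}(0,\infty)\setminus\{\mathbf{0}\}$ with $\mathbf{0}$ the null measure. $B(0,\infty)$ is the set of bounded Borel functions on $(0,\infty)$; $C^1(0,\infty)$ is the set of bounded continuous functions on $(0,\infty)$ with bounded continuous first derivative; superscript $+$ denotes the positive elements; $\|\cdot\|$ is the supremum norm. Any function on $A\subset\mathbb{R}$ is extended by $0$ to $\mathbb{R}\setminus A$. $\langle\nu,f\rangle=\int_{(0,\infty)}f\,d\nu$. $\int_a^b=\int_{(a,b]}$ and $\int_a^\infty=\int_{(a,\infty)}$. Parameters. $\alpha\in C^1(0,\infty)^+$. For each $x\in(0,\infty)$, $\{p(x,i):i\in\mathbb{N}\}$ is a probability distribution, $p(\cdot,i)\in C^1(0,\infty)^+$ for every $i$, and $\sup_{x>0}\sum_{i\ge1}i\,p(x,i)<\infty$; put $g(x,z)=\sum_{i\ge0}p(x,i)z^i$ for $z\in[0,1]$, assume $g(\cdot,z)\in C^1(0,\infty)^+$ for each $z$; $g'$ and $g''$ are the first and second derivatives in $z$, so $g'(x,1-)=\sum_i i\,p(x,i)$ and $g''(x,1-)=\sum_i i(i-1)p(x,i)$. $G$ is a continuous probability distribution on $(0,\infty)$, and $G(t)=G((0,t])$. $L(d\nu)$ is a finite measure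 on $\mathfrak{N}(0,\infty)^\circ$ and $\psi(f)=\int_{\mathfrak{N}(0,\infty)^\circ}(1-e^{-\langle\nu,f\rangle})L(d\nu)$ for $f\in B(0,\infty)^+$. The $(\alpha,g,G,\psi)$-process is the Markov process with state space $\mathfrak{N}(0,\infty)$ whose transition semigroup $(P_t)_{t\ge0}$ is determined by $$\int e^{-\langle \nu, f\rangle} P_t(\sigma, d \nu)=\exp \Big\{-\langle\sigma, u_t f\rangle-\int_0^t \psi(u_s f)\, d s\Big\},\quad f \in B(0,\infty)^{+},$$ where $(t,x)\mapsto u_tf(x)$ is the unique locally bounded positive solution of $u_{t}f(x)=f(x-t)+\int_{0}^{t} \alpha(x-s)[1-g(x-s,\langle G,e^{-u_{t-s} f}\rangle)]ds$. In ''càdlàg realization'', mass reaching $0$ is discarded (left limits are understood with mass at $0$ discarded). $\langle Z_t,f\rangle=\int_0^t\langle Y_s,f\rangle ds$. For $f\in B(0,\infty)$, $(t,x)\mapsto\pi_tf(x)$ is the unique locally bounded solution of $\pi_{t} f(x)=f(x-t)+\int_{0}^{t} \alpha(x-s) g'(x-s,1-) \langle G,\pi_{t-s}f\rangle ds$. A nonnegative function $f$ on $[0,\infty)$ is directly Riemann integrable over $[0,\infty)$ if for any $a>0$, $\sum_{n\ge1}aM_n(a)<\infty$, and $\lim_{a\to0}\sum_{n\ge1}aM_n(a)=\lim_{a\to0}\sum_{n\ge1}am_n(a)$, where $M_n(a)$ and $m_n(a)$ are the supremum and infimum of $f$ over $[(n-1)a,na]$. *)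

(* Defs.v *)
From HB Require Import structures.
From mathcomp Require Import all_boot all_order all_algebra.
From mathcomp Require Import all_classical all_reals all_analysis.

Set Implicit Arguments.
Unset Strict Implicit.
Unset Printing Implicit Defensive.

Import Order.TTheory GRing.Theory Num.Theory.
Import numFieldNormedType.Exports.

Local Open Scope classical_set_scope.
Local Open Scope ring_scope.

(* Throughout, a function on (0,oo) is represented by a function on R that
   vanishes on ]-oo, 0] (this is part of the predicates below), and a measure
   on (0,oo) by a measure on R that gives no mass to ]-oo, 0]. *)

Section state_space.
Variable R : realType.

(* The set N(0,oo) of integer-valued finite Borel measures on (0,oo). *)
Record int_measure := IntMeasure {
  int_measure_val :> {finite_measure set (measurableTypeR R) -> \bar R} ;
  int_measure_neg : int_measure_val `]-oo, 0]%classic = 0%E ;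
  int_measure_nat : forall B, measurable B ->
    exists n : nat, int_measure_val B = n%:R%:E }.

Let null_neg :
  (mzero : {finite_measure set (measurableTypeR R) -> \bar R})
    `]-oo, 0]%classic = 0%E.
Proof. by []. Qed.

Let null_nat B : measurable B ->
  exists n : nat,
  (mzero : {finite_measure set (measurableTypeR R) -> \bar R}) B = n%:R%:E.
Proof. by exists 0%N. Qed.

Definition null_measure : int_measure := IntMeasure null_neg null_nat.

HB.instance Definition _ := gen_eqMixin int_measure.
HB.instance Definition _ := gen_choiceMixin int_measure.
HB.instance Definition _ := isPointed.Build int_measure null_measure.

Definition pairing (nu : {measure set (measurableTypeR R) -> \bar R})
    (f : R -> R) : R :=
  \int[nu]_(x in `]0, +oo[%classic) f x.

(* The topology of weak convergence on N(0,oo): the coarsest one making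
   nu |-> <nu, f> continuous for f bounded and continuous on (0,oo). *)
Definition weak_subbase : set (set int_measure) :=
  [set V | exists (f : R -> R) (U : set R),
    [/\ exists M : R, forall x : R, 0 < x -> `|f x| <= M,
        forall x : R, 0 < x -> {for x, continuous f},
        open U &
        V = [set nu : int_measure | U (pairing nu f)]]].

HB.instance Definition _ :=
  isSubBaseTopological.Build int_measure weak_subbase id.

HB.instance Definition _ := @isMeasurable.Build
  (sigma_display (@open int_measure)) int_measure <<s @open int_measure >>
  (@sigma_algebra0 _ setT (@open int_measure))
  (@sigma_algebraC _ (@open int_measure))
  (@sigma_algebra_bigcup _ setT (@open int_measure)).

Definition nonnull : set int_measure := ~` [set null_measure].

End state_space.
Arguments nonnull : clear implicits.

Section function_spaces.
Variable R : realType.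
Implicit Type f : R -> R.

Definition vanishes_off_pos f := forall x : R, x <= 0 -> f x = 0.

(* B(0,oo) *)
Definition bounded_borel f :=
  [/\ vanishes_off_pos f,
      measurable_fun [set: measurableTypeR R] (f : measurableTypeR R -> _) &
      exists M : R, forall x : R, `|f x| <= M].

(* B(0,oo)^+ *)
Definition bounded_borel_pos f := bounded_borel f /\ forall x : R, 0 <= f x.

(* C^1(0,oo)^+ *)
Definition C1_pos f :=
  [/\ vanishes_off_pos f,
      forall x : R, 0 <= f x,
      forall x : R, 0 < x ->
        [/\ {for x, continuous f}, derivable f x 1 &
           {for x, continuous (derive1 f)}],
      exists M : R, forall x : R, 0 < x -> `|f x| <= M &
      exists M : R, forall x : R, 0 < x -> `|derive1 f x| <= M].

End function_spaces.

Section parameters.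
Variable R : realType.
Notation mu := (@lebesgue_measure R).
Implicit Types (alpha : R -> R) (p : R -> nat -> R).
Implicit Types (G : probability (measurableTypeR R) R).
Implicit Types (L : {finite_measure set (int_measure R) -> \bar R}).

(* The generating function g(x, z). *)
Definition gen p (x z : R) : R := limn (series (fun i => p x i * z ^+ i)).

(* g'(x, 1-) *)
Definition gen1 p (x : R) : R := lim (derive1 (gen p x) z @[z --> 1^'-]).

(* g''(x, 1-), which may be infinite. *)
Definition gen2 p (x : R) : \bar R :=
  lim ((derive1n 2 (gen p x) z)%:E @[z --> 1^'-]).

Definition offspring_law p :=
  [/\ forall i, C1_pos (p ^~ i),
      forall x : R, 0 < x -> series (p x) @ \oo --> (1 : R),
      (ereal_sup [set \sum_(1 <= i <oo) (i%:R * p x i)%:E |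
                   x in `]0%R, +oo[%classic] < +oo)%E &
      forall z : R, 0 <= z <= 1 -> C1_pos (gen p ^~ z)].

Definition dist_fun G (t : R) : R := fine (G `]0, t]%classic).

Definition continuous_distribution G :=
  G `]0, +oo[%classic = 1%E /\ continuous (dist_fun G).

(* Measures on N(0,oo) minus the null measure are represented by measures on
   N(0,oo) that do not charge the null measure. *)
Definition no_null_mass L := L [set null_measure R] = 0%E.

Definition psi L (f : R -> R) : R :=
  \int[L]_(nu in nonnull R) (1 - expR (- pairing nu f)).

(* "Locally bounded" means bounded on [0,T] x (0,oo) for every T; joint Borel
   measurability gives a meaning to the integrals. *)
Definition locally_bounded (v : R -> R -> R) :=
  [/\ forall t : R, 0 <= t -> vanishes_off_pos (v t),
      measurable_fun [set tx : measurableTypeR R * measurableTypeR R | 0 <= tx.1]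
        (fun tx => v tx.1 tx.2) &
      forall T : R, exists M : R, forall t x : R, 0 <= t <= T -> `|v t x| <= M].

(* v = (t, x) |-> u_t f (x) *)
Definition u_solution alpha p G (f : R -> R) (v : R -> R -> R) :=
  [/\ locally_bounded v,
      forall t x : R, 0 <= t -> 0 <= v t x &
      forall t x : R, 0 <= t -> 0 < x ->
        v t x = f (x - t) + \int[mu]_(s in `]0, t]%classic)
          (alpha (x - s) *
            (1 - gen p (x - s) (pairing G (fun y => expR (- v (t - s) y)))))].

(* v = (t, x) |-> pi_t f (x) *)
Definition pi_solution alpha p G (f : R -> R) (v : R -> R -> R) :=
  locally_bounded v /\
  forall t x : R, 0 <= t -> 0 < x ->
    v t x = f (x - t) + \int[mu]_(s in `]0, t]%classic)
      (alpha (x - s) * gen1 p (x - s) * pairing G (v (t - s))).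

(* int_s^oo alpha(x-s) g'(x-s,1-) G(dx) *)
Definition mean_kernel alpha p G (s : R) : \bar R :=
  (\int[G]_(x in `]s, +oo[%classic) (alpha (x - s) * gen1 p (x - s))%:E)%E.

End parameters.

Section process.
Variable R : realType.
Notation N := (int_measure R).
Notation mu := (@lebesgue_measure R).

Definition transition_semigroup (Q : R -> R.-pker N ~> N) :=
  (forall (sigma : N) B, measurable B -> Q 0 sigma B = \d_sigma B) /\
  (forall (s t : R) (sigma : N) B, 0 <= s -> 0 <= t -> measurable B ->
    Q (s + t) sigma B = (\int[Q s sigma]_nu Q t nu B)%E).

(* Q is the transition semigroup of the (alpha, g, G, psi)-process; Q t is
   only constrained for t >= 0. *)
Definition branching_semigroup (alpha : R -> R) (p : R -> nat -> R)
    (G : probability (measurableTypeR R) R)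
    (L : {finite_measure set N -> \bar R}) (Q : R -> R.-pker N ~> N) :=
  transition_semigroup Q /\
  forall f, bounded_borel_pos f -> exists u : R -> R -> R,
    u_solution alpha p G f u /\
    forall (t : R) (sigma : N), 0 <= t ->
      \int[Q t sigma]_nu expR (- pairing nu f) =
      expR (- pairing sigma (u t) - \int[mu]_(s in `]0, t]%classic) psi L (u s)).

Variables (d : measure_display) (Omega : measurableType d).
Variables (P : probability Omega R) (Y : R -> Omega -> N).

Definition natural_filtration (s : R) : set (set Omega) :=
  <<s \bigcup_(r in `[0, s]%classic) preimage_set_system setT (Y r) measurable >>.

(* The last clause says that
   P(Y_(s+t) \in B | natural_filtration s) = Q_t(Y_s, B) almost surely. *)
Definition markov_process (Q : R -> R.-pker N ~> N) (sigma : N) :=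
  [/\ forall t : R, 0 <= t -> measurable_fun setT (Y t),
      {ae P, forall w, Y 0 w = sigma} &
      forall (s t : R) A B, 0 <= s -> 0 <= t -> natural_filtration s A ->
        measurable B ->
        P (A `&` Y (s + t) @^-1` B) = (\int[P]_(w in A) Q t (Y s w) B)%E].

(* Mass of Y_s may move to 0 as s increases to t; it is then discarded. Hence
   the left limits are tested against functions vanishing at 0. *)
Definition left_limit (y : R -> N) (t : R) (nu : N) :=
  forall f : R -> R,
    {within `[0, +oo[%classic, continuous f} -> f 0 = 0 ->
    (exists M : R, forall x : R, 0 <= x -> `|f x| <= M) ->
    pairing (y s) f @[s --> t^'-] --> pairing nu f.

Definition cadlag := forall w,
  (forall t : R, 0 <= t -> Y s w @[s --> t^'+] --> Y t w) /\
  (forall t : R, 0 < t -> exists nu, left_limit (Y ^~ w) t nu).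

(* <Z_t, f> where Z_t = int_0^t Y_s ds *)
Definition Z_pairing (f : R -> R) (t : R) (w : Omega) : R :=
  \int[mu]_(s in `]0, t]%classic) pairing (Y s w) f.

End process.

Section direct_riemann.
Variable R : realType.
Implicit Types (f : R -> R) (a : R).

Definition grid_cell (n : nat) a : set R := `[n.-1%:R * a, n%:R * a]%classic.

Definition upper_sum f a : \bar R :=
  (\sum_(1 <= n <oo)
    a%:E * ereal_sup [set (f t)%:E | t in grid_cell n a])%E.

Definition lower_sum f a : \bar R :=
  (\sum_(1 <= n <oo)
    a%:E * ereal_inf [set (f t)%:E | t in grid_cell n a])%E.

Definition directly_Riemann_integrable f :=
  [/\ forall t : R, 0 <= t -> 0 <= f t,
      forall a : R, 0 < a -> (upper_sum f a < +oo)%E &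
      exists l : R, upper_sum f a @[a --> 0^'+] --> l%:E /\
                    lower_sum f a @[a --> 0^'+] --> l%:E].

End direct_riemann.

(* Main.v *)
Require Import Defs.
From HB Require Import structures.
From mathcomp Require Import all_boot all_order all_algebra.
From mathcomp Require Import all_classical all_reals all_analysis.
From mathcomp Require Import measurable_realfun simple_functions measurable_fun_approximation.
From mathcomp Require Import ring lra.

(** Let [V x = expR (alpha1 * x)] and [a = alpha1 / 2].

    _Linear flow._ The exponential moment of the mean kernel is less than one at
    rate [0] and equal to one at rate [alpha1]; by convexity it is less than one at
    rate [a] ([tilted_mass_midpoint]). Hence a function that is dominated by a
    multiple of [expR (- (a * t)) * V x] plus its own renewal convolution is itself
    dominated by such a multiple: the supremum [S] of [expR (a * t) * <G, w_t>] up
    to any time satisfies [S <= C + phi * S] with [phi < 1]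
    ([renewal_comparison]). This gives uniqueness for the linear equation and
    [pi_t f <= C * expR (- (a * t)) * V] for nonnegative bounded [f]
    ([linear_evolution_le]); existence comes from monotone iteration.

    _Moments._ For nonnegative [f] and small [th], the log-Laplace function
    [u_t (th * f)] differs from [th * pi_t f] by at most a multiple of
    [th ^+ 2 * expR (- (a * t)) * V] ([linear_sub_nonlinear_le]); the second moments
    of the offspring law and of [V] under [G] enter here. With the second moment of
    [<nu, V>] under [L], the whole Laplace exponent of [<Y_t, f>] is then linear in
    [th] up to a quadratic error that is uniform in [t] ([exponent_bounds]). So
    [<Y_t, f>] has mean
    [m_t = <sigma, pi_t f> + \int_0^t \int <nu, pi_s f> L(dnu) ds] and a variance
    bounded uniformly in [t] ([transition_moments]). The initial state has a finite
    pairing with [V] because integer-valued measures have bounded support.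

    _Covariances._ By the Markov property the conditional mean of [<Y_{r+t}, f>]
    given the past of [r] is a constant plus [<Y_r, pi_t f>], and
    [pi_t f <= C * expR (- (a * t)) * V]. Applying the variance bound to the test
    function [pi_t f] shows that covariances at lag [t] decay like
    [expR (- (a * t))] ([covariance_decay]). Therefore the variance of [<Z_t, f>]
    is at most linear in [t] ([variance_time_integral]).

    _Almost sure convergence._ Along the times [n ^+ 2] the variances of the time
    averages are summable, so the averages are asymptotic to their means; since
    [<Z_t, f>] is nondecreasing this extends to all times ([strong_law]). The means
    [m_t] converge exponentially fast to the total immigration
    [\int_0^oo \int <nu, pi_s f> L(dnu) ds] ([mean_asymptotics]), which Tonelli's
    theorem turns into the limit of the statement ([integral_immigration_rate]).

    A signed [f] is split into its positive and negative parts; by uniqueness the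
    linear flow of [f] is the difference of the flows of the parts. *)

Set Implicit Arguments.
Unset Strict Implicit.
Unset Printing Implicit Defensive.

Import Order.TTheory GRing.Theory Num.Theory.
Import numFieldNormedType.Exports.

Local Open Scope classical_set_scope.
Local Open Scope ring_scope.

(** * Pairings of finite measures with functions *)

Section pairing_theory.
Variable R : realType.
Notation RR := (measurableTypeR R).
Implicit Types (nu : {finite_measure set RR -> \bar R}) (f g : R -> R).

(** The bound is imposed on (0, oo), the part of the line that pairings see. *)
Definition bounded_measurable f :=
  measurable_fun [set: RR] (f : RR -> R) /\
  exists M : R, forall x : R, 0 < x -> `|f x| <= M.

(** Extended-real pairing, to which Tonelli's theorem and monotone convergence apply
    before finiteness is known. *)
Definition epairing (nu : {measure set RR -> \bar R}) (f : R -> \bar R) : \bar R :=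
  (\int[nu]_(x in `]0%R, +oo[%classic) f x)%E.

Lemma measurable_pos : measurable (`]0%R, +oo[%classic : set RR).
Proof. exact: measurable_itv. Qed.

Lemma bounded_measurable_integrable nu f : bounded_measurable f ->
  nu.-integrable (`]0%R, +oo[%classic : set RR) (EFin \o f).
Proof.
move=> [mf [M hM]]; apply: measurable_bounded_integrable.
- exact: measurable_pos.
- by rewrite ltey_eq fin_num_measure//; exact: measurable_pos.
- exact: measurable_funS mf.
- exists M; split; first exact: num_real.
  move=> r Mr x /=; rewrite in_itv /= andbT => x0.
  by rewrite (le_trans (hM _ x0))// ltW.
Qed.

Lemma pairingE nu f : bounded_measurable f ->
  (pairing nu f)%:E = epairing nu (EFin \o f).
Proof.
move=> bf; rewrite /pairing /Rintegral fineK//.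
by apply: integrable_fin_num; [exact: measurable_pos|exact: bounded_measurable_integrable].
Qed.

Lemma eq_pairing nu f g : (forall x, 0 < x -> f x = g x) ->
  pairing nu f = pairing nu g.
Proof.
move=> fg; apply: eq_Rintegral => x; rewrite inE/= in_itv/= andbT => x0.
exact: fg.
Qed.

Lemma epairing_ge0 nu (f : R -> \bar R) :
  (forall x, 0 < x -> (0 <= f x)%E) -> (0 <= epairing nu f)%E.
Proof.
by move=> f0; apply: integral_ge0 => x /=; rewrite in_itv/= andbT => /f0.
Qed.

Lemma pairing_ge0 nu f : (forall x, 0 < x -> 0 <= f x) -> 0 <= pairing nu f.
Proof.
by move=> f0; apply: Rintegral_ge0 => x /=; rewrite in_itv/= andbT => /f0.
Qed.

Lemma le_pairing nu f g : bounded_measurable f -> bounded_measurable g ->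
  (forall x, 0 < x -> f x <= g x) -> pairing nu f <= pairing nu g.
Proof.
move=> bf bg fg; apply: le_Rintegral.
- exact: measurable_pos.
- exact: bounded_measurable_integrable.
- exact: bounded_measurable_integrable.
- by move=> x /=; rewrite in_itv/= andbT => /fg.
Qed.

Lemma bounded_measurable_cst (c : R) : bounded_measurable (fun=> c).
Proof. by split; [exact: measurable_cst|exists `|c|]. Qed.

Lemma bounded_measurableB f g : bounded_measurable f -> bounded_measurable g ->
  bounded_measurable (fun x => f x - g x).
Proof.
move=> [mf [M hM]] [mg [N hN]]; split; first exact: measurable_funB.
exists (M + N) => x x0; rewrite (le_trans (ler_normB _ _))// lerD//.
  exact: hM.
exact: hN.
Qed.

Lemma bounded_measurableM f g : bounded_measurable f -> bounded_measurable g ->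
  bounded_measurable (fun x => f x * g x).
Proof.
move=> [mf [M hM]] [mg [N hN]]; split; first exact: measurable_funM.
exists (M * N) => x x0; rewrite normrM ler_pM//.
  exact: hM.
exact: hN.
Qed.

Lemma bounded_measurableZ (c : R) f : bounded_measurable f ->
  bounded_measurable (fun x => c * f x).
Proof. by move=> bf; apply: bounded_measurableM => //; exact: bounded_measurable_cst. Qed.

Lemma pairingD nu f g : bounded_measurable f -> bounded_measurable g ->
  pairing nu (fun x => f x + g x) = pairing nu f + pairing nu g.
Proof.
move=> bf bg; rewrite /pairing RintegralD//.
- exact: bounded_measurable_integrable.
- exact: bounded_measurable_integrable.
Qed.

Lemma pairingB nu f g : bounded_measurable f -> bounded_measurable g ->
  pairing nu (fun x => f x - g x) = pairing nu f - pairing nu g.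
Proof.
move=> bf bg; rewrite /pairing RintegralB//.
- exact: bounded_measurable_integrable.
- exact: bounded_measurable_integrable.
Qed.

Lemma pairingZ nu (c : R) f : bounded_measurable f ->
  pairing nu (fun x => c * f x) = c * pairing nu f.
Proof.
move=> bf; rewrite /pairing RintegralZl//.
exact: bounded_measurable_integrable.
Qed.

Lemma pairing_cst nu (c : R) : pairing nu (fun=> c) = c * fine (nu `]0%R, +oo[%classic).
Proof. by rewrite /pairing Rintegral_cst. Qed.

Lemma normr_pairing_le nu f (M : R) : bounded_measurable f ->
  (forall x, 0 < x -> `|f x| <= M) ->
  `|pairing nu f| <= M * fine (nu `]0%R, +oo[%classic).
Proof.
move=> bf fM; rewrite -pairing_cst ler_norml; apply/andP; split.
  rewrite -mulN1r -pairingZ; last exact: bounded_measurable_cst.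
  apply: le_pairing => //.
    by apply: bounded_measurableZ; exact: bounded_measurable_cst.
  by move=> x x0; rewrite mulN1r; have := fM x x0; rewrite ler_norml => /andP[].
apply: le_pairing => //; first exact: bounded_measurable_cst.
by move=> x x0; have := fM x x0; rewrite ler_norml => /andP[].
Qed.

End pairing_theory.

(** * Measurability on the space of integer-valued measures *)

Section state_space_measurability.
Variable R : realType.
Notation RR := (measurableTypeR R).
Notation N := (int_measure R).

Lemma finite_measure_pos (nu : N) (B : set RR) : measurable B ->
  nu B = nu (B `&` `]0, +oo[%classic).
Proof.
move=> mB.
rewrite [LHS](_ : _ = nu ((B `&` `]0, +oo[%classic) `|` (B `&` `]-oo, 0]%classic))); last first.
  congr (nu _); rewrite -setIUr.
  rewrite [X in B `&` X](_ : _ = setT) ?setIT//.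
  by apply/seteqP; split => // x _ /=; rewrite !in_itv/= andbT; case: (ltP 0 x); [left|right].
rewrite measureU//; last 3 first.
- by apply: measurableI => //; exact: measurable_itv.
- by apply: measurableI => //; exact: measurable_itv.
- apply/seteqP; split => // x [[_ /=]]; rewrite in_itv/= andbT => x0 [_].
  by rewrite /= in_itv/= leNgt x0.
rewrite [X in (_ + X)%E](_ : _ = 0%E) ?adde0//.
apply/eqP; rewrite -measure_le0 -(int_measure_neg nu).
apply: le_measure; last exact: subIsetr.
- by rewrite inE; apply: measurableI => //; exact: measurable_itv.
- by rewrite inE; exact: measurable_itv.
Qed.

(** The rays ]c, +oo[ form a pi-system that generates the Borel sets, and the sets
    with a measurable evaluation form a lambda-system. *)
Lemma kernel_of_rays d (X : measurableType d) (D : set X) (k : X -> N) :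
  measurable D ->
  (forall c : R, measurable_fun D (fun x => k x `]c, +oo[%classic)) ->
  forall B : set RR, measurable B -> measurable_fun D (fun x => k x B).
Proof.
move=> mD kc.
pose H := [set B : set RR | measurable B /\ measurable_fun D (fun x => k x B)].
pose G := [set B : set RR | exists c : R, B = `]c, +oo[%classic] `|` [set setT].
suff : (measurable : set (set RR)) `<=` H by move=> GH B mB; have [] := GH B mB.
have kT : measurable_fun D (fun x => k x [set: RR]).
  apply: (eq_measurable_fun (fun x => k x `]0, +oo[%classic)); last exact: kc.
  by move=> x _; rewrite [RHS]finite_measure_pos// setTI.
have -> : (measurable : set (set RR)) = <<s G >>.
  rewrite [LHS]RGenOInfty.measurableE.
  apply/seteqP; split.
    apply: sub_sigma_algebra2 => B [c ->]; by left; exists c.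
  apply: smallest_sub; first exact: smallest_sigma_algebra.
  move=> B [[c ->]|->].
    by apply: sub_gen_smallest; exists c.
  exact: (@measurableT _ (g_sigma_algebraType (@RGenOInfty.G R))).
apply: lambda_system_subset => //.
- move=> A B [[c ->]|->] [[e ->]|->]; rewrite ?setTI ?setIT; [|by left; eexists..|by right].
  left; exists (Num.max c e).
  apply/seteqP; split => x /=; rewrite !in_itv/= !andbT gt_max.
    by move=> [-> ->].
  by move=> /andP[].
- split.
  + by [].
  + by split.
  + move=> A B BA [mA kA] [mB kB]; split; first exact: measurableD.
    apply: (eq_measurable_fun (fun x => k x A - k x B)%E); last exact: emeasurable_funB.
    move=> x _ /=; rewrite measureD// ?ltey_eq ?fin_num_measure//.
    by congr (_ - k x _)%E; rewrite setIidr.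
  + move=> F ndF FH; split.
      by apply: bigcup_measurable => i _; case: (FH i).
    apply: (emeasurable_fun_cvg (fun n x => k x (F n))).
      by move=> i; case: (FH i).
    move=> x _; apply: nondecreasing_cvg_mu => //.
      by move=> i; case: (FH i).
    by apply: bigcup_measurable => i _; case: (FH i).
- by move=> B [[c ->]|->]; split.
Qed.

(** Continuous approximations from below of the indicator of a ray. *)
Definition ramp (c : R) (n : nat) (x : R) : R := Num.min 1 (Num.max 0 (n%:R * (x - c))).

Lemma ramp_ge0 c n x : 0 <= ramp c n x.
Proof. by rewrite le_min ler01/= le_max lexx. Qed.

Lemma ramp_le1 c n x : ramp c n x <= 1.
Proof. by rewrite ge_min lexx. Qed.

Lemma ramp_continuous c n : continuous (ramp c n).
Proof.
move=> x.
have c0 : {for x, continuous (fun y : R => n%:R * (y - c))}.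
  apply: cvgM; first exact: cvg_cst.
  by apply: cvgB; [exact: cvg_id|exact: cvg_cst].
have c1 : {for x, continuous ((cst 0 : R -> R^o) \max (fun y : R => n%:R * (y - c) : R^o))}.
  by apply: continuous_max => //; exact: cvg_cst.
have c2 : {for x, continuous ((cst 1 : R -> R^o) \min ((cst 0 : R -> R^o) \max (fun y : R => n%:R * (y - c) : R^o)))}.
  by apply: continuous_min => //; exact: cvg_cst.
exact: c2.
Qed.

Lemma bounded_measurable_ramp c n : bounded_measurable (ramp c n).
Proof.
split; first by apply: continuous_measurable_fun; exact: ramp_continuous.
by exists 1 => x _; rewrite ger0_norm ?ramp_ge0// ramp_le1.
Qed.

Lemma ramp_nd c x : {homo (fun n => ramp c n x) : m n / (m <= n)%N >-> m <= n}.
Proof.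
move=> m n mn; rewrite /ramp; apply: le_min2 => //.
have [xc|xc] := leP x c.
  have h k : Num.max 0 (k%:R * (x - c)) = 0 :> R.
    by apply/max_idPl; rewrite mulr_ge0_le0 ?ler0n ?subr_le0.
  by rewrite !h.
apply: le_max2 => //; apply: ler_wpM2r; first by rewrite subr_ge0 ltW.
by rewrite ler_nat.
Qed.

Lemma ramp_cvg c x : ramp c n x @[n --> \oo] --> (\1_(`]c, +oo[%classic) x : R).
Proof.
rewrite indicE; have [cx|cx] := ltP c x.
  rewrite mem_set/=; last by rewrite in_itv/= andbT.
  have xc0 : 0 < x - c by rewrite subr_gt0.
  apply: cvg_near_cst; exists (Num.truncn (x - c)^-1).+1 => //= n /= hn.
  rewrite /ramp; apply/min_idPl; rewrite le_max; apply/orP; right.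
  rewrite -ler_pdivrMr// mul1r ltW// (lt_le_trans (truncnS_gt _))//.
  by rewrite ler_nat.
rewrite memNset/=; last by rewrite in_itv/= andbT; apply/negP; rewrite -leNgt.
apply: cvg_near_cst; near=> n.
rewrite /ramp (_ : Num.max 0 _ = 0); first by apply/min_idPr.
by apply/max_idPl; rewrite mulr_ge0_le0 ?ler0n ?subr_le0.
Unshelve. all: by end_near. Qed.

Lemma pairing_ramp_cvg (nu : N) (c : R) : 0 <= c ->
  (pairing nu (ramp c n))%:E @[n --> \oo] --> nu `]c, +oo[%classic.
Proof.
move=> c0.
have -> : nu `]c, +oo[%classic =
    epairing nu (fun x => (\1_(`]c, +oo[%classic) x)%:E).
  rewrite /epairing integral_indic//.
  congr (nu _); apply/seteqP; split => [x/=|x/= []//].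
  rewrite !in_itv/= !andbT => cx; split => //.
  by rewrite (le_lt_trans c0).
rewrite (_ : (fun n => _) = (fun n => epairing nu (EFin \o ramp c n))); last first.
  by apply/funext => n; rewrite pairingE//; exact: bounded_measurable_ramp.
have mI : measurable (`]0%R, +oo[%classic : set RR) by exact: measurable_itv.
have h := @cvg_monotone_convergence _ _ _ nu _ mI (fun n x => (ramp c n x)%:E).
rewrite /epairing [X in _ --> X](_ : _ =
  (\int[nu]_(x in `]0%R, +oo[%classic) limn (fun n => (ramp c n x)%:E))%E).
  apply: h.
  - move=> n; apply/measurable_EFinP; apply: measurable_funS (proj1 (bounded_measurable_ramp c n)) => //.
  - by move=> n x _; rewrite lee_fin ramp_ge0.
  - by move=> x _ m n mn; rewrite lee_fin; exact: ramp_nd.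
apply: eq_integral => x _; apply/esym/cvg_lim => //.
by apply: cvg_EFin; [exact: nearW|exact: ramp_cvg].
Qed.

(** Pairings with ramps increase to evaluations at rays. *)
Lemma kernel_of_ramps d (X : measurableType d) (D : set X) (k : X -> N) :
  measurable D ->
  (forall (c : R) n, 0 <= c -> measurable_fun D (fun x => pairing (k x) (ramp c n))) ->
  forall B : set RR, measurable B -> measurable_fun D (fun x => k x B).
Proof.
move=> mD kr; apply: kernel_of_rays => // c.
have [c0|c0] := leP 0 c.
  apply: (emeasurable_fun_cvg (fun n x => (pairing (k x) (ramp c n))%:E)).
    by move=> n; apply/measurable_EFinP; exact: kr.
  by move=> x _; exact: pairing_ramp_cvg.
apply: (eq_measurable_fun (fun x => k x `]0, +oo[%classic)).
  move=> x _; rewrite [RHS]finite_measure_pos; last exact: measurable_itv.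
  congr (k x _); apply/seteqP; split => [y/=|y/= []//].
  rewrite !in_itv/= !andbT => y0; split => //.
  by rewrite (lt_trans c0).
apply: (emeasurable_fun_cvg (fun n x => (pairing (k x) (ramp 0 n))%:E)).
  by move=> n; apply/measurable_EFinP; exact: kr.
by move=> x _; exact: pairing_ramp_cvg.
Qed.

Lemma open_weak_subbase (V : set N) : weak_subbase V -> open V.
Proof.
move=> hV; rewrite /open/=.
exists [set V]; last by rewrite bigcup_set1.
move=> _ ->; exists (finmap.fset1 V).
  by move=> W /finmap.fset1P ->; apply/mem_set.
by rewrite set_fset1 bigcap_set1.
Qed.

Lemma continuous_pairing (f : R -> R) :
  (exists M : R, forall x : R, 0 < x -> `|f x| <= M) ->
  (forall x : R, 0 < x -> {for x, continuous f}) ->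
  continuous (fun nu : N => pairing nu f).
Proof.
move=> fM cf; apply/continuousP => U oU; apply: open_weak_subbase.
by exists f, U.
Qed.

Lemma measurable_pairing_continuous (f : R -> R) :
  (exists M : R, forall x : R, 0 < x -> `|f x| <= M) ->
  (forall x : R, 0 < x -> {for x, continuous f}) ->
  measurable_fun [set: N] (fun nu : N => pairing nu f).
Proof.
move=> fM cf; have ct := continuous_pairing fM cf.
apply: (measurability (@RGenOpens.G R)); first exact: RGenOpens.measurableE.
move=> _ [_ [a [b ->] <-]].
rewrite setTI; apply: sub_gen_smallest.
by move/continuousP: ct; apply; exact: interval_open.
Qed.

(** The sigma-algebra on states is the Borel one of the weak topology, for which
    evaluations at Borel sets are not continuous; they are limits of pairings with
    ramps, which are. *)
Lemma measurable_eval (B : set RR) : measurable B ->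
  measurable_fun [set: N] (fun nu : N => nu B).
Proof.
apply: (@kernel_of_ramps _ N setT id) => // c n c0.
apply: measurable_pairing_continuous; first exact: (proj2 (bounded_measurable_ramp c n)).
by move=> x _; exact: ramp_continuous.
Qed.

End state_space_measurability.

(** * Joint measurability in time, age and sample point *)

Section joint_measurability.
Variable R : realType.
Notation RR := (measurableTypeR R).
Notation N := (int_measure R).

(** The preimage of a set splits along the countably many values of the index. *)
Lemma measurable_fun_countable_index d (X : measurableType d)
    d' (T : measurableType d') (idx : X -> nat) (g : nat -> X -> T) :
  (forall k, measurable [set x | idx x = k]) ->
  (forall k, measurable_fun setT (g k)) ->
  measurable_fun setT (fun x => g (idx x) x).
Proof.
move=> mi mg _ B mB; rewrite setTI.
rewrite (_ : _ @^-1` B = \bigcup_k ([set x | idx x = k] `&` (g k @^-1` B))).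
  apply: bigcupT_measurable => k; apply: measurableI; first exact: mi.
  by rewrite -[X in measurable X]setTI; exact: mg.
apply/seteqP; split => [x /= gx|x [k _ [/= <-]]//].
by exists (idx x).
Qed.

Lemma measurable_truncn_eq d (X : measurableType d) (y : X -> R) k :
  measurable_fun setT y -> (forall x, 0 <= y x) ->
  measurable [set x | Num.truncn (y x) = k].
Proof.
move=> my y0.
rewrite (_ : [set x | _] = y @^-1` `[k%:R, k.+1%:R[%classic).
  by rewrite -[X in measurable X]setTI; apply: my => //; exact: measurable_itv.
apply/seteqP; split => x /=; rewrite in_itv/= -truncn_eq//; first by move=> ->.
by move/eqP.
Qed.

(** Time is approximated from the right by the grid of mesh [1 / m.+1]; each
    approximation uses countably many of the variables [X t]. *)
Lemma right_continuous_measurable d (Omega : measurableType d) (X : R -> Omega -> R) :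
  (forall t, 0 <= t -> measurable_fun setT (X t)) ->
  (forall w t, 0 <= t -> X s w @[s --> t^'+] --> X t w) ->
  measurable_fun [set: RR * Omega] (fun z => X (Num.max 0 z.1) z.2).
Proof.
move=> mX rX.
have p0 m : 0 < m.+1%:R :> R by rewrite ltr0n.
(* The successor in [g] makes the grid point lie strictly to the right of the time. *)
pose y (m : nat) (z : RR * Omega) : R := Num.max 0 (z.1 : R) * m.+1%:R.
have y0 m z : 0 <= y m z by rewrite mulr_ge0// le_max lexx.
have my m : measurable_fun [set: RR * Omega] (y m).
  apply: measurable_funM; last exact: measurable_cst.
  apply: measurable_maxr; first exact: measurable_cst.
  exact: measurable_fst.
pose g m (k : nat) (z : RR * Omega) : R := X (k.+1%:R / m.+1%:R) z.2.
apply: (measurable_fun_cvg (h := fun m z => g m (Num.truncn (y m z)) z)).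
  move=> m; apply: measurable_fun_countable_index.
    by move=> k; exact: measurable_truncn_eq.
  move=> k; apply: (@measurableT_comp _ _ _ _ _ _ (X (k.+1%:R / m.+1%:R)) _ snd).
    by apply: mX; rewrite divr_ge0.
  exact: measurable_snd.
move=> z _; rewrite /g.
have t0 : 0 <= Num.max 0 (z.1 : R) by rewrite le_max lexx.
have /cvg_at_rightP := rX z.2 _ t0; apply; split => [m|].
  rewrite ltr_pdivlMr// -/(y m z).
  by have /andP[] := truncn_itv (y0 m z).
set t := Num.max 0 (z.1 : R) in t0 *.
apply: (@squeeze_cvgr _ _ _ _ (fun=> t) (fun m => t + m.+1%:R^-1)).
- apply: nearW => m; apply/andP; split.
    rewrite ler_pdivlMr// -/(y m z) ltW//.
    by have /andP[] := truncn_itv (y0 m z).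
  rewrite ler_pdivrMr// mulrDl mulVf ?gt_eqF// -natr1 lerD2r.
  by have /andP[] := truncn_itv (y0 m z).
- exact: cvg_cst.
- rewrite -[X in _ --> X]addr0; apply: cvgD; first exact: cvg_cst.
  exact: cvg_harmonic.
Qed.

(** Right-continuity in the weak topology makes every pairing with a ramp
    right-continuous, and pairings with ramps determine evaluations. *)
Lemma right_continuous_process_measurable d (Omega : measurableType d) (Y : R -> Omega -> N) :
  (forall t, 0 <= t -> measurable_fun setT (Y t)) ->
  (forall w t, 0 <= t -> Y s w @[s --> t^'+] --> Y t w) ->
  forall B, measurable B ->
  measurable_fun [set: RR * Omega] (fun z => Y (Num.max 0 z.1) z.2 B).
Proof.
move=> mY rY; apply: (@kernel_of_ramps _ _ _ setT
  (fun z : RR * Omega => Y (Num.max 0 z.1) z.2)) => // c n c0.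
apply: (@right_continuous_measurable _ _ (fun t w => pairing (Y t w) (ramp c n))).
  move=> t t0.
  apply: (@measurableT_comp _ _ _ _ _ _ (fun nu : N => pairing nu (ramp c n)) _ (Y t)); last exact: mY.
  apply: measurable_pairing_continuous.
    exact: (proj2 (bounded_measurable_ramp c n)).
  by move=> x _; exact: ramp_continuous.
move=> w t t0.
have ct : continuous (fun nu : N => pairing nu (ramp c n)).
  apply: continuous_pairing.
    exact: (proj2 (bounded_measurable_ramp c n)).
  by move=> x _; exact: ramp_continuous.
exact: (cvg_comp _ _ (rY w t t0) (ct (Y t w))).
Qed.

Section kernel_joint.
Context d (X : measurableType d) (k : X -> {finite_measure set RR -> \bar R}).
Hypothesis mk : forall B, measurable B -> measurable_fun [set: X] (fun x => k x B).

Let kk (x : X) : {measure set RR -> \bar R} := k x.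

HB.instance Definition _ := isKernel.Build _ _ X RR R kk mk.

Import HBNNSimple.

(** Fubini's theorem for a finite kernel without a uniform bound on its mass: for
    indicators, a bound on the kernel at each point is enough. *)
Lemma measurable_epairing_joint (F : X * RR -> \bar R) : (forall z, (0 <= F z)%E) ->
  measurable_fun setT F ->
  measurable_fun setT (fun x => epairing (k x) (fun y => F (x, y))).
Proof.
move=> F0 mF; rewrite /epairing.
have mD : measurable ([set: X] `*` (`]0%R, +oo[%classic : set RR)).
  by apply: measurableX => //; exact: measurable_itv.
pose F' : X * RR -> \bar R := F \_ (setT `*` `]0%R, +oo[%classic).
have mF' : measurable_fun [set: X * RR] F'.
  by apply/(measurable_restrictT _ _).1 => //; exact: measurable_funS mF.
have F'0 z : (0 <= F' z)%E by apply: erestrict_ge0.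
rewrite (_ : (fun x => _) = (fun x => \int[kk x]_y F' (x, y))%E); last first.
  apply/funext => x; rewrite integral_mkcond; apply: eq_integral => y _.
  rewrite /F' !patchE; congr (if _ then _ else _).
  by apply/idP/idP; rewrite !inE/= => //; case.
pose k_ := nnsfun_approx measurableT mF'.
apply: (@measurable_fun_xsection_integral _ _ X RR R F' kk k_).
- by move=> a b ab; exact/nd_nnsfun_approx.
- by move=> z; exact/cvg_nnsfun_approx.
move=> n r.
have mA : measurable (k_ n @^-1` [set r]) by [].
suff kb : forall x, exists M, forall B, measurable B -> (mrestr (kk x) measurableT B < M%:E)%E.
  have [_] := @measurable_prod_subset_xsection_kernel _ _ _ _ _ kk setT measurableT kb _ mA.
  apply: eq_measurable_fun => x _ /=.
  by rewrite /mrestr setIT.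
move=> x; exists (fine (kk x setT) + 1) => B mB.
rewrite /mrestr setIT (@le_lt_trans _ _ (kk x setT))//.
  by apply: le_measure; rewrite ?inE.
by rewrite EFinD fineK ?lteDl ?lte01 ?fin_num_measure.
Qed.

Lemma measurable_epairing (f : R -> \bar R) : (forall y, (0 <= f y)%E) ->
  measurable_fun setT (f : RR -> _) ->
  measurable_fun setT (fun x => epairing (k x) f).
Proof.
move=> f0 mf; apply: (@measurable_epairing_joint (f \o snd)) => //.
  by move=> z; exact: f0.
by apply: measurableT_comp => //.
Qed.

(** The positive and negative parts have finite pairings, so the pairing is the
    difference of two measurable functions. *)
Lemma measurable_pairing_joint (F : X * RR -> R) :
  measurable_fun setT F ->
  (forall x, exists M : R, forall y : R, 0 < y -> `|F (x, y)| <= M) ->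
  measurable_fun setT (fun x => pairing (k x) (fun y => F (x, y))).
Proof.
move=> mF bF.
have mFx x : measurable_fun [set: RR] (fun y : RR => F (x, y)).
  by apply: measurableT_comp => //; exact: measurable_pair1.
have bx x : bounded_measurable (fun y => F (x, y)) by split.
have nm (z : R) : `|Num.max z 0| <= `|z|.
  by case: (leP z 0) => h; rewrite ?normr0.
pose Fp (z : X * RR) := Num.max (F z) 0.
pose Fn (z : X * RR) := Num.max (- F z) 0.
have mFp : measurable_fun setT Fp by apply: measurable_maxr => //; exact: measurable_cst.
have mFn : measurable_fun setT Fn.
  by apply: measurable_maxr; [exact: measurable_funN|exact: measurable_cst].
have bp x : bounded_measurable (fun y => Fp (x, y)).
  split; first by apply: measurable_maxr => //; exact: measurable_cst.
  by have [M hM] := bF x; exists M => y y0; apply: le_trans (hM y y0); exact: nm.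
have bn x : bounded_measurable (fun y => Fn (x, y)).
  split; first by apply: measurable_maxr; [exact: measurable_funN|exact: measurable_cst].
  have [M hM] := bF x; exists M => y y0; apply: le_trans (hM y y0).
  by rewrite -[leRHS]normrN; exact: nm.
rewrite (_ : (fun x => _) = (fun x => pairing (k x) (fun y => Fp (x, y)) -
                                     pairing (k x) (fun y => Fn (x, y)))).
  have h (H : X * RR -> R) : measurable_fun setT H -> (forall z, 0 <= H z) ->
      (forall x, bounded_measurable (fun y => H (x, y))) ->
      measurable_fun setT (fun x => pairing (k x) (fun y => H (x, y))).
    move=> mH H0 bH.
    rewrite (_ : (fun x => _) = fine \o (fun x => epairing (k x) (fun y => (H (x, y))%:E))).
      apply: measurableT_comp; first exact: fine_measurable.
      apply: (@measurable_epairing_joint (EFin \o H)) => [z|].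
        by rewrite lee_fin.
      exact/measurable_EFinP.
    by apply/funext => x /=; rewrite -[LHS]/(fine (_%:E)) pairingE.
  by apply: measurable_funB; apply: h => // z; rewrite le_max lexx orbT.
apply/funext => x; rewrite -pairingB//; apply: eq_pairing => y _.
by rewrite /Fp /Fn /Order.max; case: ifP => h1; case: ifP => h2; lra.
Qed.

Lemma measurable_pairing (f : R -> R) : bounded_measurable f ->
  measurable_fun setT (fun x => pairing (k x) f).
Proof.
move=> [mf bf]; apply: (@measurable_pairing_joint (f \o snd)).
  by apply: measurableT_comp.
by move=> x; exact: bf.
Qed.

End kernel_joint.

End joint_measurability.

Section bounded_support.
Variable R : realType.
Notation RR := (measurableTypeR R).
Notation N := (int_measure R).

(** A decreasing sequence of integers that tends to 0 is eventually 0. *)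
Lemma int_measure_bounded_support (nu : N) :
  exists2 M : R, 0 <= M & nu `]M, +oo[%classic = 0%E.
Proof.
have : nu `](n%:R : R), +oo[%classic @[n --> \oo] --> 0%E.
  have <- : nu (\bigcap_n `](n%:R : R), +oo[%classic) = 0%E.
    rewrite [X in nu X](_ : _ = set0) ?measure0//.
    apply/seteqP; split => // x /(_ (Num.truncn x).+1 I)/=.
    by rewrite in_itv/= andbT ltNge (ltW (truncnS_gt _)).
  apply: nonincreasing_cvg_mu.
  - by rewrite ltey_eq fin_num_measure//; exact: measurable_itv.
  - by move=> i; exact: measurable_itv.
  - by apply: bigcapT_measurable => i; exact: measurable_itv.
  - move=> m n mn; apply/subsetPset => x /=; rewrite !in_itv/= !andbT.
    by apply: le_lt_trans; rewrite ler_nat.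
move=> /fine_cvgP[_] /cvgr0Pnorm_lt /(_ 1 ltr01) [n _ /(_ n (leqnn n))/=].
have [k hk] := int_measure_nat nu (measurable_itv (Interval (BRight (n%:R : R)) +oo%O)).
move=> h; exists n%:R => //; move: h; rewrite hk/= ger0_norm// (ltr_nat R k 1) ltnS leqn0.
by move=> /eqP ->.
Qed.

End bounded_support.

(** * Generating functions near one *)

Section power_series_at_one.
Variable R : realType.
Implicit Types (c : nat -> R).

(** The gap between [r] and [K] pays for the factor [i.+1] of a termwise derivative. *)
Lemma exprSB_ge (r K : R) (i : nat) : 0 <= r -> r <= K ->
  i.+1%:R * r ^+ i * (K - r) <= K ^+ i.+1 - r ^+ i.+1.
Proof.
move=> r0 rK; have K0 : 0 <= K by exact: le_trans rK.
elim: i => [|i IH]; first by rewrite expr0 mulr1 mul1r !expr1.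
rewrite (_ : K ^+ i.+2 - _ = K * (K ^+ i.+1 - r ^+ i.+1) + r ^+ i.+1 * (K - r)); last first.
  by rewrite (exprS K i.+1) (exprS r i.+1); ring.
rewrite -natr1 mulrDl mul1r [leLHS]mulrDl lerD2r.
rewrite exprS mulrCA -!mulrA.
rewrite (le_trans (y := r * (K ^+ i.+1 - r ^+ i.+1)))//.
  by rewrite ler_wpM2l// mulrA.
by rewrite -exprS; apply: ler_wpM2r => //; rewrite subr_ge0 lerXn2r// nnegrE.
Qed.

Lemma cvg_pseries_diffs c : (forall i, 0 <= c i) ->
  (forall r : R, 0 <= r < 1 -> cvgn (pseries c r)) ->
  forall r : R, 0 <= r < 1 -> cvgn (pseries (pseries_diffs c) r).
Proof.
move=> c0 cc r /andP[r0 r1].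
pose K := (1 + r) / 2.
have rK : r < K by rewrite /K; lra.
have K1 : K < 1 by rewrite /K; lra.
have K0 : 0 <= K by exact/ltW/(le_lt_trans r0).
apply: (@series_le_cvg _ _ (fun i => (K - r)^-1 * (c i.+1 * K ^+ i.+1))).
- by move=> n; rewrite mulr_ge0 ?exprn_ge0// mulr_ge0.
- by move=> n; rewrite mulr_ge0 ?invr_ge0 ?subr_ge0 ?(ltW rK)// mulr_ge0 ?exprn_ge0.
- move=> n; rewrite ler_pdivlMl ?subr_gt0// /pseries_diffs/=.
  rewrite [leLHS](_ : _ = c n.+1 * (n.+1%:R * r ^+ n * (K - r))); last by ring.
  rewrite ler_wpM2l//.
  apply: le_trans (exprSB_ge n r0 (ltW rK)) _.
  by rewrite gerBl exprn_ge0.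
- have := cc K; rewrite K0 K1 => /(_ isT) h.
  have h1 : cvgn (series (fun i => c i.+1 * K ^+ i.+1)).
    move: h; rewrite /pseries -(is_cvg_series_restrict 1) => /cvg_ex[l].
    rewrite -cvg_shiftS => hl; apply/cvg_ex; exists l; move: hl.
    by under eq_fun do rewrite /= big_add1/=.
  exact: is_cvg_seriesZ.
Qed.

Lemma continuous_psum c n : continuous (fun z : R => \sum_(0 <= i < n) c i * z ^+ i).
Proof.
move=> z; elim: n => [|n IH].
  rewrite (_ : (fun _ => _) = (fun=> 0)); first exact: cvg_cst.
  by apply/funext => y; rewrite big_nil.
rewrite (_ : (fun _ => _) = (fun y : R => \sum_(0 <= i < n) c i * y ^+ i + c n * y ^+ n)).
  apply: cvgD => //.
  by apply: cvgM; [exact: cvg_cst|exact: exprn_continuous].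
by apply/funext => y; rewrite big_nat_recr.
Qed.

Lemma psum_le_pseries c r n : (forall i, 0 <= c i) -> 0 <= r ->
  cvgn (pseries c r) -> \sum_(0 <= i < n) c i * r ^+ i <= limn (pseries c r).
Proof.
move=> c0 r0 cr; apply: (nondecreasing_cvgn_le _ cr n).
by apply: nondecreasing_series => i _ _; rewrite mulr_ge0// exprn_ge0.
Qed.

(** A partial sum is continuous at 1 and bounds the series from below. *)
Lemma pseries_near1_ge c n (e : R) : (forall i, 0 <= c i) ->
  (forall r : R, 0 <= r < 1 -> cvgn (pseries c r)) -> 0 < e ->
  \forall z \near 1^'-, \sum_(0 <= i < n) c i - e <= limn (pseries c z).
Proof.
move=> c0 cc e0; have h := @continuous_psum c n 1.
have {}h : (fun z : R => \sum_(0 <= i < n) c i * z ^+ i) z @[z --> 1^'-] --> \sum_(0 <= i < n) c i.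
  apply: cvg_at_left_filter.
  rewrite (_ : (\sum_(0 <= i < n) c i)%R = \sum_(0 <= i < n) c i * 1 ^+ i)//.
  by apply: eq_bigr => i _; rewrite expr1n mulr1.
have h1 : \forall z \near 1^'-, \sum_(0 <= i < n) c i - e < \sum_(0 <= i < n) c i * z ^+ i.
  by apply: (cvgr_gt _ h); rewrite ltrBlDr ltrDl.
near=> z.
have z0 : 0 <= z by near: z; exact: nbhs_left_ge.
have z1 : z < 1 by near: z; exact: nbhs_left_lt.
apply: (@le_trans _ _ (\sum_(0 <= i < n) c i * z ^+ i)).
  by apply/ltW; near: z.
by apply: psum_le_pseries => //; apply: cc; rewrite z0 z1.
Unshelve. all: by end_near. Qed.

(** Abel's theorem for nonnegative coefficients: partial sums bound the series from
    below near 1, and termwise comparison bounds it from above. *)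
Lemma pseries_cvg_at_left1 c M : (forall i, 0 <= c i) ->
  (forall r : R, 0 <= r < 1 -> cvgn (pseries c r)) ->
  (forall n, \sum_(0 <= i < n) c i <= M) ->
  limn (pseries c z) @[z --> 1^'-] --> limn (series c).
Proof.
move=> c0 cc cM.
have cs : cvgn (series c).
  apply: nondecreasing_is_cvgn; first exact: nondecreasing_series.
  by exists M => _ [n _ <-]; exact: cM.
apply/cvgrPdist_le => e e0.
have [n hn] : exists n, limn (series c) - e / 2 <= series c n.
  have /cvgrPdist_le /(_ (e / 2)) := cs; rewrite divr_gt0// => /(_ isT) [n _ /(_ n (leqnn n)) h].
  exists n; rewrite lerBlDr -lerBlDl.
  by apply: le_trans h; exact: ler_norm.
have e2 : 0 < e / 2 by rewrite divr_gt0.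
have h := pseries_near1_ge n c0 cc e2.
near=> z.
have z0 : 0 <= z by near: z; exact: nbhs_left_ge.
have z1 : z < 1 by near: z; exact: nbhs_left_lt.
have h1 : limn (pseries c z) <= limn (series c).
  apply: limr_le; first by apply: cc; rewrite z0.
  apply: nearW => k; apply: (le_trans _ (nondecreasing_cvgn_le _ cs k)); last first.
    exact: nondecreasing_series.
  apply: ler_sum => i _; rewrite ler_piMr// exprn_ile1// ltW//.
have h2 : \sum_(0 <= i < n) c i - e / 2 <= limn (pseries c z) by near: z.
rewrite ger0_norm ?subr_ge0//.
rewrite /series/= in hn.
lra.
Unshelve. all: by end_near. Qed.

End power_series_at_one.

Section probability_generating_function.
Variable R : realType.
Variables (a : nat -> R) (M : R).
Hypotheses (a0 : forall i, 0 <= a i) (a1 : series a @ \oo --> (1 : R)).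
Hypothesis aM : forall n, \sum_(0 <= i < n) i%:R * a i <= M.

Let g (z : R) : R := limn (pseries a z).
Let m : R := limn (series (pseries_diffs a)).

Let diffs0 (c : nat -> R) : (forall i, 0 <= c i) -> forall i, 0 <= pseries_diffs c i.
Proof. by move=> c0 i; rewrite mulr_ge0. Qed.

Lemma pgf_cvg z : 0 <= z <= 1 -> cvgn (pseries a z).
Proof.
move=> /andP[z0 z1]; apply: (@series_le_cvg _ _ a) => //.
- by move=> n; rewrite mulr_ge0 ?exprn_ge0.
- by move=> n; rewrite ler_piMr// exprn_ile1.
- by apply/cvg_ex; exists 1.
Qed.

Let cc0 (r : R) : 0 <= r < 1 -> cvgn (pseries a r).
Proof. by move=> /andP[r0 r1]; apply: pgf_cvg; rewrite r0 ltW. Qed.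

Let cc1 (r : R) : 0 <= r < 1 -> cvgn (pseries (pseries_diffs a) r).
Proof. exact: cvg_pseries_diffs. Qed.

Let cc2 (r : R) : 0 <= r < 1 -> cvgn (pseries (pseries_diffs (pseries_diffs a)) r).
Proof. by apply: cvg_pseries_diffs => //; exact: diffs0. Qed.

Let cc3 (r : R) : 0 <= r < 1 -> cvgn (pseries (pseries_diffs (pseries_diffs (pseries_diffs a))) r).
Proof. by apply: cvg_pseries_diffs => //; do 2 apply: diffs0. Qed.

Lemma pgf_derive1 (z : R) : 0 <= z < 1 ->
  derive1 g z = limn (pseries (pseries_diffs a) z).
Proof.
move=> /andP[z0 z1]; pose K := (1 + z) / 2.
have K01 : 0 <= K < 1 by rewrite /K; apply/andP; split; lra.
have h : is_derive z (1 : R) g (limn (pseries (pseries_diffs a) z)).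
  apply: (@pseries_snd_diffs _ a K z); [exact: cc0|exact: cc1|exact: cc2|].
  by rewrite !ger0_norm//; [rewrite /K; lra|case/andP: K01].
by rewrite derive1E; case: h.
Qed.

Lemma pgf_derive2 (z : R) : 0 < z < 1 ->
  derive1n 2 g z = limn (pseries (pseries_diffs (pseries_diffs a)) z).
Proof.
move=> /andP[z0 z1]; pose K := (1 + z) / 2.
have K01 : 0 <= K < 1 by rewrite /K; apply/andP; split; lra.
have h : is_derive z (1 : R) (fun z : R => limn (pseries (pseries_diffs a) z))
    (limn (pseries (pseries_diffs (pseries_diffs a)) z)).
  apply: (@pseries_snd_diffs _ _ K z); [exact: cc1|exact: cc2|exact: cc3|].
  by rewrite !ger0_norm ?(ltW z0)//; [rewrite /K; lra|case/andP: K01].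
rewrite derive1nS/= derive1E.
have -> : 'D_1 (derive1 g) z = 'D_1 (fun z : R => limn (pseries (pseries_diffs a) z)) z.
  apply: near_eq_derive; near=> y.
  apply: pgf_derive1; apply/andP; split.
    by apply/ltW; near: y; exact: lt_nbhsr.
  by near: y; exact: lt_nbhsl.
by case: h.
Unshelve. all: by end_near. Qed.

Lemma diffs_sum n : \sum_(0 <= i < n) pseries_diffs a i = \sum_(0 <= i < n.+1) i%:R * a i.
Proof. by rewrite big_nat_recl//= mul0r add0r. Qed.

Lemma diffs2_sum n : \sum_(0 <= i < n) pseries_diffs (pseries_diffs a) i =
  \sum_(0 <= i < n.+2) (i * i.-1)%:R * a i.
Proof.
rewrite big_nat_recl//= mul0r add0r big_nat_recl//= muln0 mul0r add0r.
apply: eq_bigr => i _; rewrite /pseries_diffs mulrA; congr (_ * _).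
by rewrite -natrM mulnC.
Qed.

Lemma pgf_mean : lim (derive1 g z @[z --> 1^'-]) = m.
Proof.
apply/cvg_lim => //.
have h : limn (pseries (pseries_diffs a) z) @[z --> 1^'-] --> m.
  apply: (@pseries_cvg_at_left1 _ _ M) => //; first exact: diffs0.
  by move=> n; rewrite diffs_sum.
apply: cvg_trans h; apply: near_eq_cvg; near=> z.
rewrite pgf_derive1//; apply/andP; split.
  by near: z; exact: nbhs_left_ge.
by near: z; exact: nbhs_left_lt.
Unshelve. all: by end_near. Qed.

Let md : cvgn (series (pseries_diffs a)).
Proof.
apply: nondecreasing_is_cvgn; first by apply: nondecreasing_series => *; exact: diffs0.
by exists M => _ [n _ <-]; rewrite /series/= diffs_sum.
Qed.

Lemma mean_cvg : (\sum_(0 <= i < n) i%:R * a i)%R @[n --> \oo] --> m.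
Proof.
rewrite -cvg_shiftS /=.
by under eq_fun do rewrite -diffs_sum; exact: md.
Qed.

(** If the sums were unbounded, partial sums would force the second derivative of the
    generating function to tend to +oo at 1, against the bound on its limit. *)
Lemma pgf_second_moment (K2 : R) :
  (lim ((derive1n 2 g z)%:E @[z --> 1^'-]) <= K2%:E)%E ->
  forall n, \sum_(0 <= i < n) (i * i.-1)%:R * a i <= K2.
Proof.
move=> hK.
pose c := pseries_diffs (pseries_diffs a).
have c0 : forall i, 0 <= c i by do 2 apply: diffs0.
pose F (z : R) : R := limn (pseries c z).
have FE : lim ((derive1n 2 g z)%:E @[z --> 1^'-]) = lim ((F z)%:E @[z --> 1^'-]).
  congr (lim _); apply/seteqP; split; apply: near_eq_cvg; near=> z;
    rewrite pgf_derive2//; apply/andP; split;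
    (near: z; first [exact: nbhs_left_gt|exact: nbhs_left_lt]).
rewrite FE in hK.
have H n : \sum_(0 <= i < n) c i <= K2.
  have [[B hB]|] := pselect (exists B, forall n, \sum_(0 <= i < n) c i <= B).
    have h := pseries_cvg_at_left1 c0 cc2 hB.
    have h' : (F z)%:E @[z --> 1^'-] --> (limn (series c))%:E.
      by apply: cvg_EFin; [exact: nearW|exact: h].
    move: hK; rewrite (cvg_lim _ h')// lee_fin; apply: le_trans.
    apply: (nondecreasing_cvgn_le (u_ := series c)).
      by apply: nondecreasing_series.
    apply: nondecreasing_is_cvgn; first exact: nondecreasing_series.
    by exists B => _ [k _ <-]; exact: hB.
  move=> hB; exfalso.
  have h' : (F z)%:E @[z --> 1^'-] --> +oo%E.
    apply/cvgeyPge => A.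
    have [k hk] : exists k, A + 1 <= \sum_(0 <= i < k) c i.
      apply: contrapT => /forallNP hN; apply: hB; exists (A + 1) => k.
      by have /negP := hN k; rewrite -ltNge => /ltW.
    have h1 := pseries_near1_ge k c0 cc2 ltr01.
    near=> z; rewrite lee_fin.
    apply: (@le_trans _ _ (\sum_(0 <= i < k) c i - 1)); first by rewrite lerBrDr.
    by near: z.
  by move: hK; rewrite (cvg_lim _ h')// leye_eq.
move=> n; apply: (le_trans _ (H n)); rewrite diffs2_sum.
rewrite [leRHS](@big_cat_nat _ _ _ n)//=; last by rewrite -addn2 leq_addr.
by rewrite lerDl; apply: sumr_ge0 => i _; rewrite mulr_ge0.
Unshelve. all: by end_near. Qed.

Lemma one_sub_pgf (z : R) : 0 <= z <= 1 ->
  (\sum_(0 <= i < n) a i * (1 - z ^+ i))%R @[n --> \oo] --> 1 - g z.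
Proof.
move=> z01; rewrite (_ : (fun n => _) = series a - pseries a z).
  by apply: cvgB; [exact: a1|exact: pgf_cvg].
apply/funext => n; rewrite /pseries /series/= fctE -sumrB.
by apply: eq_bigr => i _; rewrite mulrBr mulr1.
Qed.

Let expr1B_ge (q : R) i : 0 <= q <= 1 -> 1 - i%:R * q <= (1 - q) ^+ i.
Proof.
move=> /andP[q0 q1]; elim: i => [|i IH]; first by rewrite mul0r subr0 expr0.
rewrite exprS; apply: (@le_trans _ _ ((1 - q) * (1 - i%:R * q))).
  rewrite -natr1 (_ : (1 - q) * _ = 1 - (i%:R + 1) * q + i%:R * q ^+ 2); last by ring.
  by rewrite lerDl mulr_ge0// sqr_ge0.
by rewrite ler_wpM2l// subr_ge0.
Qed.

Let expr1B_le (q : R) i : 0 <= q <= 1 ->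
  (1 - q) ^+ i <= 1 - i%:R * q + (i * i.-1)%:R * q ^+ 2.
Proof.
move=> q01; have /andP[q0 q1] := q01.
elim: i => [|i IH]; first by rewrite !mul0r subr0 expr0 addr0.
rewrite exprS; apply: (le_trans (ler_wpM2l _ IH)); first by rewrite subr_ge0.
case: i {IH} => [|i]; first by rewrite /= !muln0 !mul0r subr0 !addr0 mulr1 mul1r.
rewrite /= !natrM -(natr1 i.+1) -(natr1 i).
have i0 : 0 <= i%:R :> R by [].
move: (i%:R) i0 => x x0.
rewrite -subr_ge0 (_ : _ - _ = (x + 1) * q ^+ 2 + (x + 1) * x * q ^+ 3); last by ring.
by rewrite addr_ge0// mulr_ge0 ?exprn_ge0// ?mulr_ge0// addr_ge0.
Qed.

(** Bernoulli's inequality, term by term. *)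
Lemma pgf_le (q : R) : 0 <= q <= 1 -> 1 - g (1 - q) <= m * q.
Proof.
move=> q01; have /andP[q0 q1] := q01.
have h : 0 <= 1 - q <= 1 by apply/andP; split; lra.
have h2 : (\sum_(0 <= i < n) i%:R * a i) * q @[n --> \oo] --> m * q.
  by apply: cvgM; [exact: mean_cvg|exact: cvg_cst].
apply: ler_cvg_to (one_sub_pgf h) h2 _.
apply: nearW => n; rewrite mulr_suml; apply: ler_sum => i _.
rewrite (mulrC _ (a i)) -mulrA ler_wpM2l//.
by rewrite lerBlDr -lerBlDl expr1B_ge.
Qed.

(** A second-order expansion of [(1 - q) ^+ i], term by term. *)
Lemma pgf_ge (q K2 : R) : 0 <= q <= 1 ->
  (forall n, \sum_(0 <= i < n) (i * i.-1)%:R * a i <= K2) ->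
  m * q - K2 * q ^+ 2 <= 1 - g (1 - q).
Proof.
move=> q01 hK; have /andP[q0 q1] := q01.
have h : 0 <= 1 - q <= 1 by apply/andP; split; lra.
have h2 : (\sum_(0 <= i < n) i%:R * a i) * q - K2 * q ^+ 2 @[n --> \oo] --> m * q - K2 * q ^+ 2.
  by apply: cvgB; [apply: cvgM; [exact: mean_cvg|exact: cvg_cst]|exact: cvg_cst].
apply: ler_cvg_to h2 (one_sub_pgf h) _.
apply: nearW => n.
apply: (@le_trans _ _ (\sum_(0 <= i < n) i%:R * a i * q -
                      (\sum_(0 <= i < n) (i * i.-1)%:R * a i) * q ^+ 2)).
  by rewrite -mulr_suml lerD2l lerN2 ler_wpM2r// sqr_ge0.
rewrite mulr_suml -sumrB; apply: ler_sum => i _.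
rewrite (mulrC _ (a i)) (mulrC _ (a i)) -!mulrA -mulrBr ler_wpM2l//.
have := expr1B_le i q01; lra.
Qed.

Lemma pgf_bounds (z : R) : 0 <= z <= 1 -> 0 <= 1 - g z <= 1.
Proof.
move=> z01; have /andP[z0 z1] := z01.
have cz := pgf_cvg z01.
rewrite subr_ge0 gerBl; apply/andP; split.
  apply: ler_cvg_to cz a1 _; apply: nearW => n; apply: ler_sum => i _.
  by rewrite ler_piMr// exprn_ile1.
apply: limr_ge => //; apply: nearW => n; apply: sumr_ge0 => i _.
by rewrite mulr_ge0// exprn_ge0.
Qed.

End probability_generating_function.

(** * The birth rate and the branching term *)

Section branching_parameters.
Variable R : realType.
Notation RR := (measurableTypeR R).

Lemma C1_pos_measurable (f : R -> R) : C1_pos f -> measurable_fun [set: RR] (f : RR -> R).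
Proof.
move=> [f0 _ cf _ _].
have mI : measurable (`]0%R, +oo[%classic : set RR) by exact: measurable_itv.
have fE : f = f \_ (`]0%R, +oo[%classic : set R).
  apply/funext => x; rewrite patchE; case: ifPn => //.
  by rewrite notin_setE/= in_itv/= andbT => /negP; rewrite -leNgt => /f0.
rewrite fE; apply: (@measurable_restrictT _ _ RR R _ (f : RR -> R) mI).1.
apply: open_continuous_measurable_fun; first exact: interval_open.
by move=> x; rewrite inE/= in_itv/= andbT => /cf[].
Qed.

Lemma C1_pos_bounded (f : R -> R) : C1_pos f -> exists2 M : R, 0 <= M & forall x, `|f x| <= M.
Proof.
move=> [f0 _ _ [M hM] _]; exists M; first exact: le_trans (hM 1 ltr01).
move=> x; have [x0|/f0 ->] := ltP 0 x; first exact: hM.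
by rewrite normr0; exact: le_trans (hM 1 ltr01).
Qed.

Variables (alpha : R -> R) (p : R -> nat -> R).
Hypotheses (Halpha : C1_pos alpha) (Hp : offspring_law p).

Let p_ge0 x i : 0 <= p x i.
Proof. by case: Hp => /(_ i)[_ h _ _ _] _ _ _; exact: h. Qed.

Let p_off x i : x <= 0 -> p x i = 0.
Proof. by case: Hp => /(_ i)[h _ _ _ _] _ _ _; exact: h. Qed.

Let alpha_ge0 x : 0 <= alpha x.
Proof. by case: Halpha. Qed.

Let alpha_off x : x <= 0 -> alpha x = 0.
Proof. by case: Halpha => + _ _ _ _; apply. Qed.

Lemma offspring_mean_bound : exists2 M : R, 0 <= M &
  forall x n, \sum_(0 <= i < n) i%:R * p x i <= M.
Proof.
case: Hp => _ _; set S := ereal_sup _ => Sfin _.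
have hS x n : 0 < x -> ((\sum_(0 <= i < n) i%:R * p x i)%:E <= S)%E.
  move=> x0; apply: (@le_trans _ _ (\sum_(1 <= i <oo) (i%:R * p x i)%:E)%E); last first.
    by apply: ereal_sup_ubound; exists x => //=; rewrite in_itv/= andbT.
  apply: (@le_trans _ _ (\sum_(1 <= i < n) (i%:R * p x i)%:E)%E).
    rewrite sumEFin lee_fin; case: n => [|n]; first by rewrite !big_geq.
    by rewrite big_ltn// mul0r add0r.
  by apply: nneseries_lim_ge => i _ _; rewrite lee_fin mulr_ge0.
have Sge0 : (0 <= S)%E by have := hS 1 0%N ltr01; rewrite big_nil.
exists (fine S); first exact: fine_ge0.
move=> x n; have [x0|x0] := ltP 0 x.
  by rewrite -lee_fin fineK ?hS// ge0_fin_numE.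
by rewrite big1 ?fine_ge0// => i _; rewrite p_off// mulr0.
Qed.

Let gen_off x z : x <= 0 -> gen p x z = 0.
Proof.
move=> x0; rewrite /gen (_ : series _ = cst 0) ?lim_cst//.
by apply/funext => n; rewrite /series/= big1// => i _; rewrite p_off// mul0r.
Qed.

Let gen1_off x : x <= 0 -> gen1 p x = 0.
Proof.
move=> x0; rewrite /gen1 (_ : gen p x = cst 0); last by apply/funext => z; rewrite gen_off.
rewrite (_ : derive1 (cst 0) = cst 0) ?lim_cst//.
by apply/funext => z; rewrite derive1_cst.
Qed.

Let sum1 x : 0 < x -> series (p x) @ \oo --> (1 : R).
Proof. by case: Hp => _ + _ _; apply. Qed.

Lemma gen1_cvg x : (\sum_(0 <= i < n) i%:R * p x i)%R @[n --> \oo] --> gen1 p x.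
Proof.
have [M M0 hM] := offspring_mean_bound.
have [x0|x0] := ltP 0 x.
  rewrite /gen1 (pgf_mean (p_ge0 x) (sum1 x0) (hM x)).
  exact: (mean_cvg (p_ge0 x) (hM x)).
rewrite gen1_off// (_ : (fun n => _) = cst 0); first exact: cvg_cst.
by apply/funext => n; rewrite big1// => i _; rewrite p_off// mulr0.
Qed.

Lemma gen1_ge0 x : 0 <= gen1 p x.
Proof.
rewrite -(cvg_lim _ (@gen1_cvg x))//; apply: limr_ge.
  by apply/cvg_ex; exists (gen1 p x); exact: gen1_cvg.
by apply: nearW => n; apply: sumr_ge0 => i _; rewrite mulr_ge0.
Qed.

Lemma gen1_bounded : exists2 M : R, 0 <= M & forall x, gen1 p x <= M.
Proof.
have [M M0 hM] := offspring_mean_bound; exists M => // x.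
rewrite -(cvg_lim _ (@gen1_cvg x))//; apply: limr_le; last exact: nearW.
by apply/cvg_ex; exists (gen1 p x); exact: gen1_cvg.
Qed.

Lemma gen1_measurable : measurable_fun [set: RR] (gen1 p : RR -> R).
Proof.
apply: (measurable_fun_cvg (h := fun n (x : RR) => \sum_(0 <= i < n) i%:R * p x i)).
  move=> n; apply: measurable_sum => i; apply: measurable_funM; first exact: measurable_cst.
  by apply: C1_pos_measurable; case: Hp.
by move=> x _; exact: gen1_cvg.
Qed.

(** The coefficient of the equation of [pi_t f], and the integrand of the mean
    kernel. *)
Definition birth_rate (x : R) : R := alpha x * gen1 p x.

Lemma birth_rate_measurable : measurable_fun [set: RR] (birth_rate : RR -> R).
Proof.
apply: measurable_funM; last exact: gen1_measurable.
exact: C1_pos_measurable.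
Qed.

Lemma birth_rate_ge0 x : 0 <= birth_rate x.
Proof. by rewrite mulr_ge0 ?gen1_ge0. Qed.

Lemma birth_rate_off x : x <= 0 -> birth_rate x = 0.
Proof. by move=> x0; rewrite /birth_rate alpha_off// mul0r. Qed.

Lemma birth_rate_bounded : exists2 b : R, 0 < b & forall x, birth_rate x <= b.
Proof.
have [A A0 hA] := C1_pos_bounded Halpha.
have [M M0 hM] := gen1_bounded.
exists (A * M + 1); first by rewrite ltr_wpDl// mulr_ge0.
move=> x; apply: (@le_trans _ _ (A * M)); last by rewrite lerDl.
rewrite ler_pM ?gen1_ge0//.
by apply: le_trans (hA x); exact: ler_norm.
Qed.

(** The nonlinear term of the equation of [u_t f]. *)
Definition branching_term (x z : R) : R := alpha x * (1 - gen p x z).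

Lemma branching_term_ge0 x z : 0 <= z <= 1 -> 0 <= branching_term x z.
Proof.
move=> z01; rewrite /branching_term; have [x0|x0] := ltP 0 x; last by rewrite alpha_off// mul0r.
by rewrite mulr_ge0//; case/andP: (pgf_bounds (p_ge0 x) (sum1 x0) z01).
Qed.

Lemma branching_term_le x q : 0 <= q <= 1 -> branching_term x (1 - q) <= birth_rate x * q.
Proof.
move=> q01; rewrite /branching_term; have [x0|x0] := ltP 0 x.
  have [M M0 hM] := offspring_mean_bound.
  rewrite /birth_rate -mulrA ler_wpM2l//.
  rewrite /gen1 (pgf_mean (p_ge0 x) (sum1 x0) (hM x)).
  exact: (pgf_le (p_ge0 x) (sum1 x0) (hM x)).
by rewrite alpha_off// mul0r birth_rate_off// mul0r.
Qed.

Lemma branching_term_bounded : exists2 B : R, 0 <= B &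
  forall x z, 0 <= z <= 1 -> `|branching_term x z| <= B.
Proof.
have [A A0 hA] := C1_pos_bounded Halpha; exists A => // x z z01.
rewrite ger0_norm ?branching_term_ge0// /branching_term.
have [x0|x0] := ltP 0 x; last by rewrite alpha_off// mul0r.
rewrite -[leRHS]mulr1 ler_pM//; try by case/andP: (pgf_bounds (p_ge0 x) (sum1 x0) z01).
by apply: le_trans (hA x); exact: ler_norm.
Qed.

Lemma branching_term_measurable d (T : measurableType d) (D : set T) (x z : T -> R) :
  measurable D -> measurable_fun D x -> measurable_fun D z ->
  (forall t, D t -> 0 <= z t <= 1) ->
  measurable_fun D (fun t => branching_term (x t) (z t)).
Proof.
move=> mD mx mz z01.
have cE (f : R -> R) : C1_pos f -> measurable_fun D (fun t => f (x t)).
  move=> cf; apply: (@measurableT_comp _ _ _ _ _ _ (f : RR -> R)) => //.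
  exact: C1_pos_measurable.
apply: measurable_funM; first exact: cE.
apply: measurable_funB; first exact: measurable_cst.
apply: (measurable_fun_cvg (h := fun n t => \sum_(0 <= i < n) p (x t) i * z t ^+ i)).
  move=> n; apply: measurable_sum => i; apply: measurable_funM.
    by apply: (cE (p ^~ i)); case: Hp.
  exact: measurable_funX.
move=> t Dt; have [x0|x0] := ltP 0 (x t).
  exact: (pgf_cvg (p_ge0 (x t)) (sum1 x0) (z01 t Dt)).
rewrite gen_off// (_ : (fun n => _) = cst 0); first exact: cvg_cst.
by apply/funext => n; rewrite big1// => i _; rewrite p_off// mul0r.
Qed.

(** The loss is quadratic because the second derivative of the generating function is
    bounded; [K] is that bound times a bound on [alpha]. *)
Lemma branching_term_ge :
  (ereal_sup [set gen2 p x | x in `]0%R, +oo[%classic] < +oo)%E ->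
  exists2 K : R, 0 <= K & forall x q, 0 < x -> 0 <= q <= 1 ->
    birth_rate x * q - K * q ^+ 2 <= branching_term x (1 - q).
Proof.
move=> hg.
have [A A0 hA] := C1_pos_bounded Halpha.
have [M M0 hM] := offspring_mean_bound.
set S := ereal_sup _ in hg.
pose K2 := Num.max 0 (fine S).
have K20 : 0 <= K2 by rewrite le_max lexx.
have hS x : 0 < x -> (gen2 p x <= K2%:E)%E.
  move=> x0; have h : (gen2 p x <= S)%E.
    by apply: ereal_sup_ubound; exists x => //=; rewrite in_itv/= andbT.
  apply: (le_trans h); have : (S <= (fine S)%:E)%E.
    by case: S {h K2 K20} hg => //= _; exact: leNye.
  by move/le_trans; apply; rewrite lee_fin le_max lexx orbT.
exists (A * K2); first by rewrite mulr_ge0.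
move=> x q x0 q01.
have hK2 := pgf_second_moment (p_ge0 x) (sum1 x0) (hS x x0).
have h := pgf_ge (p_ge0 x) (sum1 x0) (hM x) q01 hK2.
have hE : gen1 p x = limn (series (pseries_diffs (p x))).
  exact: (pgf_mean (p_ge0 x) (sum1 x0) (hM x)).
apply: (@le_trans _ _ (alpha x * (gen1 p x * q - K2 * q ^+ 2))).
  have h1 : alpha x * (K2 * q ^+ 2) <= A * (K2 * q ^+ 2).
    apply: ler_wpM2r; first by rewrite mulr_ge0// sqr_ge0.
    by apply: le_trans (hA x); exact: ler_norm.
  by rewrite mulrBr /birth_rate -!mulrA lerB.
by rewrite ler_wpM2l// hE.
Qed.

End branching_parameters.

(** * Integration tools *)

Section integration_tools.
Variable R : realType.
Notation RR := (measurableTypeR R).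
Notation mu := (@lebesgue_measure R).

Section tonelli.
Context d1 d2 (T1 : measurableType d1) (T2 : measurableType d2).
Variables (m1 : {sigma_finite_measure set T1 -> \bar R}).
Variables (m2 : {sigma_finite_measure set T2 -> \bar R}).
Variables (A : set T1) (B : set T2) (mA : measurable A) (mB : measurable B).
Variable f : T1 * T2 -> \bar R.
Hypotheses (f0 : forall z, (0 <= f z)%E) (mf : measurable_fun setT f).

Let f' : T1 * T2 -> \bar R := f \_ (A `*` B).

Let mf' : measurable_fun setT f'.
Proof.
apply/(measurable_restrictT _ _).1; first exact: measurableX.
exact: measurable_funS mf.
Qed.

Let f'0 z : (0 <= f' z)%E. Proof. exact: erestrict_ge0. Qed.

Lemma tonelli_on :
  (\int[m1]_(x in A) \int[m2]_(y in B) f (x, y) =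
   \int[m2]_(y in B) \int[m1]_(x in A) f (x, y))%E.
Proof.
have E1 : (\int[m1]_(x in A) \int[m2]_(y in B) f (x, y) =
           \int[m1]_x \int[m2]_y f' (x, y))%E.
  rewrite integral_mkcond; apply: eq_integral => x _.
  rewrite patchE; case: ifPn => xA.
    rewrite integral_mkcond; apply: eq_integral => y _.
    rewrite /f' !patchE; congr (if _ then _ else _).
    apply/idP/idP; rewrite !inE/= => h; last by case: h.
    by split => //; move: xA; rewrite inE.
  rewrite integral0_eq// => y _; rewrite /f' patchE ifN// notin_setE/= => -[xA' _].
  by move: xA; rewrite notin_setE.
have E2 : (\int[m2]_(y in B) \int[m1]_(x in A) f (x, y) =
           \int[m2]_y \int[m1]_x f' (x, y))%E.
  rewrite integral_mkcond; apply: eq_integral => y _.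
  rewrite patchE; case: ifPn => yB.
    rewrite integral_mkcond; apply: eq_integral => x _.
    rewrite /f' !patchE; congr (if _ then _ else _).
    apply/idP/idP; rewrite !inE/= => h; last by case: h.
    by split => //; move: yB; rewrite inE.
  rewrite integral0_eq// => x _; rewrite /f' patchE ifN// notin_setE/= => -[_ yB'].
  by move: yB; rewrite notin_setE.
rewrite E1 E2; exact: (@fubini_tonelli _ _ _ _ _ m1 m2 f').
Qed.

Lemma measurable_integral_on :
  measurable_fun setT (fun x => \int[m2]_(y in B) f (x, y))%E.
Proof.
pose g : T1 * T2 -> \bar R := f \_ (setT `*` B).
have mg : measurable_fun setT g.
  apply/(measurable_restrictT _ _).1; first exact: measurableX.
  exact: measurable_funS mf.
rewrite (_ : (fun x => _) = (fun x => \int[m2]_y g (x, y))%E).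
  by apply: measurable_fun_fubini_tonelli_F => // z; exact: erestrict_ge0.
apply/funext => x; rewrite integral_mkcond; apply: eq_integral => y _.
rewrite /g !patchE; congr (if _ then _ else _).
by apply/idP/idP; rewrite !inE/= => //; case.
Qed.

End tonelli.

Lemma itv_integrable (F : R -> R) (t M : R) :
  measurable_fun (`]0, t]%classic : set RR) (F : RR -> R) ->
  (forall s, 0 < s <= t -> `|F s| <= M) ->
  mu.-integrable `]0, t]%classic (EFin \o F).
Proof.
move=> mF FM; apply: measurable_bounded_integrable.
- exact: measurable_itv.
- by rewrite /= lebesgue_measure_itv/=; case: ifP => // _; rewrite -EFinB ltry.
- exact: mF.
- exists M; split; first exact: num_real.
  move=> r Mr s /=; rewrite in_itv/= => st.
  by rewrite (le_trans (FM _ st))// ltW.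
Qed.

(** Bounded convergence theorem. *)
Lemma Rintegral_cvg d (T : measurableType d) (m : {measure set T -> \bar R})
    (D : set T) (F : nat -> T -> R) (f : T -> R) (M : R) :
  measurable D -> (m D < +oo)%E ->
  (forall n, measurable_fun D (F n)) ->
  (forall n x, D x -> `|F n x| <= M) ->
  (forall x, D x -> F n x @[n --> \oo] --> f x) ->
  \int[m]_(x in D) F n x @[n --> \oo] --> \int[m]_(x in D) f x.
Proof.
move=> mD mDoo mF FM Ff; rewrite /Rintegral.
have M0 x : D x -> 0 <= M by move=> Dx; exact: le_trans (FM 0%N x Dx).
have mf : measurable_fun D f by apply: (measurable_fun_cvg (h := F)).
have fM x : D x -> `|f x| <= M.
  move=> Dx; have h : `|F n x| @[n --> \oo] --> `|f x|.
    by apply: (cvg_comp _ _ (Ff x Dx)); exact: norm_continuous.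
  by apply: (ler_cvg_to h (cvg_cst M)); apply: nearW => n; exact: FM.
have ig : m.-integrable D (EFin \o f).
  apply: measurable_bounded_integrable => //.
  exists M; split; first exact: num_real.
  by move=> r Mr x Dx; rewrite /= (le_trans (fM _ Dx))// ltW.
have igM : m.-integrable D (EFin \o cst M).
  apply: measurable_bounded_integrable => //.
  exists `|M|; split; first exact: num_real.
  by move=> r Mr x Dx; rewrite /= ltW.
apply: fine_cvg; rewrite fineK; last exact: integrable_fin_num.
apply: (@dominated_cvg _ _ _ m D mD (fun n => EFin \o F n) (EFin \o f) (EFin \o cst M)) => //.
- by move=> n; exact/measurable_EFinP.
- by move=> x Dx; apply: cvg_EFin; [exact: nearW|exact: Ff].
Qed.

Lemma measurable_decay (l : R) :
  measurable_fun [set: RR] (fun s : RR => expR (- (l * s)) : R).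
Proof.
apply: measurableT_comp => //; apply: measurable_funN.
by apply: measurable_funM => //; exact: measurable_cst.
Qed.

(** The exponential density of rate [l] has total mass one. *)
Lemma integral_expR_pos_le (l : R) : 0 < l ->
  (\int[mu]_(s in `]0%R, +oo[) (expR (- (l * s)))%:E <= (l^-1)%:E)%E.
Proof.
move=> l0.
have := @integral_exponential_pdf R l l0.
set I := (\int[mu]_(x in _) _)%E => hI.
apply: (@le_trans _ _ (\int[mu]_s ((l^-1)%:E * (exponential_pdf l s)%:E))%E).
  rewrite [leLHS]integral_mkcond; apply: ge0_le_integral => //.
  - by move=> x _; apply: erestrict_ge0 => y _; rewrite lee_fin expR_ge0.
  - apply/(measurable_restrictT _ _).1; first exact: measurable_itv.
    by apply/measurable_EFinP; exact: measurable_funS (measurable_decay l).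
  - apply: measurable_funeM; apply/measurable_EFinP.
    exact: measurable_exponential_pdf.
  - move=> x _; rewrite patchE; case: ifPn => [|_]; last first.
      by rewrite -EFinM lee_fin mulr_ge0// ?invr_ge0 ?(ltW l0)// exponential_pdf_ge0// ltW.
    rewrite inE/= in_itv/= => /andP[x0 _].
    rewrite -EFinM lee_fin exponential_pdfE ?(ltW x0)// mulrA mulVf ?gt_eqF// mul1r.
    by rewrite mulNr.
rewrite ge0_integralZl//; last 3 first.
- by apply/measurable_EFinP; exact: measurable_exponential_pdf.
- by move=> x _; rewrite lee_fin exponential_pdf_ge0// ltW.
- by rewrite lee_fin invr_ge0 ltW.
by rewrite -[X in (_ * X)%E]/I hI mule1.
Qed.

Lemma integral_expR_on_le (l : R) (D : set RR) : 0 < l -> measurable D ->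
  D `<=` `]0, +oo[%classic -> (\int[mu]_(s in D) (expR (- (l * s)))%:E <= (l^-1)%:E)%E.
Proof.
move=> l0 mD D0; apply: le_trans (integral_expR_pos_le l0).
apply: ge0_subset_integral => //.
by apply/measurable_EFinP; exact: measurable_funS (measurable_decay l).
Qed.

Lemma expR_integral_le (l t : R) : 0 < l ->
  \int[mu]_(s in `]0, t]%classic) expR (- (l * s)) <= l^-1.
Proof.
move=> l0.
have h : (\int[mu]_(s in `]0%R, t]) (expR (- (l * s)))%:E <= (l^-1)%:E)%E.
  apply: (integral_expR_on_le l0 (measurable_itv `]0, t])).
  by move=> s /=; rewrite !in_itv/= => /andP[->].
rewrite /Rintegral -lee_fin fineK//.
rewrite ge0_fin_numE; first by apply: le_lt_trans h _; rewrite ltry.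
by apply: integral_ge0 => x _; rewrite lee_fin expR_ge0.
Qed.

End integration_tools.

(** * Locally bounded functions and time convolutions *)

Section locally_bounded_functions.
Variable R : realType.
Notation RR := (measurableTypeR R).
Notation mu := (@lebesgue_measure R).
Implicit Types (v w : R -> R -> R) (c : R -> R).

Definition time_bounded c :=
  measurable_fun (`[0, +oo[%classic : set RR) (c : RR -> R) /\
  forall T : R, exists M : R, forall t : R, 0 <= t <= T -> `|c t| <= M.

Let measurable_nonneg_time : measurable [set tx : RR * RR | 0 <= tx.1].
Proof.
rewrite (_ : [set tx : RR * RR | _] = setT `&` fst @^-1` (`[0, +oo[%classic : set RR)).
  by apply: (@measurable_fst _ _ RR RR) => //; exact: measurable_itv.
by rewrite setTI; apply/seteqP; split => z /=; rewrite in_itv/= andbT.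
Qed.

(** Truncating time at 0 yields a function that is measurable on the whole plane. *)
Lemma locally_bounded_ext v : locally_bounded v ->
  measurable_fun [set: RR * RR] (fun z => v (Num.max 0 z.1) z.2).
Proof.
move=> [_ mv _].
apply: (measurable_comp (F := [set tx : RR * RR | 0 <= tx.1])
  (f := fun tx : RR * RR => v tx.1 tx.2) (g := fun z : RR * RR => (Num.max 0 (z.1 : R) : RR, z.2))) => //.
  by move=> _ [z _ <-]/=; rewrite le_max lexx.
apply: measurable_fun_pair; last exact: measurable_snd.
by apply: measurable_maxr; [exact: measurable_cst|exact: measurable_fst].
Qed.

Lemma locally_bounded_section v t : locally_bounded v -> 0 <= t ->
  bounded_measurable (v t).
Proof.
move=> lv t0; split.
  have := locally_bounded_ext lv => h.
  have := @measurableT_comp _ _ _ _ _ _ _ _ (fun x : RR => (t : RR, x)) h.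
  rewrite /comp/= (max_idPr t0); apply.
  by apply: measurable_fun_pair => //; exact: measurable_cst.
have [_ _ /(_ t)[M hM]] := lv; exists M => x _; apply: hM.
by rewrite t0 lexx.
Qed.

Lemma locally_boundedD v w : locally_bounded v -> locally_bounded w ->
  locally_bounded (fun t x => v t x + w t x).
Proof.
move=> [v0 mv bv] [w0 mw bw]; split.
- by move=> t t0 x x0; rewrite v0// w0// addr0.
- exact: measurable_funD.
- move=> T; have [M hM] := bv T; have [K hK] := bw T.
  exists (M + K) => t x tT; rewrite (le_trans (ler_normD _ _))// lerD//.
    exact: hM.
  exact: hK.
Qed.

Lemma locally_boundedM v w : locally_bounded v -> locally_bounded w ->
  locally_bounded (fun t x => v t x * w t x).
Proof.
move=> [v0 mv bv] [w0 mw bw]; split.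
- by move=> t t0 x x0; rewrite v0// mul0r.
- exact: measurable_funM.
- move=> T; have [M hM] := bv T; have [K hK] := bw T.
  exists (M * K) => t x tT; rewrite normrM ler_pM//.
    exact: hM.
  exact: hK.
Qed.

Lemma locally_boundedZ (k : R) v : locally_bounded v ->
  locally_bounded (fun t x => k * v t x).
Proof.
move=> [v0 mv bv]; split.
- by move=> t t0 x x0; rewrite v0// mulr0.
- by apply: measurable_funM => //; exact: measurable_cst.
- move=> T; have [M hM] := bv T.
  by exists (`|k| * M) => t x tT; rewrite normrM ler_wpM2l// hM.
Qed.

Lemma locally_boundedB v w : locally_bounded v -> locally_bounded w ->
  locally_bounded (fun t x => v t x - w t x).
Proof.
move=> lv lw; have := locally_boundedD lv (locally_boundedZ (-1) lw).
congr (locally_bounded _); apply/funext => t; apply/funext => x.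
by rewrite mulN1r.
Qed.

Lemma time_bounded_pairing (nu : {finite_measure set RR -> \bar R}) v :
  locally_bounded v -> time_bounded (fun t => pairing nu (v t)).
Proof.
move=> lv; split.
  apply: (eq_measurable_fun (fun t : RR => pairing nu (v (Num.max 0 t)))).
    by move=> t; rewrite inE/= in_itv/= andbT => t0; rewrite (max_idPr t0).
  apply: (@measurable_funS _ _ _ _ setT) => //.
  have mk : forall B : set RR, measurable B -> measurable_fun [set: RR] (fun x : RR => nu B).
    by move=> B mB; exact: measurable_cst.
  apply: (@measurable_pairing_joint R _ RR (fun=> nu) mk (fun z : RR * RR => v (Num.max 0 z.1) z.2)).
    exact: locally_bounded_ext.
  move=> t; have t0 : 0 <= Num.max 0 t by rewrite le_max lexx.
  by case: (locally_bounded_section lv t0).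
move=> T; have [_ _ /(_ T)[M hM]] := lv.
exists (M * fine (nu `]0, +oo[%classic)) => t tT.
apply: normr_pairing_le; last by move=> x _; exact: hM.
by apply: locally_bounded_section => //; case/andP: tT.
Qed.

Lemma time_boundedZ (k : R) c : time_bounded c -> time_bounded (fun t => k * c t).
Proof.
move=> [mc bc]; split; first by apply: measurable_funM => //; exact: measurable_cst.
move=> T; have [M hM] := bc T.
by exists (`|k| * M) => t tT; rewrite normrM ler_wpM2l// hM.
Qed.

Lemma time_boundedD c c' : time_bounded c -> time_bounded c' ->
  time_bounded (fun t => c t + c' t).
Proof.
move=> [mc bc] [mc' bc']; split; first exact: measurable_funD.
move=> T; have [M hM] := bc T; have [K hK] := bc' T.
by exists (M + K) => t tT; rewrite (le_trans (ler_normD _ _))// lerD ?hM ?hK.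
Qed.

Lemma time_reversal_measurable c t : time_bounded c ->
  measurable_fun (`]0, t]%classic : set RR) (fun s : RR => c (t - s) : R).
Proof.
move=> [mc _]; apply: (measurable_comp (F := `[0, +oo[%classic : set RR)
  (f := c : RR -> R) (g := fun s : RR => (t - s : R) : RR)) => //.
- by move=> y [s /=]; rewrite in_itv/= => /andP[_ st] <-; rewrite in_itv/= andbT subr_ge0.
- by apply: measurable_funB => //; exact: measurable_cst.
Qed.

Lemma shift_measurable (g : R -> R) (x : R) (D : set RR) : measurable D ->
  measurable_fun [set: RR] (g : RR -> R) ->
  measurable_fun D (fun s : RR => g (x - s) : R).
Proof.
move=> mD mg; apply: (@measurableT_comp _ _ _ _ _ _ (g : RR -> R) D (fun s : RR => (x - s : R) : RR)) => //.
by apply: measurable_funB => //; exact: measurable_cst.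
Qed.

(** The integral term of the linear equation: the age [x - s] recedes along a
    characteristic while the remaining time is [t - s]. *)
Definition convt (g c : R -> R) (t x : R) : R :=
  \int[mu]_(s in `]0, t]%classic) (g (x - s) * c (t - s)).

Lemma convt_integrable (g c : R -> R) (B t x : R) :
  measurable_fun [set: RR] (g : RR -> R) -> (forall y, `|g y| <= B) ->
  time_bounded c ->
  mu.-integrable `]0, t]%classic (EFin \o (fun s => g (x - s) * c (t - s))).
Proof.
move=> mg gB bc; have [_ /(_ t)[M hM]] := bc.
apply: (@itv_integrable _ _ _ (B * M)).
  apply: measurable_funM; last exact: time_reversal_measurable.
  by apply: shift_measurable => //; exact: measurable_itv.
move=> s /andP[s0 st]; rewrite normrM ler_pM//; apply: hM.
by rewrite subr_ge0 st/= gerBl ltW.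
Qed.

Lemma le_convt (g c c' : R -> R) (B t x : R) :
  measurable_fun [set: RR] (g : RR -> R) -> (forall y, 0 <= g y <= B) ->
  time_bounded c -> time_bounded c' ->
  (forall r, 0 <= r < t -> c r <= c' r) -> convt g c t x <= convt g c' t x.
Proof.
move=> mg gB bc bc' cc'.
have gB' y : `|g y| <= B by have /andP[g0 g1] := gB y; rewrite ger0_norm.
apply: le_Rintegral.
- exact: measurable_itv.
- exact: (convt_integrable _ _ mg gB').
- exact: (convt_integrable _ _ mg gB').
- move=> s /=; rewrite in_itv/= => /andP[s0 st].
  have /andP[g0 _] := gB (x - s).
  by rewrite ler_wpM2l// cc'// subr_ge0 st ltrBlDr ltrDl.
Qed.

Lemma convtD (g c c' : R -> R) (B t x : R) :
  measurable_fun [set: RR] (g : RR -> R) -> (forall y, `|g y| <= B) ->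
  time_bounded c -> time_bounded c' ->
  convt g (fun r => c r + c' r) t x = convt g c t x + convt g c' t x.
Proof.
move=> mg gB bc bc'; rewrite /convt -RintegralD//.
- by apply: eq_Rintegral => s _; rewrite mulrDr.
- exact: (convt_integrable _ _ mg gB).
- exact: (convt_integrable _ _ mg gB).
Qed.

Lemma convtZ (g c : R -> R) (k B t x : R) :
  measurable_fun [set: RR] (g : RR -> R) -> (forall y, `|g y| <= B) ->
  time_bounded c ->
  convt g (fun r => k * c r) t x = k * convt g c t x.
Proof.
move=> mg gB bc; rewrite /convt -RintegralZl//.
- by apply: eq_Rintegral => s _; rewrite mulrCA.
- exact: (convt_integrable _ _ mg gB).
Qed.

End locally_bounded_functions.

(** * Comparison for the renewal equation *)

Section renewal_comparison.
Variable R : realType.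
Notation RR := (measurableTypeR R).
Notation mu := (@lebesgue_measure R).
Variables (G : probability RR R) (beta : R -> R) (b a : R).
Hypotheses (mbeta : measurable_fun [set: RR] (beta : RR -> R)).
Hypotheses (beta_ge0 : forall x, 0 <= beta x) (beta_le : forall x, beta x <= b).
Hypotheses (beta_off : forall x, x <= 0 -> beta x = 0) (b0 : 0 < b) (a0 : 0 < a).

(** The rate is twice the decay rate [a] used in time. The gap absorbs the length of
    the characteristic over which [expR (a * s)] is integrated
    ([mul_expR_le_weight]). *)
Definition weight (a x : R) : R := expR (2 * a * x).
Local Notation V := (weight a).

Lemma weight_ge0 x : 0 <= V x. Proof. exact: expR_ge0. Qed.

Lemma measurable_weight : measurable_fun [set: RR] (V : RR -> R).
Proof.
by apply: measurableT_comp => //; apply: measurable_funM => //; exact: measurable_cst.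
Qed.

Lemma measurable_expRZ (k : R) : measurable_fun [set: RR] (fun s : RR => expR (k * s) : R).
Proof.
by apply: measurableT_comp => //; apply: measurable_funM => //; exact: measurable_cst.
Qed.

Lemma mul_expR_le_weight (x : R) : 0 < x -> x * expR (a * x) <= a^-1 * V x.
Proof.
move=> x0; rewrite ler_pdivlMl// mulrA.
rewrite /weight (_ : 2 * a * x = a * x + a * x); last by ring.
rewrite expRD ler_wpM2r ?expR_ge0//.
by apply: le_trans (expR_ge1Dx _); rewrite lerDr.
Qed.

Definition exp_conv (g : R -> R) (t x : R) : R :=
  \int[mu]_(s in `]0, t]%classic) (g (x - s) * expR (a * s)).

Lemma exp_conv_integrable (g : R -> R) (B t x : R) :
  measurable_fun [set: RR] (g : RR -> R) -> (forall y, 0 <= g y <= B) ->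
  mu.-integrable `]0, t]%classic (EFin \o (fun s => g (x - s) * expR (a * s))).
Proof.
move=> mg gB; apply: (@itv_integrable _ _ _ (B * expR (a * t))).
  apply: measurable_funM; last exact: measurable_funS (measurable_expRZ a).
  by apply: shift_measurable => //; exact: measurable_itv.
move=> s /andP[s0 st]; have /andP[g0 gle] := gB (x - s).
by rewrite ger0_norm ?mulr_ge0 ?expR_ge0// ler_pM ?expR_ge0// ler_expR ler_pM2l.
Qed.

(** The integrand vanishes for [s >= x], and on ]0, x[ it is at most
    [B * expR (a * x)]. *)
Lemma exp_conv_le (g : R -> R) (B t x : R) :
  measurable_fun [set: RR] (g : RR -> R) -> (forall y, 0 <= g y <= B) ->
  (forall y, y <= 0 -> g y = 0) -> 0 < x ->
  exp_conv g t x <= B * (a^-1 * V x).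
Proof.
move=> mg gB goff x0.
have B0 : 0 <= B by have /andP[h1 h2] := gB 0; exact: le_trans h2.
have k0 : 0 <= B * expR (a * x) by rewrite mulr_ge0 ?expR_ge0.
have i1 : mu.-integrable `]0, t]%classic (EFin \o (\1_(`]0, x[%classic) : R -> R)).
  apply: (@itv_integrable _ _ _ 1).
    by apply: measurable_indic; exact: measurable_itv.
  by move=> s _; rewrite indicE; case: (_ \in _); rewrite ?normr1 ?normr0.
apply: (@le_trans _ _ (\int[mu]_(s in `]0, t]%classic) (B * expR (a * x) * \1_(`]0, x[%classic) s))).
  apply: le_Rintegral.
  - exact: measurable_itv.
  - exact: (exp_conv_integrable _ _ mg gB).
  - rewrite (_ : _ \o _ = (fun s => (B * expR (a * x))%:E * (EFin \o (\1_(`]0%R, x[%classic) : R -> R)) s)%E).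
      by apply: integrableZl => //; exact: measurable_itv.
    by apply/funext => s /=.
  - move=> s /=; rewrite in_itv/= => /andP[s0 st].
    have /andP[g0 gle] := gB (x - s).
    rewrite indicE; have [sx|sx] := ltP s x.
      rewrite mem_set/=; last by rewrite in_itv/= s0.
      by rewrite mulr1 ler_pM ?expR_ge0// ler_expR ler_pM2l// ltW.
    by rewrite goff ?subr_le0// mul0r mulr_ge0.
rewrite RintegralZl//.
rewrite -mulrA ler_wpM2l//; apply: le_trans (mul_expR_le_weight x0).
rewrite mulrC ler_wpM2r ?expR_ge0//.
have mx : mu `]0%R, x[%classic = x%:E.
  by rewrite lebesgue_measure_itv/= lte_fin x0 -EFinB subr0.
have : (\int[mu]_(s in `]0%R, t]%classic) (\1_(`]0%R, x[%classic) s)%:E <= x%:E)%E.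
  rewrite integral_indic//.
  rewrite -mx; apply: le_measure; rewrite ?inE//.
  by apply: measurableI; exact: measurable_itv.
rewrite /Rintegral -lee_fin => h; rewrite fineK//.
rewrite ge0_fin_numE; first by apply: le_lt_trans h _; rewrite ltry.
by apply: integral_ge0 => s _; rewrite lee_fin.
Qed.

Definition total_exp_conv (x : R) : \bar R :=
  (\int[mu]_(s in `]0%R, +oo[%classic) (beta (x - s) * expR (a * s))%:E)%E.

Lemma measurable_total_exp_conv_arg :
  measurable_fun [set: RR * RR] (fun z => (beta (z.1 - z.2) * expR (a * z.2))%:E).
Proof.
apply/measurable_EFinP; apply: measurable_funM.
  apply: (@measurableT_comp _ _ _ _ _ _ (beta : RR -> R) _ (fun z : RR * RR => (z.1 - z.2 : R) : RR)) => //.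
  by apply: measurable_funB; [exact: measurable_fst|exact: measurable_snd].
apply: (@measurableT_comp _ _ _ _ _ _ (fun s : RR => expR (a * s) : R) _ snd).
  exact: measurable_expRZ.
exact: measurable_snd.
Qed.

Lemma measurable_total_exp_conv :
  measurable_fun [set: RR] (total_exp_conv : RR -> \bar R).
Proof.
apply: (@measurable_integral_on _ _ _ RR RR mu _ _
  (fun z => (beta (z.1 - z.2) * expR (a * z.2))%:E)).
- exact: measurable_itv.
- by move=> z; rewrite lee_fin mulr_ge0 ?expR_ge0.
- exact: measurable_total_exp_conv_arg.
Qed.

Lemma total_exp_conv_ge0 x : (0 <= total_exp_conv x)%E.
Proof. by apply: integral_ge0 => s _; rewrite lee_fin mulr_ge0 ?expR_ge0. Qed.

Lemma exp_conv_le_total t x : ((exp_conv beta t x)%:E <= total_exp_conv x)%E.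
Proof.
have bb y : 0 <= beta y <= b by rewrite beta_ge0 beta_le.
rewrite /exp_conv /Rintegral fineK; last first.
  apply: integrable_fin_num; first exact: measurable_itv.
  exact: (exp_conv_integrable _ _ mbeta bb).
apply: ge0_subset_integral.
- exact: measurable_itv.
- exact: measurable_itv.
- apply/measurable_EFinP; apply: measurable_funM.
    by apply: shift_measurable => //; exact: measurable_itv.
  exact: measurable_funS (measurable_expRZ a).
- by move=> s _; rewrite lee_fin mulr_ge0 ?expR_ge0.
- by move=> s /=; rewrite !in_itv/= andbT => /andP[].
Qed.

Definition kernel_rate (s : R) : \bar R :=
  (\int[G]_(x in `]s, +oo[%classic) (beta (x - s))%:E)%E.

(** By Tonelli's theorem this pairing is the exponential moment of rate [a] of the
    mean kernel. *)
Lemma epairing_total_exp_conv : epairing G total_exp_conv =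
  (\int[mu]_(s in `]0%R, +oo[%classic) ((expR (a * s))%:E * kernel_rate s))%E.
Proof.
rewrite /epairing /total_exp_conv.
rewrite (@tonelli_on _ _ _ RR RR G mu _ _ _ _
  (fun z => (beta (z.1 - z.2) * expR (a * z.2))%:E))/=; last 4 first.
- exact: measurable_itv.
- exact: measurable_itv.
- by move=> z; rewrite lee_fin mulr_ge0 ?expR_ge0.
- exact: measurable_total_exp_conv_arg.
apply: eq_integral => s; rewrite inE/= in_itv/= andbT => s0.
have mb (D : set RR) : measurable D -> measurable_fun D (fun x : RR => (beta (x - s))%:E).
  move=> mD; apply/measurable_EFinP.
  apply: (@measurableT_comp _ _ _ _ _ _ (beta : RR -> R) D (fun x : RR => (x - s : R) : RR)) => //.
  by apply: measurable_funB => //; exact: measurable_cst.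
under eq_integral do rewrite mulrC EFinM.
rewrite ge0_integralZl//; last 2 first.
- by apply: mb; exact: measurable_itv.
- by move=> x _; rewrite lee_fin.
congr (_ * _)%E; rewrite /kernel_rate [LHS]integral_mkcond [RHS]integral_mkcond.
apply: eq_integral => x _; rewrite !patchE.
have [xs|xs] := leP x s.
  rewrite beta_off ?subr_le0//; by case: ifP => _; case: ifP.
rewrite !mem_set//= in_itv/= andbT//.
exact: lt_trans xs.
Qed.

(** [phi] is the mass of the mean kernel tilted at rate [a]. *)
Variable phi : R.
Hypothesis Hphi : epairing G total_exp_conv = phi%:E.
Hypothesis phi_lt1 : phi < 1.
Hypothesis HGV : (epairing G (EFin \o V) < +oo)%E.

Let gV : R := fine (epairing G (EFin \o V)).

Let gVE : epairing G (EFin \o V) = gV%:E.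
Proof.
rewrite fineK// ge0_fin_numE//; apply: epairing_ge0 => x _.
by rewrite lee_fin weight_ge0.
Qed.

Let gV_ge0 : 0 <= gV.
Proof. by apply: fine_ge0; apply: epairing_ge0 => x _; rewrite lee_fin weight_ge0. Qed.

Let phi_ge0 : 0 <= phi.
Proof. by rewrite -lee_fin -Hphi; apply: epairing_ge0 => x _; exact: total_exp_conv_ge0. Qed.

(** The bound [K * gV / (1 - phi)] on the weighted supremum, carried through one
    convolution. *)
Definition comparison_constant : R := 1 + (1 - phi)^-1 * gV * (b / a).

Lemma comparison_constant_ge1 : 1 <= comparison_constant.
Proof.
rewrite lerDl; apply: mulr_ge0; last by rewrite divr_ge0// ltW.
by rewrite mulr_ge0// invr_ge0 subr_ge0 ltW.
Qed.

Lemma time_bounded_exp (S : R) : time_bounded (fun r => S * expR (- (a * r))).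
Proof.
split.
  apply: measurable_funM; first exact: measurable_cst.
  rewrite (_ : (fun r : RR => _) = (fun s : RR => expR (- a * s) : R)).
    exact: measurable_funS (measurable_expRZ (- a)).
  by apply/funext => s; rewrite mulNr.
move=> T; exists `|S| => t /andP[t0 _].
rewrite normrM (ger0_norm (expR_ge0 _)) ler_piMr//.
by rewrite -expR0 ler_expR oppr_le0 mulr_ge0// ltW.
Qed.

Lemma convt_exp (g : R -> R) (B S t x : R) :
  measurable_fun [set: RR] (g : RR -> R) -> (forall y, 0 <= g y <= B) ->
  convt g (fun r => S * expR (- (a * r))) t x = S * expR (- (a * t)) * exp_conv g t x.
Proof.
move=> mg gB; rewrite /exp_conv -RintegralZl//; last first.
  exact: (exp_conv_integrable _ _ mg gB).
apply: eq_Rintegral => s _.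
rewrite (_ : - (a * (t - s)) = - (a * t) + a * s); last by ring.
by rewrite expRD; ring.
Qed.

Lemma convt_exp_le (g c : R -> R) (B S t x : R) :
  measurable_fun [set: RR] (g : RR -> R) -> (forall y, 0 <= g y <= B) ->
  (forall y, y <= 0 -> g y = 0) ->
  time_bounded c -> 0 <= S -> 0 < x ->
  (forall r, 0 <= r < t -> c r <= S * expR (- (a * r))) ->
  convt g c t x <= B * S / a * (expR (- (a * t)) * V x).
Proof.
move=> mg gB goff bc S0 x0 cS.
apply: (le_trans (le_convt x mg gB bc (time_bounded_exp S) cS)).
rewrite (convt_exp _ _ _ mg gB).
apply: (@le_trans _ _ (S * expR (- (a * t)) * (B * (a^-1 * V x)))).
  by rewrite ler_wpM2l ?mulr_ge0 ?expR_ge0// exp_conv_le.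
by rewrite le_eqVlt; apply/orP; left; apply/eqP; ring.
Qed.

(** Let [S] be the supremum over [r <= T] of [expR (a * r) * <G, w_r>]. Pairing the
    inequality with [G] gives [S <= K * <G, V> + phi * S], a bound on [S] that does
    not depend on [T]; a second use of the inequality bounds [w] itself. *)
Lemma renewal_comparison (w : R -> R -> R) (K : R) : locally_bounded w -> 0 <= K ->
  (forall t x, 0 <= t -> 0 < x ->
    w t x <= K * (expR (- (a * t)) * V x) + convt beta (fun r => pairing G (w r)) t x) ->
  forall t x, 0 <= t -> 0 < x ->
    w t x <= comparison_constant * K * (expR (- (a * t)) * V x).
Proof.
move=> lw K0 hw T x T0 x0.
have bb y : 0 <= beta y <= b by rewrite beta_ge0 beta_le.
pose c r := pairing G (w r).
have bc : time_bounded c by exact: time_bounded_pairing.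
(* The value 0 keeps the supremum nonnegative. *)
pose E := [set 0] `|` [set c r * expR (a * r) | r in `[0, T]%classic].
have supE : has_sup E.
  split; first by exists 0; left.
  have [_ /(_ T)[M hM]] := bc.
  exists (Num.max 0 (`|M| * expR (a * T))) => y [->|[r /=]]; first by rewrite le_max lexx.
  rewrite in_itv/= => /andP[r0 rT] <-; rewrite le_max; apply/orP; right.
  apply: (@le_trans _ _ (`|c r| * expR (a * r))).
    by rewrite ler_wpM2r ?expR_ge0// ler_norm.
  rewrite ler_pM ?expR_ge0//; last by rewrite ler_expR ler_pM2l.
  by rewrite (le_trans _ (ler_norm M))// hM// r0.
pose S := sup E.
have S0 : 0 <= S by apply: sup_upper_bound => //; left.
have cS r : 0 <= r <= T -> c r <= S * expR (- (a * r)).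
  move=> rT; rewrite expRN ler_pdivlMr ?expR_gt0//.
  by apply: sup_upper_bound => //; right; exists r => //=; rewrite in_itv.
have wS t y : 0 <= t <= T -> 0 < y ->
    w t y <= K * (expR (- (a * t)) * V y) + S * expR (- (a * t)) * exp_conv beta t y.
  move=> /andP[t0 tT] y0; apply: le_trans (hw t y t0 y0) _.
  rewrite lerD2l -(convt_exp _ _ _ mbeta bb).
  apply: (le_convt _ mbeta bb bc); first exact: time_bounded_exp.
  by move=> r /andP[r0 rt]; apply: cS; rewrite r0 (le_trans (ltW rt)).
have cE r : 0 <= r <= T -> c r * expR (a * r) <= K * gV + phi * S.
  move=> rT; have /andP[r0 _] := rT.
  have bw := locally_bounded_section lw r0.
  have mw : measurable_fun [set: RR] (fun y : RR => (Num.max (w r y) 0 : R)).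
    by apply: measurable_maxr; [case: bw|exact: measurable_cst].
  have bm : bounded_measurable (fun y => Num.max (w r y) 0).
    split=> //; have [_ [M hM]] := bw; exists M => y y0; apply: le_trans (hM y y0).
    by case: (leP (w r y) 0) => h; rewrite ?normr0.
  suff : ((c r)%:E <= (K * expR (- (a * r)))%:E * gV%:E + (S * expR (- (a * r)))%:E * phi%:E)%E.
    rewrite -!EFinM -EFinD lee_fin => h.
    apply: (@le_trans _ _ ((K * expR (- (a * r)) * gV + S * expR (- (a * r)) * phi) * expR (a * r))).
      by rewrite ler_wpM2r ?expR_ge0.
    rewrite expRN [leLHS](_ : _ = K * gV + phi * S)//.
    by field; rewrite gt_eqF// expR_gt0.
  apply: (@le_trans _ _ (epairing G (fun y => (Num.max (w r y) 0)%:E))).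
    rewrite -pairingE// lee_fin; apply: le_pairing => // y _.
    by rewrite le_max lexx.
  rewrite -gVE -Hphi.
  have k1 : (0 <= (K * expR (- (a * r)))%:E)%E by rewrite lee_fin mulr_ge0 ?expR_ge0.
  have k2 : (0 <= (S * expR (- (a * r)))%:E)%E by rewrite lee_fin mulr_ge0 ?expR_ge0.
  have mV : measurable_fun (`]0%R, +oo[%classic : set RR) (fun y : RR => (V y)%:E).
    by apply/measurable_EFinP; exact: measurable_funS measurable_weight.
  have mH : measurable_fun (`]0%R, +oo[%classic : set RR) (total_exp_conv : RR -> _).
    exact: measurable_funS measurable_total_exp_conv.
  rewrite /epairing -ge0_integralZl//; last by move=> y _; rewrite lee_fin weight_ge0.
  rewrite -ge0_integralZl//; last by move=> y _; exact: total_exp_conv_ge0.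
  rewrite -ge0_integralD//; last 4 first.
  - by move=> y _; rewrite mule_ge0// lee_fin weight_ge0.
  - exact: measurable_funeM.
  - by move=> y _; rewrite mule_ge0// total_exp_conv_ge0.
  - exact: measurable_funeM.
  apply: ge0_le_integral.
  - exact: measurable_itv.
  - by move=> y _; rewrite lee_fin le_max lexx orbT.
  - by apply/measurable_EFinP; exact: measurable_funS mw.
  - by apply: emeasurable_funD; exact: measurable_funeM.
  - move=> y /=; rewrite in_itv/= andbT => y0.
    apply: (@le_trans _ _ (K * (expR (- (a * r)) * V y) + S * expR (- (a * r)) * exp_conv beta r y)%:E).
      rewrite lee_fin ge_max wS//= addr_ge0 ?mulr_ge0 ?expR_ge0 ?weight_ge0//.
      by apply: Rintegral_ge0 => s _; rewrite mulr_ge0 ?expR_ge0.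
    rewrite EFinD mulrA EFinM leeD2l// EFinM lee_wpmul2l//.
    exact: exp_conv_le_total.
have SK : S <= (1 - phi)^-1 * (K * gV).
  rewrite ler_pdivlMl ?subr_gt0// mulrBl mul1r lerBlDr.
  apply: ge_sup; first by exists 0; left.
  move=> y [->|[r /=]]; first by rewrite addr_ge0// mulr_ge0.
  by rewrite in_itv/= => rT <-; exact: cE.
apply: le_trans (wS T x _ x0) _; first by rewrite T0 lexx.
have h1 := exp_conv_le T mbeta bb beta_off x0.
have e0 := expR_ge0 (- (a * T)).
apply: (@le_trans _ _ (K * (expR (- (a * T)) * V x) +
   (1 - phi)^-1 * (K * gV) * expR (- (a * T)) * (b * (a^-1 * V x)))).
  rewrite lerD2l ler_pM//.
  - by rewrite mulr_ge0.
  - by apply: Rintegral_ge0 => s _; rewrite mulr_ge0 ?expR_ge0.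
  - by rewrite ler_wpM2r.
rewrite /comparison_constant.
by rewrite le_eqVlt; apply/orP; left; apply/eqP; ring.
Qed.

(** With no forcing the comparison gives a maximum principle. *)
Lemma renewal_maximum (w : R -> R -> R) : locally_bounded w ->
  (forall t x, 0 <= t -> 0 < x ->
    w t x <= convt beta (fun r => pairing G (w r)) t x) ->
  forall t x, 0 <= t -> 0 < x -> w t x <= 0.
Proof.
move=> lw hw t x t0 x0.
have := @renewal_comparison w 0 lw (lexx _) _ t x t0 x0.
rewrite mulr0 mul0r; apply => r y r0 y0.
by rewrite mul0r add0r; exact: hw.
Qed.

End renewal_comparison.

(** * Existence for the linear equation *)

Section linear_existence.
Variable R : realType.
Notation RR := (measurableTypeR R).
Notation mu := (@lebesgue_measure R).
Variables (G : probability RR R) (beta : R -> R) (b : R).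
Hypotheses (mbeta : measurable_fun [set: RR] (beta : RR -> R)).
Hypotheses (beta_ge0 : forall x, 0 <= beta x) (beta_le : forall x, beta x <= b).
Hypotheses (b0 : 0 < b).

Let bb y : 0 <= beta y <= b. Proof. by rewrite beta_ge0 beta_le. Qed.
Let bn y : `|beta y| <= b. Proof. by rewrite ger0_norm. Qed.

Lemma time_bounded_ext (c : R -> R) : time_bounded c ->
  measurable_fun [set: RR] (fun r : RR => c (Num.max 0 r) : R).
Proof.
move=> [mc _]; apply: (measurable_comp (F := `[0, +oo[%classic : set RR)
  (f := c : RR -> R) (g := fun s : RR => (Num.max 0 s : R) : RR)) => //.
- by move=> y [s _ <-]/=; rewrite in_itv/= andbT le_max lexx.
- by apply: measurable_maxr => //; exact: measurable_cst.
Qed.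

(** The convolution is written as the integral over the triangle [0 < s <= t] of a
    jointly measurable function. *)
Lemma convt_measurable (c : R -> R) : time_bounded c -> (forall r, 0 <= r -> 0 <= c r) ->
  measurable_fun [set: RR * RR] (fun z => convt beta c z.1 z.2).
Proof.
move=> bc c0.
pose S : set ((RR * RR) * RR) := [set z | 0 < z.2] `&` [set z | z.2 <= z.1.1].
have mS : measurable S.
  have ms (g h : (RR * RR) * RR -> R) : measurable_fun setT g -> measurable_fun setT h ->
      measurable [set z | g z < h z] /\ measurable [set z | g z <= h z].
    move=> mg mh; split.
      have := measurable_fun_ltr mg mh measurableT (Y := [set true]).
      rewrite setTI; exact.
    have := measurable_fun_ler mg mh measurableT (Y := [set true]).
    rewrite setTI; exact.
  apply: measurableI.
    by have [] := ms (cst 0) snd (measurable_cst _) (@measurable_snd _ _ _ _).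
  have m11 : measurable_fun setT (fun z : (RR * RR) * RR => z.1.1).
    by apply: (measurableT_comp (@measurable_fst _ _ RR RR)) => //; exact: measurable_fst.
  by have [] := ms snd (fun z => z.1.1) (@measurable_snd _ _ _ _) m11.
pose F0 (z : (RR * RR) * RR) : \bar R := (beta (z.1.2 - z.2) * c (Num.max 0 (z.1.1 - z.2)))%:E.
have m11 : measurable_fun setT (fun z : (RR * RR) * RR => z.1.1).
  by apply: (measurableT_comp (@measurable_fst _ _ RR RR)) => //; exact: measurable_fst.
have m12 : measurable_fun setT (fun z : (RR * RR) * RR => z.1.2).
  by apply: (measurableT_comp (@measurable_snd _ _ RR RR)) => //; exact: measurable_fst.
have m2 : measurable_fun setT (fun z : (RR * RR) * RR => z.2) by exact: measurable_snd.
have mF0 : measurable_fun setT F0.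
  apply/measurable_EFinP; apply: measurable_funM.
    apply: (@measurableT_comp _ _ _ _ _ _ (beta : RR -> R) _ (fun z : (RR * RR) * RR => (z.1.2 - z.2 : R) : RR)) => //.
    exact: measurable_funB.
  apply: (@measurableT_comp _ _ _ _ _ _ (fun r : RR => c (Num.max 0 r) : R) _ (fun z : (RR * RR) * RR => (z.1.1 - z.2 : R) : RR)).
    exact: time_bounded_ext.
  exact: measurable_funB.
pose F : (RR * RR) * RR -> \bar R := F0 \_ S.
have F00 z : (0 <= F0 z)%E by rewrite lee_fin mulr_ge0// c0// le_max lexx.
have mF : measurable_fun setT F.
  by apply/(measurable_restrictT _ _).1 => //; exact: measurable_funS mF0.
have h : measurable_fun setT (fun z : RR * RR => \int[mu]_s F (z, s))%E.
  apply: (@measurable_fun_fubini_tonelli_F _ _ (RR * RR)%type RR R mu F mF) => z.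
  exact: erestrict_ge0.
rewrite (_ : (fun z => _) = fine \o (fun z : RR * RR => \int[mu]_s F (z, s))%E).
  by apply: measurableT_comp h; exact: fine_measurable.
apply/funext => -[t x]; rewrite /convt/= /Rintegral; congr fine.
rewrite integral_mkcond; apply: eq_integral => s _.
rewrite /F !patchE; have [st|st] := boolP (s \in (`]0, t]%classic : set R)).
  rewrite mem_set; last first.
    by move: st; rewrite inE/= in_itv/= => /andP[? ?]; split.
  move: st; rewrite inE/= in_itv/= => /andP[_ st].
  by rewrite /F0/= (max_idPr _)// subr_ge0.
rewrite memNset//; move: st; rewrite notin_setE/= in_itv/= => h1 [/= h2 h3].
by apply: h1; apply/andP.
Qed.

Variable f : R -> R.
Hypothesis Hf : bounded_borel_pos f.

Let f0 x : 0 <= f x. Proof. by case: Hf. Qed.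
Let mf : measurable_fun [set: RR] (f : RR -> R). Proof. by case: Hf => -[]. Qed.

Definition picard_step (v : R -> R -> R) (t x : R) : R :=
  if 0 < x then f (x - t) + convt beta (fun r => pairing G (v r)) t x else 0.

Fixpoint picard (n : nat) : R -> R -> R :=
  if n is m.+1 then picard_step (picard m) else fun _ _ => 0.

Variable B : R.
Hypothesis (B0 : 0 <= B) (fB : forall x, f x <= B).

Let GT : fine (G `]0, +oo[%classic) <= 1.
Proof.
rewrite -lee_fin fineK ?fin_num_measure//; exact: probability_le1.
Qed.

Let picard_invariant (v : R -> R -> R) :=
  [/\ locally_bounded v, forall t x, 0 <= t -> 0 <= v t x &
     forall t x, 0 <= t -> v t x <= 2 * B * expR (2 * b * t)].

Let pairing_bound v t : picard_invariant v -> 0 <= t ->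
  0 <= pairing G (v t) <= 2 * B * expR (2 * b * t).
Proof.
move=> [lv v0 vB] t0; apply/andP; split; first by apply: pairing_ge0 => x _; exact: v0.
have h : bounded_measurable (v t) by exact: locally_bounded_section.
have := @normr_pairing_le R G (v t) (2 * B * expR (2 * b * t)) h.
have h1 : forall x, 0 < x -> `|v t x| <= 2 * B * expR (2 * b * t).
  by move=> x _; rewrite ger0_norm ?v0// vB.
move=> /(_ h1); move=> h2; apply: le_trans (ler_norm _) _; apply: le_trans h2 _.
by rewrite ler_piMr// !mulr_ge0 ?expR_ge0.
Qed.

(** The growth rate [2 * b] makes the convolution contract the bound by one half. *)
Lemma picardP n : picard_invariant (picard n).
Proof.
elim: n => [|n IH].
  split => [|//|t x _].
    split => //.
    by move=> T; exists 0 => t x _; rewrite normr0.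
  by rewrite /= !mulr_ge0 ?expR_ge0.
have [lv v0 vB] := IH.
have bc := time_bounded_pairing G lv.
have c0 r : 0 <= r -> 0 <= pairing G (picard n r).
  by move=> r0; case/andP: (pairing_bound IH r0).
have st0 t x : 0 <= t -> 0 <= picard_step (picard n) t x.
  move=> t0; rewrite /picard_step; case: ifP => // _; rewrite addr_ge0//.
  apply: Rintegral_ge0 => s /=; rewrite in_itv/= => /andP[_ st].
  by rewrite mulr_ge0// c0// subr_ge0.
have stB t x : 0 <= t -> picard_step (picard n) t x <= 2 * B * expR (2 * b * t).
  move=> t0; rewrite /picard_step; case: ifP => _; last by rewrite !mulr_ge0 ?expR_ge0.
  have e1 : 1 <= expR (2 * b * t) by rewrite -expR0 ler_expR !mulr_ge0 // ltW.
  apply: (@le_trans _ _ (B * expR (2 * b * t) + B * expR (2 * b * t))); last by lra.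
  apply: lerD; first by apply: le_trans (fB _) _; rewrite ler_peMr.
  have b20 : 0 < 2 * b by rewrite mulr_gt0.
  have me : measurable_fun [set: RR] (fun s : RR => expR (- (2 * b * s)) : R).
    apply: measurableT_comp => //; apply: measurable_funN.
    by apply: measurable_funM => //; exact: measurable_cst.
  have ie : mu.-integrable `]0, t]%classic (EFin \o (fun s => expR (- (2 * b * s)))).
    apply: (@itv_integrable _ _ _ 1); first exact: measurable_funS me.
    move=> s /andP[s0 _]; rewrite ger0_norm ?expR_ge0// -expR0 ler_expR oppr_le0.
    by rewrite !mulr_ge0// ltW.
  apply: (@le_trans _ _ (\int[mu]_(s in `]0, t]%classic)
      (b * (2 * B * expR (2 * b * t)) * expR (- (2 * b * s))))).
    apply: le_Rintegral.
    - exact: measurable_itv.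
    - exact: (convt_integrable t x mbeta bn bc).
    - rewrite (_ : _ \o _ = (fun s => (b * (2 * B * expR (2 * b * t)))%:E * (EFin \o (fun s => expR (- (2 * b * s)))) s)%E).
        by apply: integrableZl => //; exact: measurable_itv.
      by apply/funext => s.
    - move=> s /=; rewrite in_itv/= => /andP[_ st].
      have ts : 0 <= t - s by rewrite subr_ge0.
      have /andP[h1 h2] := pairing_bound IH ts.
      apply: (le_trans (ler_pM (beta_ge0 _) h1 (beta_le _) h2)).
      rewrite -!mulrA ler_wpM2l ?(ltW b0)// !ler_wpM2l//.
      by rewrite -expRD ler_expR; lra.
  rewrite RintegralZl//.
  apply: (@le_trans _ _ (b * (2 * B * expR (2 * b * t)) * (2 * b)^-1)).
    rewrite ler_wpM2l ?expR_integral_le// mulr_ge0 ?(ltW b0)// mulr_ge0 ?expR_ge0//.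
    by rewrite mulr_ge0.
  by rewrite le_eqVlt; apply/orP; left; apply/eqP; field; rewrite gt_eqF.
split => //; split.
- by move=> t t0 x x0; rewrite /= /picard_step ltNge x0.
- rewrite /= /picard_step; apply: (@measurable_funS _ _ _ _ setT) => //.
  apply: measurable_fun_ifT.
  + by apply: measurable_fun_ltr; [exact: measurable_cst|exact: measurable_snd].
  + apply: measurable_funD; last exact: convt_measurable.
    apply: (@measurableT_comp _ _ _ _ _ _ (f : RR -> R) _ (fun z : RR * RR => (z.2 - z.1 : R) : RR)) => //.
    by apply: measurable_funB; [exact: measurable_snd|exact: measurable_fst].
  + exact: measurable_cst.
- move=> T; exists (2 * B * expR (2 * b * T)) => t x /andP[t0 tT].
  rewrite ger0_norm ?st0//; apply: le_trans (stB t x t0) _.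
  rewrite ler_wpM2l ?mulr_ge0// ler_expR ler_pM2l// mulr_gt0//.
Qed.

Lemma picard_nd n t x : 0 <= t -> picard n t x <= picard n.+1 t x.
Proof.
elim: n t x => [|n IH] t x t0; first by have [_ + _] := picardP 1; apply.
rewrite -[leLHS]/(picard_step (picard n) t x) -[leRHS]/(picard_step (picard n.+1) t x) /picard_step.
case: ifP => x0; last exact: lexx.
rewrite lerD2l.
have [l1 _ _] := picardP n; have [l2 _ _] := picardP n.+1.
apply: (le_convt x mbeta bb (time_bounded_pairing G l1) (time_bounded_pairing G l2)).
move=> r /andP[r0 _].
apply: (le_pairing G (locally_bounded_section l1 r0) (locally_bounded_section l2 r0)).
by move=> y y0; exact: IH.
Qed.

(** The Picard iterates from 0 increase and stay below [2 * B * expR (2 * b * t)];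
    bounded convergence passes to the limit in the equation. *)
Lemma linear_evolution_exists : exists v : R -> R -> R,
  [/\ locally_bounded v, forall t x, 0 <= t -> 0 <= v t x &
     forall t x, 0 <= t -> 0 < x ->
       v t x = f (x - t) + convt beta (fun r => pairing G (v r)) t x].
Proof.
pose v t x := limn (fun n => picard n t x).
have cv t x : 0 <= t -> picard n t x @[n --> \oo] --> v t x.
  move=> t0; apply: nondecreasing_is_cvgn.
    by apply/nondecreasing_seqP => n; exact: picard_nd.
  exists (2 * B * expR (2 * b * t)) => _ [n _ <-].
  by have [_ _] := picardP n; apply.
have pB n t x T : 0 <= t <= T -> `|picard n t x| <= 2 * B * expR (2 * b * T).
  move=> /andP[t0 tT]; have [_ p0 pB] := picardP n.
  rewrite ger0_norm ?p0//; apply: le_trans (pB t x t0) _.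
  by rewrite ler_wpM2l ?mulr_ge0// ler_expR ler_wpM2l// mulr_ge0// ltW.
have lv : locally_bounded v.
  split.
  - move=> t t0 x x0; apply: (cvg_unique _ (cv t x t0)) => //.
    rewrite (_ : (fun n => _) = cst 0); first exact: cvg_cst.
    by apply/funext => n; have [[+ _ _] _ _] := picardP n; move=> /(_ t t0); apply.
  - apply: (measurable_fun_cvg (h := fun n (z : RR * RR) => picard n z.1 z.2)).
      by move=> n; have [[]] := picardP n.
    by move=> z z0; exact: cv.
  - move=> T; exists (2 * B * expR (2 * b * T)) => t x /andP[t0 tT].
    have h : `|picard n t x| @[n --> \oo] --> `|v t x|.
      by apply: (cvg_comp _ _ (cv t x t0)); exact: norm_continuous.
    apply: (ler_cvg_to h (cvg_cst _)); apply: nearW => n.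
    by apply: pB; rewrite t0.
exists v; split => //.
  move=> t x t0; apply: limr_ge; first by apply/cvg_ex; exists (v t x); exact: cv.
  by apply: nearW => n; have [_ + _] := picardP n; apply.
move=> t x t0 x0.
suff h : picard n t x @[n --> \oo] -->
    f (x - t) + convt beta (fun r => pairing G (v r)) t x.
  exact: (cvg_unique _ (cv t x t0) h).
rewrite -(cvg_shiftS (fun n => picard n t x)) /= /picard_step x0.
apply: cvgD; first exact: cvg_cst.
rewrite /convt.
pose M := 2 * B * expR (2 * b * t).
have M0 : 0 <= M by rewrite !mulr_ge0 ?expR_ge0.
have ms : measurable (`]0, t]%classic : set RR) by exact: measurable_itv.
apply: (@Rintegral_cvg _ _ _ _ _ _ _ (b * M)).
- exact: measurable_itv.
- by rewrite /= lebesgue_measure_itv/=; case: ifP => // _; rewrite -EFinB ltry.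
- move=> n; apply: measurable_funM; first by apply: shift_measurable.
  have [l1 _ _] := picardP n.
  exact: (@time_reversal_measurable R (fun r => pairing G (picard n r)) t (time_bounded_pairing G l1)).
- move=> n s /=; rewrite in_itv/= => /andP[s0 st].
  have ts : 0 <= t - s by rewrite subr_ge0.
  have /andP[h1 h2] := pairing_bound (picardP n) ts.
  rewrite normrM (ger0_norm h1) ler_pM// (le_trans h2)//.
  by rewrite ler_wpM2l ?mulr_ge0// ler_expR ler_wpM2l ?mulr_ge0 ?(ltW b0)// gerBl ltW.
- move=> s /=; rewrite in_itv/= => /andP[s0 st].
  have ts : 0 <= t - s by rewrite subr_ge0.
  apply: cvgM; first exact: cvg_cst.
  apply: (@Rintegral_cvg _ _ _ _ _ _ _ (2 * B * expR (2 * b * (t - s)))).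
  + exact: measurable_itv.
  + by rewrite ltey_eq fin_num_measure//; exact: measurable_itv.
  + move=> n; have [l1 _ _] := picardP n.
    by have [+ _] := locally_bounded_section l1 ts; apply: measurable_funS.
  + by move=> n y _; apply: pB; rewrite ts lexx.
  + by move=> y _; exact: cv.
Qed.

End linear_existence.

(** * The nonlinear equation against the linear one *)

Lemma integrable_addR d (T : measurableType d) (R : realType)
    (m : {measure set T -> \bar R}) (D : set T) (f g : T -> R) : measurable D ->
  m.-integrable D (EFin \o f) -> m.-integrable D (EFin \o g) ->
  m.-integrable D (EFin \o (fun x => f x + g x)).
Proof.
by move=> mD mf mg; have := integrableD mD mf mg.
Qed.

Section weight_bounds.
Variable R : realType.
Notation RR := (measurableTypeR R).

Lemma pairing_le_multiple (nu : {finite_measure set RR -> \bar R}) (f W : R -> R) (k v : R) :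
  bounded_measurable f -> measurable_fun [set: RR] (W : RR -> R) ->
  (forall x, 0 <= W x) -> 0 <= k ->
  (forall x, 0 < x -> 0 <= f x <= k * W x) ->
  epairing nu (EFin \o W) = v%:E -> pairing nu f <= k * v.
Proof.
move=> bf mW W0 k0 fW hv; rewrite -lee_fin pairingE// EFinM -hv.
rewrite /epairing -ge0_integralZl//.
- apply: ge0_le_integral.
  + exact: measurable_itv.
  + by move=> x /=; rewrite in_itv/= andbT lee_fin => /fW /andP[].
  + by apply/measurable_EFinP; case: bf => + _; exact: measurable_funS.
  + by apply: measurable_funeM; apply/measurable_EFinP; exact: measurable_funS mW.
  + by move=> x /=; rewrite in_itv/= andbT -EFinM lee_fin => /fW /andP[].
- by apply/measurable_EFinP; exact: measurable_funS mW.
- by move=> x _; rewrite lee_fin.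
Qed.

Lemma expRN_le_quadratic (y : R) : 0 <= y -> 1 - y <= expR (- y) <= 1 - y + y ^+ 2.
Proof.
move=> y0; apply/andP; split; first by have := expR_ge1Dx (- y).
rewrite expRN.
have y1 : 0 < 1 + y by rewrite ltr_pwDl.
apply: (@le_trans _ _ (1 + y)^-1).
  by rewrite lef_pV2 ?posrE ?expR_gt0// expR_ge1Dx.
rewrite -(ler_pM2r y1) mulVf ?gt_eqF//.
rewrite (_ : _ * (1 + y) = 1 + y ^+ 3); last by ring.
by rewrite lerDl exprn_ge0.
Qed.

End weight_bounds.

Section nonlinear_versus_linear.
Variable R : realType.
Notation RR := (measurableTypeR R).
Notation mu := (@lebesgue_measure R).
Variables (G : probability RR R) (beta : R -> R) (b a : R).
Hypotheses (mbeta : measurable_fun [set: RR] (beta : RR -> R)).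
Hypotheses (beta_ge0 : forall x, 0 <= beta x) (beta_le : forall x, beta x <= b).
Hypotheses (beta_off : forall x, x <= 0 -> beta x = 0) (b0 : 0 < b) (a0 : 0 < a).
Local Notation V := (weight a).
Hypothesis GT : G `]0, +oo[%classic = 1%E.
Variable phi : R.
Hypothesis Hphi : epairing G (total_exp_conv beta a) = phi%:E.
Hypothesis phi_lt1 : phi < 1.
Variables (gV gV2 : R).
Hypothesis HgV : epairing G (EFin \o V) = gV%:E.
Hypothesis HgV2 : epairing G (EFin \o (fun x => V x ^+ 2)) = gV2%:E.

Let HGV : (epairing G (EFin \o V) < +oo)%E. Proof. by rewrite HgV ltry. Qed.

Let bb y : 0 <= beta y <= b. Proof. by rewrite beta_ge0 beta_le. Qed.
Let bn y : `|beta y| <= b. Proof. by rewrite ger0_norm. Qed.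

Local Notation C0 := (comparison_constant G b a phi).

Let mV : measurable_fun [set: RR] (V : RR -> R). Proof. exact: measurable_weight. Qed.

Let mV2 : measurable_fun [set: RR] ((fun x => V x ^+ 2) : RR -> R).
Proof. exact: measurable_funX. Qed.

Let gV_ge0 : 0 <= gV.
Proof.
by rewrite -lee_fin -HgV; apply: epairing_ge0 => x _; rewrite lee_fin weight_ge0.
Qed.

Let gV2_ge0 : 0 <= gV2.
Proof.
by rewrite -lee_fin -HgV2; apply: epairing_ge0 => x _; rewrite lee_fin sqr_ge0.
Qed.

Definition linear_evolution (h : R -> R) (v : R -> R -> R) :=
  [/\ locally_bounded v, forall t x, 0 <= t -> 0 <= v t x &
     forall t x, 0 <= t -> 0 < x ->
       v t x = h (x - t) + convt beta (fun r => pairing G (v r)) t x].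

(** The transport term [h (x - t)] is at most [A * expR (- (a * t)) * V x], because
    [V] grows at twice the rate [a]. *)
Lemma linear_evolution_le (h : R -> R) v A : linear_evolution h v -> 0 <= A ->
  (forall x, x <= 0 -> h x = 0) -> (forall x, 0 < x -> h x <= A * V x) ->
  forall t x, 0 <= t -> 0 < x -> v t x <= C0 * A * (expR (- (a * t)) * V x).
Proof.
move=> [lv v0 vE] A0 hoff hA.
apply: (renewal_comparison mbeta beta_ge0 beta_le beta_off a0 Hphi phi_lt1 HGV lv A0).
move=> t x t0 x0; rewrite vE// lerD2r.
have [xt|xt] := ltP 0 (x - t); last by rewrite hoff// !mulr_ge0 ?expR_ge0.
apply: (le_trans (hA _ xt)); rewrite ler_wpM2l// /weight -expRD ler_expR.
have : 0 <= a * t by rewrite mulr_ge0// ltW.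
lra.
Qed.

Lemma linear_evolutionZ (h : R -> R) v k : 0 <= k -> linear_evolution h v ->
  linear_evolution (fun x => k * h x) (fun t x => k * v t x).
Proof.
move=> k0 [lv v0 vE]; split.
- exact: locally_boundedZ.
- by move=> t x t0; rewrite mulr_ge0// v0.
- move=> t x t0 x0; rewrite vE// mulrDr; congr (_ + _).
  rewrite -(convtZ k t x mbeta bn (time_bounded_pairing G lv)).
  apply: eq_Rintegral => s; rewrite inE/= in_itv/= => /andP[_ st].
  rewrite pairingZ//; apply: locally_bounded_section => //.
  by rewrite subr_ge0.
Qed.

Variables (Psi : R -> R -> R) (K B : R).
Hypothesis mPsi : forall (D : set RR) (x z : RR -> R), measurable D ->
  measurable_fun D x -> measurable_fun D z -> (forall s, D s -> 0 <= z s <= 1) ->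
  measurable_fun D (fun s => Psi (x s) (z s)).
Hypothesis Psi_bounded : forall x z, 0 <= z <= 1 -> `|Psi x z| <= B.
Hypothesis Psi_ge0 : forall x z, 0 <= z <= 1 -> 0 <= Psi x z.
Hypothesis Psi_le : forall x q, 0 <= q <= 1 -> Psi x (1 - q) <= beta x * q.
Hypothesis K0 : 0 <= K.
Hypothesis Psi_ge : forall x q, 0 < x -> 0 <= q <= 1 ->
  beta x * q - K * q ^+ 2 <= Psi x (1 - q).

Definition nonlinear_evolution (h : R -> R) (u : R -> R -> R) :=
  [/\ locally_bounded u, forall t x, 0 <= t -> 0 <= u t x &
     forall t x, 0 <= t -> 0 < x ->
       u t x = h (x - t) + \int[mu]_(s in `]0, t]%classic)
         Psi (x - s) (pairing G (fun y => expR (- u (t - s) y)))].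

Section comparison.
Variables (h : R -> R) (u v : R -> R -> R).
Hypotheses (Hu : nonlinear_evolution h u) (Hv : linear_evolution h v).

Let lu : locally_bounded u. Proof. by case: Hu. Qed.
Let lv : locally_bounded v. Proof. by case: Hv. Qed.
Let u0 t x : 0 <= t -> 0 <= u t x. Proof. by case: Hu => _ + _; apply. Qed.
Let v0 t x : 0 <= t -> 0 <= v t x. Proof. by case: Hv => _ + _; apply. Qed.

Let le1 : locally_bounded (fun t x => 1 - expR (- u t x)).
Proof.
have [uoff mu_ _] := lu; split.
- by move=> t t0 x x0; rewrite uoff// oppr0 expR0 subrr.
- apply: measurable_funB; first exact: measurable_cst.
  by apply: measurableT_comp => //; exact: measurable_funN.
- move=> T; exists 1 => t x /andP[t0 _].
  rewrite ger0_norm ?subr_ge0; first by rewrite gerBl expR_ge0.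
  by rewrite -expR0 ler_expR oppr_le0 u0.
Qed.

Let q t := pairing G (fun y => 1 - expR (- u t y)).

Let bq : time_bounded q. Proof. exact: time_bounded_pairing. Qed.

Let cu t := pairing G (u t).
Let cv t := pairing G (v t).
Let cu2 t := pairing G (fun y => u t y ^+ 2).

Let bcv : time_bounded cv. Proof. exact: time_bounded_pairing. Qed.

Let sq_section (w : R -> R -> R) (t : R) : locally_bounded w -> 0 <= t -> bounded_measurable (fun y => w t y ^+ 2).
Proof.
move=> lw t0; rewrite (_ : (fun y => _) = (fun y => w t y * w t y)).
  by apply: bounded_measurableM; exact: locally_bounded_section.
by apply/funext => y; rewrite expr2.
Qed.

Let pairing1 : pairing G (fun=> 1) = 1.
Proof. by rewrite pairing_cst mul1r; exact: (congr1 fine GT). Qed.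

Let pairing_exp t : 0 <= t -> pairing G (fun y => expR (- u t y)) = 1 - q t.
Proof.
move=> t0; rewrite -{1}pairing1 -pairingB.
- by apply: eq_pairing => y _; rewrite opprB addrC subrK.
- exact: bounded_measurable_cst.
- exact: (locally_bounded_section le1).
Qed.

Let q01 t : 0 <= t -> 0 <= q t <= 1.
Proof.
move=> t0; apply/andP; split.
  by apply: pairing_ge0 => y _; rewrite subr_ge0 -expR0 ler_expR oppr_le0 u0.
rewrite -[leRHS]pairing1; apply: le_pairing.
- exact: (locally_bounded_section le1).
- exact: bounded_measurable_cst.
- by move=> y _; rewrite gerBl expR_ge0.
Qed.

Let q_le t : 0 <= t -> q t <= cu t.
Proof.
move=> t0; apply: le_pairing.
- exact: (locally_bounded_section le1).
- exact: locally_bounded_section.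
- by move=> y _; have /andP[] := expRN_le_quadratic (u0 y t0); lra.
Qed.

Let q_ge t : 0 <= t -> cu t - cu2 t <= q t.
Proof.
move=> t0; rewrite -pairingB; [|exact: locally_bounded_section|exact: sq_section].
apply: le_pairing.
- by apply: bounded_measurableB; [exact: locally_bounded_section|exact: sq_section].
- exact: (locally_bounded_section le1).
- by move=> y _; have /andP[] := expRN_le_quadratic (u0 y t0); lra.
Qed.

Let ts_ge0 (s t : R) : `]0, t]%classic s -> 0 <= t - s.
Proof. by rewrite /= in_itv/= => /andP[_ st]; rewrite subr_ge0. Qed.

Let Pint t x : \int[mu]_(s in `]0, t]%classic)
    Psi (x - s) (pairing G (fun y => expR (- u (t - s) y))) =
  \int[mu]_(s in `]0, t]%classic) Psi (x - s) (1 - q (t - s)).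
Proof.
apply: eq_Rintegral => s; rewrite inE => /ts_ge0 ts.
by rewrite pairing_exp.
Qed.

Let Psi_integrable t x : mu.-integrable `]0, t]%classic
  (EFin \o (fun s => Psi (x - s) (1 - q (t - s)))).
Proof.
have z01 s : `]0, t]%classic s -> 0 <= 1 - q (t - s) <= 1.
  by move=> /ts_ge0 ts; have /andP[h1 h2] := q01 ts; rewrite subr_ge0 h2 gerBl.
apply: (@itv_integrable _ _ _ B).
  apply: mPsi => //.
  - by apply: measurable_funB => //; exact: measurable_cst.
  - apply: measurable_funB; first exact: measurable_cst.
    exact: (@time_reversal_measurable R q t bq).
by move=> s st; apply: Psi_bounded; apply: z01; rewrite /= in_itv.
Qed.

(** The branching term lies below its tangent at 1 and [1 - expR (- y) <= y], so
    [u - v] is dominated by its own renewal convolution. *)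
Lemma nonlinear_le_linear t x : 0 <= t -> 0 < x -> u t x <= v t x.
Proof.
move=> t0 x0; rewrite -subr_le0; move: t x t0 x0.
apply: (renewal_maximum mbeta beta_ge0 beta_le beta_off a0 Hphi phi_lt1 HGV (w := fun t x => u t x - v t x)).
  exact: locally_boundedB.
move=> t x t0 x0; have [_ _ uE] := Hu; have [_ _ vE] := Hv.
have bD : time_bounded (fun r => pairing G (fun x => u r x - v r x)).
  by apply: time_bounded_pairing; exact: locally_boundedB.
rewrite uE// vE// Pint opprD addrACA subrr add0r.
rewrite lerBlDr -(convtD t x mbeta bn bD bcv).
rewrite /convt; apply: le_Rintegral.
- exact: measurable_itv.
- exact: Psi_integrable.
- exact: (convt_integrable t x mbeta bn (time_boundedD bD bcv)).
- move=> s /ts_ge0 ts; apply: le_trans (Psi_le _ (q01 ts)) _.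
  rewrite ler_wpM2l//; apply: (le_trans (q_le ts)).
  rewrite /cv -pairingD;
    [|apply: bounded_measurableB; exact: locally_bounded_section|exact: locally_bounded_section].
  by under [leRHS]eq_pairing do rewrite subrK.
Qed.

(** The difference [v - u] satisfies the renewal inequality with a forcing that is
    quadratic in [v]: it comes from the curvature of the branching term and from that
    of the exponential. Squares of [V] are integrable under [G]. *)
Lemma linear_sub_nonlinear_le A : 0 <= A ->
  (forall t x, 0 <= t -> 0 < x -> v t x <= A * (expR (- (a * t)) * V x)) ->
  forall t x, 0 <= t -> 0 < x ->
  v t x - u t x <= C0 * ((b + K) * (A ^+ 2 * (gV2 + gV ^+ 2)) / a) * (expR (- (a * t)) * V x).
Proof.
move=> A0 vA.
pose E2 := gV2 + gV ^+ 2.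
have E20 : 0 <= E2 by rewrite addr_ge0// sqr_ge0.
pose S := A ^+ 2 * E2.
have S0 : 0 <= S by rewrite mulr_ge0// sqr_ge0.
(* Only positive ages produce a forcing term: for [y <= 0] the birth rate vanishes. *)
pose g (y : R) : R := (b + K) * \1_(`]0, +oo[%classic) y.
have bK : 0 <= b + K by rewrite addr_ge0// ltW.
have gB y : 0 <= g y <= b + K.
  rewrite /g indicE; case: (_ \in _); first by rewrite mulr1 bK lexx.
  by rewrite mulr0 lexx.
have goff y : y <= 0 -> g y = 0.
  by move=> y0; rewrite /g indicE memNset ?mulr0//= in_itv/= andbT; apply/negP; rewrite -leNgt.
have gpos y : 0 < y -> g y = b + K.
  by move=> y0; rewrite /g indicE mem_set ?mulr1//= in_itv/= andbT.
have mg : measurable_fun [set: RR] (g : RR -> R).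
  by apply: measurable_funM; [exact: measurable_cst|apply: measurable_indic; exact: measurable_itv].
have lv2 : locally_bounded (fun t x => v t x ^+ 2).
  by have := locally_boundedM lv lv; congr locally_bounded; do 2 apply/funext => ?; rewrite expr2.
have bcv2 : time_bounded (fun r => cv r ^+ 2).
  have [mc bc] := bcv; split; first exact: measurable_funX.
  by move=> T; have [M hM] := bc T; exists (M ^+ 2) => t tT; rewrite normrX lerXn2r ?nnegrE ?(le_trans _ (hM t tT))// hM.
pose e r := pairing G (fun y => v r y ^+ 2) + cv r ^+ 2.
have be : time_bounded e by apply: time_boundedD => //; exact: time_bounded_pairing.
have cv0 r : 0 <= r -> 0 <= cv r by move=> r0; apply: pairing_ge0 => y _; exact: v0.
have e1 r : 0 <= r -> 0 <= expR (- (a * r)) <= 1.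
  move=> r0; rewrite expR_ge0/= -expR0 ler_expR oppr_le0 mulr_ge0//; exact: ltW.
have eS r : 0 <= r -> e r <= S * expR (- (a * r)).
  move=> r0; have /andP[x0 x1] := e1 r r0.
  set X := expR _ in x0 x1 *.
  have h1 : cv r <= (A * X) * gV.
    apply: (pairing_le_multiple (W := V)) => //; first exact: locally_bounded_section.
    - by move=> y; exact: weight_ge0.
    - by rewrite mulr_ge0.
    - by move=> y y0; rewrite v0//= -mulrA vA.
  have h2 : pairing G (fun y => v r y ^+ 2) <= (A * X) ^+ 2 * gV2.
    apply: (pairing_le_multiple (W := fun x => V x ^+ 2)) => //; first exact: sq_section.
    - by move=> y; exact: sqr_ge0.
    - by rewrite sqr_ge0.
    - move=> y y0; rewrite sqr_ge0/= -exprMn lerXn2r ?nnegrE ?v0//.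
        by rewrite !mulr_ge0 ?weight_ge0.
      by rewrite -mulrA vA.
  have h3 : cv r ^+ 2 <= ((A * X) * gV) ^+ 2.
    by rewrite lerXn2r ?nnegrE ?cv0// !mulr_ge0.
  have XX : X ^+ 2 <= X by rewrite expr2 ler_piMl.
  apply: (le_trans (lerD h2 h3)).
  rewrite (_ : _ + _ = A ^+ 2 * E2 * X ^+ 2); last by rewrite /E2; ring.
  by rewrite ler_wpM2l.
apply: (renewal_comparison mbeta beta_ge0 beta_le beta_off a0 Hphi phi_lt1 HGV (w := fun t x => v t x - u t x)).
- exact: locally_boundedB.
- by rewrite !mulr_ge0// invr_ge0 ltW.
move=> t x t0 x0; have [_ _ uE] := Hu; have [_ _ vE] := Hv.
have hge := @convt_exp_le R a a0 g e (b + K) S t x mg gB goff be S0 x0.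
have {}hge := hge (fun r hr => eS r (proj1 (andP hr))).
apply: (@le_trans _ _ (convt g e t x + convt beta (fun r => pairing G (fun x => v r x - u r x)) t x)); last first.
  by rewrite lerD2r.
rewrite uE// vE// Pint opprD addrACA subrr add0r.
have gn y : `|g y| <= b + K by have /andP[g0 gle] := gB y; rewrite ger0_norm.
have bD : time_bounded (fun r => pairing G (fun x => v r x - u r x)).
  by apply: time_bounded_pairing; exact: locally_boundedB.
have mI : measurable (`]0, t]%classic : set RR) by exact: measurable_itv.
have i12 := integrable_addR mI (convt_integrable t x mg gn be)
  (convt_integrable t x mbeta bn bD).
have i123 := integrable_addR mI i12 (Psi_integrable t x).
rewrite lerBlDr /convt -(RintegralD mI (convt_integrable t x mg gn be)
  (convt_integrable t x mbeta bn bD)) -(RintegralD mI i12 (Psi_integrable t x)).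
apply: le_Rintegral.
- exact: measurable_itv.
- exact: (convt_integrable t x mbeta bn bcv).
- exact: i123.
move=> s /ts_ge0 ts.
set r := t - s in ts *.
have [xs|xs] := ltP 0 (x - s); last first.
  rewrite beta_off// !mul0r addr0 goff// mul0r add0r.
  have /andP[h1 h2] := q01 ts.
  by apply: Psi_ge0; rewrite subr_ge0 h2 gerBl.
rewrite gpos//; have hP := Psi_ge xs (q01 ts).
have hq := q_le ts; have hq' := q_ge ts; have /andP[qq0 qq1] := q01 ts.
have huv : cu r <= cv r.
  apply: le_pairing; [exact: locally_bounded_section..|].
  by move=> y y0; exact: nonlinear_le_linear.
have huv2 : cu2 r <= pairing G (fun y => v r y ^+ 2).
  apply: le_pairing; [exact: sq_section|exact: sq_section|].
  by move=> y y0; rewrite lerXn2r ?nnegrE ?u0 ?v0//; exact: nonlinear_le_linear.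
have hD : pairing G (fun x => v r x - u r x) = cv r - cu r.
  by rewrite -pairingB//; exact: locally_bounded_section.
rewrite hD.
have hb := bb (x - s); move: hb hP; set be' := beta (x - s) => /andP[be0 beb] hP.
have hqv : q r ^+ 2 <= cv r ^+ 2 by rewrite lerXn2r ?nnegrE ?(le_trans hq)// cv0.
have v20 : 0 <= pairing G (fun y => v r y ^+ 2) by apply: pairing_ge0 => y _; exact: sqr_ge0.
have k1 : be' * (cu r - cu2 r) <= be' * q r by rewrite ler_wpM2l.
have k2 : be' * cu2 r <= be' * pairing G (fun y => v r y ^+ 2) by rewrite ler_wpM2l.
have k3 : be' * pairing G (fun y => v r y ^+ 2) <= b * pairing G (fun y => v r y ^+ 2) by rewrite ler_wpM2r.
have k4 : K * q r ^+ 2 <= K * cv r ^+ 2 by rewrite ler_wpM2l.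
have k5 : 0 <= b * cv r ^+ 2 by rewrite mulr_ge0 ?sqr_ge0// ltW.
have k6 : 0 <= K * pairing G (fun y => v r y ^+ 2) by rewrite mulr_ge0.
rewrite /e -/(cv r); lra.
Qed.

End comparison.

End nonlinear_versus_linear.

(** * Moments from Laplace transforms *)

Section laplace_moments.
Context d (T : measurableType d) (R : realType) (P : probability T R).

Lemma measurable_funV_pos (f : T -> R) : (forall w, 0 < f w) ->
  measurable_fun setT f -> measurable_fun setT (fun w => (f w)^-1).
Proof.
move=> f0 mf; rewrite (_ : (fun w => _) = (fun w => expR (- ln (f w)))).
  apply: measurableT_comp => //; apply: measurable_funN.
  by apply: measurableT_comp => //; exact: measurable_ln.
by apply/funext => w; rewrite expRN lnK ?posrE.
Qed.

(** The damped integrands increase to [Y] as [n] grows. *)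
Lemma integral_regularized_le (Y W : T -> R) (th B : R) : 0 < th ->
  measurable_fun setT Y -> measurable_fun setT W ->
  (forall w, 0 <= Y w) -> (forall w, 0 <= W w) ->
  (forall n : nat, (\int[P]_w (Y w / (1 + th / n.+1%:R * W w))%:E <= B%:E)%E) ->
  (\int[P]_w (Y w)%:E <= B%:E)%E.
Proof.
move=> th0 mY mW Y0 W0 hB.
have d0 n w : 0 < 1 + th / n.+1%:R * W w.
  by rewrite ltr_pwDl// mulr_ge0// divr_ge0// ltW.
pose g n w : \bar R := (Y w / (1 + th / n.+1%:R * W w))%:E.
have mg n : measurable_fun setT (g n).
  apply/measurable_EFinP; apply: measurable_funM => //.
  apply: measurable_funV_pos => //.
  apply: measurable_funD; first exact: measurable_cst.
  by apply: measurable_funM => //; exact: measurable_cst.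
have g0 n w : (0 <= g n w)%E by rewrite lee_fin divr_ge0// ltW.
have ndg w : {homo g^~ w : n m / (n <= m)%N >-> (n <= m)%E}.
  move=> n m nm; rewrite lee_fin ler_wpM2l// lef_pV2 ?posrE//.
  rewrite lerD2l ler_wpM2r// ler_wpM2l ?(ltW th0)// lef_pV2 ?posrE//.
  by rewrite ler_nat.
have cg w : g n w @[n --> \oo] --> (Y w)%:E.
  apply: cvg_EFin; first exact: nearW.
  rewrite /= -[X in _ --> X]mulr1 -[in X in _ --> X]invr1.
  apply: cvgM; first exact: cvg_cst.
  apply: cvgV; first by rewrite oner_eq0.
  rewrite -[X in _ --> X]addr0; apply: cvgD; first exact: cvg_cst.
  rewrite -[X in _ --> X](mul0r (W w)); apply: cvgM; last exact: cvg_cst.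
  rewrite -[X in _ --> X](mulr0 th); apply: cvgM; first exact: cvg_cst.
  exact: cvg_harmonic.
have := @cvg_monotone_convergence _ _ _ P setT measurableT g mg (fun n w _ => g0 n w) (fun w _ => ndg w).
rewrite (_ : (\int[P]_(x in setT) _)%E = (\int[P]_w (Y w)%:E)%E); last first.
  by apply: eq_integral => w _; apply/cvg_lim => //; exact: cg.
move=> h; apply: (cvge_le (b := B%:E) _ h); exact: nearW.
Qed.

(** Quadratic for small [y] and linear for large [y], so that it can be integrated
    before second moments are known to exist. *)
Lemma expR_second_order_ge (y : R) :
  y ^+ 2 / (4 * (1 + `|y|)) <= expR (- y) - 1 + y.
Proof.
have n0 : 0 < 1 + `|y| by rewrite ltr_pwDl.
rewrite ler_pdivrMr ?mulr_gt0//.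
have [y2|y2] := leP y 2.
  have h : y ^+ 2 / 4 <= expR (- y) - 1 + y.
    have e1 := expR_ge1Dx (- (y / 2)).
    have e2 : expR (- y) = expR (- (y / 2)) ^+ 2.
      by rewrite expr2 -expRD; congr expR; lra.
    rewrite e2; have h0 : 0 <= 1 - y / 2 by lra.
    have h1 : (1 - y / 2) ^+ 2 <= expR (- (y / 2)) ^+ 2.
      by rewrite lerXn2r// nnegrE expR_ge0.
    have e3 : (1 - y / 2) ^+ 2 = 1 - y + y ^+ 2 / 4 by field.
    lra.
  apply: (@le_trans _ _ (y ^+ 2 / 4 * (4 * (1 + `|y|)))).
    have := mulr_ge0 (sqr_ge0 y) (normr_ge0 y).
    have -> : y ^+ 2 / 4 * (4 * (1 + `|y|)) = y ^+ 2 + y ^+ 2 * `|y| by field.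
    lra.
  by rewrite ler_wpM2r// mulr_ge0// ltW.
have y0 : 0 < y by lra.
rewrite gtr0_norm//.
have e0 := expR_ge0 (- y).
apply: (@le_trans _ _ ((y - 1) * (4 * (1 + y)))); last first.
  by rewrite ler_wpM2r; lra.
have -> : (y - 1) * (4 * (1 + y)) = 4 * y ^+ 2 - 4 by ring.
have : 2 ^+ 2 <= y ^+ 2 by rewrite lerXn2r ?nnegrE//; lra.
lra.
Qed.

Lemma one_sub_expR_ge (y : R) : 0 <= y -> y / (1 + y) <= 1 - expR (- y).
Proof.
move=> y0; have y1 : 0 < 1 + y by rewrite ltr_pwDl.
have : expR (- y) <= (1 + y)^-1.
  by rewrite expRN lef_pV2 ?posrE ?expR_gt0// expR_ge1Dx.
have -> : y / (1 + y) = 1 - (1 + y)^-1 by field; rewrite gt_eqF.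
lra.
Qed.

Variables (X : T -> R) (m C : R).
Hypotheses (mX : measurable_fun setT X) (X0 : forall w, 0 <= X w).
Hypotheses (m0 : 0 <= m) (C0 : 0 <= C).
Hypothesis laplace : forall th : R, 0 < th <= 1 -> exists Phi : R,
  th * m - th ^+ 2 * C <= Phi <= th * m /\
  \int[P]_w expR (- (th * X w)) = expR (- Phi).

Let PT : P setT = 1%E. Proof. exact: probability_setT. Qed.

Let bounded_integrable (F : T -> R) (M : R) : measurable_fun setT F ->
  (forall w, `|F w| <= M) -> P.-integrable setT (EFin \o F).
Proof.
move=> mF FM; apply: measurable_bounded_integrable => //.
  by rewrite ltey_eq fin_num_measure.
exists M; split; first exact: num_real.
by move=> r Mr w _ /=; rewrite (le_trans (FM w))// ltW.
Qed.

Let mexp (th : R) : measurable_fun setT (fun w => expR (- (th * X w))).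
Proof.
apply: measurableT_comp => //; apply: measurable_funN.
by apply: measurable_funM => //; exact: measurable_cst.
Qed.

Let exp01 (th : R) w : 0 < th -> 0 <= expR (- (th * X w)) <= 1.
Proof.
by move=> th0; rewrite expR_ge0/= -expR0 ler_expR oppr_le0 mulr_ge0// ltW.
Qed.

Let iexp (th : R) : 0 < th -> P.-integrable setT (EFin \o (fun w => expR (- (th * X w)))).
Proof.
move=> th0; apply: (bounded_integrable (M := 1)) => // w.
by have /andP[h1 h2] := exp01 w th0; rewrite ger0_norm.
Qed.

Let icst (k : R) : P.-integrable setT (EFin \o (fun=> k)).
Proof. by apply: (bounded_integrable (M := `|k|)). Qed.

Let Icst (k : R) : \int[P]_w k = k.
Proof. by rewrite Rintegral_cst// -[RHS]mulr1; congr (_ * _); exact: (congr1 fine PT). Qed.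

Let Phi_ge0 th Phi : 0 < th -> \int[P]_w expR (- (th * X w)) = expR (- Phi) -> 0 <= Phi.
Proof.
move=> th0 hP; have : expR (- Phi) <= 1.
  rewrite -hP -[leRHS]Icst; apply: le_Rintegral => //; first exact: iexp.
  by move=> w _; have /andP[] := exp01 w th0.
by rewrite -{1}expR0 ler_expR oppr_le0.
Qed.

Let I1 th Phi : 0 < th -> \int[P]_w expR (- (th * X w)) = expR (- Phi) ->
  \int[P]_w (1 - expR (- (th * X w))) = 1 - expR (- Phi).
Proof. by move=> th0 hP; rewrite RintegralB// ?Icst ?hP//; exact: iexp. Qed.

Let i1 (th : R) : 0 < th -> P.-integrable setT (EFin \o (fun w => 1 - expR (- (th * X w)))).
Proof.
move=> th0; apply: (bounded_integrable (M := 1)).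
  by apply: measurable_funB => //; exact: measurable_cst.
by move=> w; have /andP[h1 h2] := exp01 w th0; rewrite ger0_norm; lra.
Qed.

Let E1 (th : R) : 0 < th -> (\int[P]_w (1 - expR (- (th * X w)))%:E)%E =
  (\int[P]_w (1 - expR (- (th * X w))))%:E.
Proof.
by move=> th0; rewrite /Rintegral fineK//; apply: integrable_fin_num => //; exact: i1.
Qed.

(** Letting [th] tend to 0 along [1 / n.+1], with [y / (1 + y)] as a minorant of
    [1 - expR (- y)]. *)
Lemma laplace_mean_le : (\int[P]_w (X w)%:E <= m%:E)%E.
Proof.
apply: (@integral_regularized_le X X 1) => // n.
pose th : R := 1 / n.+1%:R.
have th0 : 0 < th by rewrite divr_gt0.
have th1 : th <= 1 by rewrite ler_pdivrMr// mul1r ler1n.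
have [|Phi [/andP[_ hPhi] hP]] := laplace (th := th); first by rewrite th0.
have P0 := Phi_ge0 th0 hP.
apply: (@le_trans _ _ (\int[P]_w ((th^-1)%:E * (1 - expR (- (th * X w)))%:E))%E).
  apply: ge0_le_integral => //.
  - by move=> w _; rewrite lee_fin divr_ge0// addr_ge0// mulr_ge0// ltW.
  - apply/measurable_EFinP; apply: measurable_funM => //.
    apply: measurable_funV_pos => [w|].
      by rewrite ltr_pwDl// mulr_ge0// ltW.
    apply: measurable_funD; first exact: measurable_cst.
    by apply: measurable_funM => //; exact: measurable_cst.
  - apply: measurable_funeM; apply/measurable_EFinP.
    by apply: measurable_funB => //; exact: measurable_cst.
  - move=> w _; rewrite -EFinM lee_fin ler_pdivlMl// mulrA.
    by apply: one_sub_expR_ge; rewrite mulr_ge0// ltW.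
rewrite ge0_integralZl//; last 3 first.
- by apply/measurable_EFinP; apply: measurable_funB => //; exact: measurable_cst.
- by move=> w _; rewrite lee_fin subr_ge0; have /andP[] := exp01 w th0.
- by rewrite lee_fin invr_ge0 ltW.
rewrite E1// (I1 th0 hP) -EFinM lee_fin ler_pdivrMl//.
apply: le_trans hPhi.
by have /andP[] := expRN_le_quadratic P0; lra.
Qed.

Lemma laplace_integrable : P.-integrable setT (EFin \o X).
Proof.
apply/integrableP; split; first exact/measurable_EFinP.
apply: (@le_lt_trans _ _ m%:E); last exact: ltry.
apply: le_trans laplace_mean_le; rewrite le_eqVlt; apply/orP; left; apply/eqP.
by apply: eq_integral => w _; rewrite /= ger0_norm.
Qed.

(** Conversely [1 - expR (- (th * X)) <= th * X], and the left side has expectation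
    at least [th * m] up to a term of order [th ^+ 2]. *)
Lemma laplace_mean : \int[P]_w X w = m.
Proof.
apply/eqP; rewrite eq_le; apply/andP; split.
  rewrite -lee_fin /Rintegral fineK; first exact: laplace_mean_le.
  by apply: integrable_fin_num => //; exact: laplace_integrable.
apply/ler_addgt0Pr => e e0.
pose k := C + m ^+ 2 + 1.
have k0 : 0 < k by rewrite /k ltr_wpDl// addr_ge0// sqr_ge0.
pose th := Num.min 1 (e / k).
have th0 : 0 < th by rewrite lt_min ltr01/= divr_gt0.
have th1 : th <= 1 by rewrite ge_min lexx.
have the : th * k <= e by rewrite -ler_pdivlMr// ge_min lexx orbT.
have [|Phi [/andP[hPhi hPhi'] hP]] := laplace (th := th); first by rewrite th0.
have P0 := Phi_ge0 th0 hP.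
have h : th^-1 * (1 - expR (- Phi)) <= \int[P]_w X w.
  rewrite -(I1 th0 hP) -RintegralZl//; last exact: i1.
  apply: le_Rintegral => //; last 2 first.
  - exact: laplace_integrable.
  - move=> w _; rewrite ler_pdivrMl//.
    have tX : 0 <= th * X w by rewrite mulr_ge0// ltW.
    by have /andP[] := expRN_le_quadratic tX; lra.
  have := integrableZl (mu := P) measurableT th^-1 (i1 th0).
  exact.
have := expRN_le_quadratic P0 => /andP[_ hq].
have hPhi2 : Phi ^+ 2 <= (th * m) ^+ 2 by rewrite lerXn2r ?nnegrE ?mulr_ge0// ltW.
have hh : th * m - th ^+ 2 * C - (th * m) ^+ 2 <= 1 - expR (- Phi) by lra.
have : m - th * (C + m ^+ 2) <= th^-1 * (1 - expR (- Phi)).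
  rewrite ler_pdivlMl//; apply: le_trans hh.
  by rewrite le_eqVlt; apply/orP; left; apply/eqP; ring.
move: the; rewrite /k => the.
have : th * (C + m ^+ 2) <= e by nra.
lra.
Qed.

(** The variable [expR (- (th * (X - m))) - 1 + th * (X - m)] has expectation
    [expR (th * m - Phi) - 1], of order [th ^+ 2 * C]; its minorant from
    [expR_second_order_ge] is of order [th ^+ 2 * (X - m) ^+ 2]. *)
Lemma laplace_variance : (\int[P]_w ((X w - m) ^+ 2)%:E <= (8 * C)%:E)%E.
Proof.
(* Up to [th0] the difference [th * m - Phi] stays below 1/2, where the
   exponential is at most [1 + 2 * y]. *)
pose th0 : R := (2 * C + 1)^-1.
have Cp : 0 <= C by exact: C0.
have c1 : 1 <= 2 * C + 1 by lra.
have th00 : 0 < th0 by rewrite invr_gt0; lra.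
have th01 : th0 <= 1 by rewrite invf_le1//; lra.
have thC : th0 * C <= 2^-1 by rewrite /th0 ler_pdivrMl; lra.
apply: (@integral_regularized_le (fun w => (X w - m) ^+ 2) (fun w => `|X w - m|) th0) => //.
- by apply: measurable_funX; apply: measurable_funB => //; exact: measurable_cst.
- by apply: measurableT_comp => //; apply: measurable_funB => //; exact: measurable_cst.
- by move=> w; exact: sqr_ge0.
move=> n.
set th : R := th0 / n.+1%:R.
have tp : 0 < th by rewrite divr_gt0.
have tt0 : th <= th0 by rewrite ler_pdivrMr// ler_peMr ?ler1n// ltW.
have t1 : th <= 1 by exact: le_trans th01.
have [|Phi [/andP[hPhi hPhi'] hP]] := laplace (th := th); first by rewrite tp.
pose F w := expR (th * m) * expR (- (th * X w)) - 1 + (th * X w - th * m).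
have iX := laplace_integrable.
have iF1 : P.-integrable setT (EFin \o (fun w => expR (th * m) * expR (- (th * X w)))).
  by have := integrableZl (mu := P) measurableT (expR (th * m)) (iexp tp).
have iF2 : P.-integrable setT (EFin \o (fun w => th * X w)).
  by have := integrableZl (mu := P) measurableT th iX.
have iF3 : P.-integrable setT (EFin \o (fun w => expR (th * m) * expR (- (th * X w)) + (-1))).
  exact: (integrable_addR measurableT iF1 (icst (-1))).
have iF4 : P.-integrable setT (EFin \o (fun w => th * X w + - (th * m))).
  exact: (integrable_addR measurableT iF2 (icst (- (th * m)))).
have iF : P.-integrable setT (EFin \o F) by exact: (integrable_addR measurableT iF3 iF4).
have FE : \int[P]_w F w = expR (th * m - Phi) - 1.
  rewrite (RintegralD measurableT iF3 iF4) (RintegralD measurableT iF1 (icst (-1))).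
  rewrite (RintegralD measurableT iF2 (icst (- (th * m)))) !Icst.
  rewrite (RintegralZl _ measurableT (iexp tp)) (RintegralZl _ measurableT iX).
  by rewrite hP laplace_mean subrr addr0 expRD.
have F_ge w : th ^+ 2 * ((X w - m) ^+ 2 / (4 * (1 + th * `|X w - m|))) <= F w.
  have := expR_second_order_ge (th * (X w - m)).
  rewrite normrM (gtr0_norm tp) exprMn mulrA.
  rewrite /F -expRD (_ : th * m + - (th * X w) = - (th * (X w - m))); last by ring.
  by rewrite mulrBr.
have d0 w : 0 < 1 + th * `|X w - m| by rewrite ltr_pwDl// mulr_ge0// ltW.
have F0 w : 0 <= F w.
  apply: le_trans (F_ge w); rewrite mulr_ge0 ?sqr_ge0// divr_ge0 ?sqr_ge0//.
  by rewrite mulr_ge0// ltW.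
apply: (@le_trans _ _ (\int[P]_w ((4 / th ^+ 2)%:E * (F w)%:E))%E).
  have mF : measurable_fun setT F by have /measurable_int /measurable_EFinP := iF.
  apply: ge0_le_integral => //.
  - by move=> w _; rewrite lee_fin divr_ge0 ?sqr_ge0// ltW// d0.
  - apply/measurable_EFinP; apply: measurable_funM.
      by apply: measurable_funX; apply: measurable_funB => //; exact: measurable_cst.
    apply: measurable_funV_pos => //.
    apply: measurable_funD; first exact: measurable_cst.
    apply: measurable_funM; first exact: measurable_cst.
    by apply: measurableT_comp => //; apply: measurable_funB => //; exact: measurable_cst.
  - by apply: measurable_funeM; exact/measurable_EFinP.
  - move=> w _; rewrite -EFinM lee_fin.
    have h := F_ge w; have t2 : 0 < th ^+ 2 by rewrite exprn_gt0.
    have -> : 4 / th ^+ 2 * F w = (th ^+ 2)^-1 * (4 * F w) by ring.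
    rewrite ler_pdivlMl//.
    have -> : th ^+ 2 * ((X w - m) ^+ 2 / (1 + th * `|X w - m|)) =
      4 * (th ^+ 2 * ((X w - m) ^+ 2 / (4 * (1 + th * `|X w - m|)))).
      by field; rewrite gt_eqF// d0.
    by rewrite ler_wpM2l.
rewrite ge0_integralZl//; last 3 first.
- by have /measurable_int := iF.
- by move=> w _; rewrite lee_fin.
- by rewrite lee_fin divr_ge0 ?sqr_ge0.
rewrite (_ : (\int[P]_w (F w)%:E)%E = (\int[P]_w F w)%:E); last first.
  by rewrite /Rintegral fineK//; exact: integrable_fin_num.
rewrite FE -EFinM lee_fin.
set y := th * m - Phi.
have y0 : 0 <= y by rewrite subr_ge0.
have yC : y <= th ^+ 2 * C by rewrite /y; lra.
have y12 : y <= 2^-1.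
  apply: le_trans yC _; apply: le_trans thC; rewrite expr2 -mulrA.
  apply: (@le_trans _ _ (1 * (th0 * C))); last by rewrite mul1r.
  have h1 : th * C <= th0 * C by apply: ler_wpM2r.
  have tC : 0 <= th * C by rewrite mulr_ge0// ltW.
  by apply: ler_pM => //; exact: ltW.
have h : expR y - 1 <= 2 * y.
  have e1 := expR_ge1Dx (- y).
  have ep := expR_gt0 y.
  have : expR y * (1 - y) <= 1.
    by rewrite -ler_pdivlMl// mulr1 -expRN.
  nra.
have t2 : 0 < th ^+ 2 by rewrite exprn_gt0.
rewrite mulrAC ler_pdivrMr//.
nra.
Qed.

End laplace_moments.

(** * Immigration and the Laplace exponent of the process *)

Section kernel_law.
Context d d' (X : measurableType d) (Y : measurableType d') (R : realType).
Variables (k : R.-pker X ~> Y) (x : X).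

(** A name for [k x] that carries its structure of probability measure. *)
Definition kernel_law : set Y -> \bar R := k x.

HB.instance Definition _ := Measure.on kernel_law.

Let kernel_law_setT : kernel_law setT = 1%E.
Proof. exact: prob_kernel. Qed.

HB.instance Definition _ := Measure_isProbability.Build _ _ _ kernel_law kernel_law_setT.

End kernel_law.

Section state_moments.
Variable R : realType.
Notation RR := (measurableTypeR R).
Notation N := (int_measure R).
Notation mu := (@lebesgue_measure R).
Implicit Types (nu : N) (f h : R -> R).

Let kid (nu : N) : {finite_measure set RR -> \bar R} := nu.

Let mkid : forall B : set RR, measurable B -> measurable_fun [set: N] (fun nu => kid nu B).
Proof. exact: measurable_eval. Qed.

Lemma measurable_pairing_state f : bounded_measurable f ->
  measurable_fun [set: N] (fun nu : N => pairing nu f).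
Proof. exact: (measurable_pairing mkid). Qed.

Lemma measurable_epairing_state (f : R -> \bar R) : (forall x, (0 <= f x)%E) ->
  measurable_fun [set: RR] (f : RR -> \bar R) ->
  measurable_fun [set: N] (fun nu : N => epairing nu f).
Proof. by move=> f0 mf; exact: (measurable_epairing mkid). Qed.

Lemma measurable_pairing_time_state (w : R -> R -> R) : locally_bounded w ->
  measurable_fun [set: RR * N] (fun z => pairing z.2 (w (Num.max 0 z.1))).
Proof.
move=> lw.
have mk : forall B : set RR, measurable B ->
    measurable_fun [set: RR * N] (fun z : RR * N => kid z.2 B).
  move=> B mB; apply: (@measurableT_comp _ _ _ _ _ _ (fun nu : N => nu B) _ snd).
    exact: measurable_eval.
  exact: measurable_snd.
apply: (measurable_pairing_joint mk (F := fun y : (RR * N) * RR => w (Num.max 0 y.1.1) y.2)).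
  apply: (@measurableT_comp _ _ _ _ _ _ (fun z : RR * RR => w (Num.max 0 z.1) z.2) _
    (fun y : (RR * N) * RR => (y.1.1, y.2))).
    exact: locally_bounded_ext.
  apply: measurable_fun_pair; last exact: measurable_snd.
  by apply: (measurableT_comp (@measurable_fst _ _ RR N)) => //; exact: measurable_fst.
move=> z; have z0 : 0 <= Num.max 0 z.1 by rewrite le_max lexx.
by case: (locally_bounded_section lw z0).
Qed.

Variables (a : R) (a0 : 0 < a).
Local Notation V := (weight a).

(** The pairing with [V], finite for every integer-valued measure. *)
Definition mass nu : R := fine (epairing nu (EFin \o V)).

Lemma mass_ge0 nu : 0 <= mass nu.
Proof. by apply: fine_ge0; apply: epairing_ge0 => x _; rewrite lee_fin weight_ge0. Qed.

(** Integer-valued measures have bounded support, hence integrate the weight. *)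
Lemma massE nu : epairing nu (EFin \o V) = (mass nu)%:E.
Proof.
rewrite fineK// ge0_fin_numE; last by apply: epairing_ge0 => x _; rewrite lee_fin weight_ge0.
have [M M0 hM] := int_measure_bounded_support nu.
have mV := @measurable_weight R a.
have mM : measurable (`]M, +oo[%classic : set RR) by exact: measurable_itv.
have mP : measurable (`]0, +oo[%classic : set RR) by exact: measurable_itv.
rewrite /epairing (@ge0_negligible_integral _ RR R nu `]0, +oo[%classic `]M, +oo[%classic (EFin \o V) mM mP _ _ hM); last 2 first.
- by apply/measurable_EFinP; exact: measurable_funS mV.
- by move=> x _; rewrite lee_fin weight_ge0.
have mD : measurable ((`]0, +oo[%classic : set RR) `\` `]M, +oo[%classic).
  by apply: measurableD; exact: measurable_itv.
apply: (@le_lt_trans _ _ (\int[nu]_(x in `]0%R, +oo[%classic `\` `]M, +oo[%classic) (cst (V M)%:E x))%E).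
  apply: ge0_le_integral => //.
  - by move=> x _; rewrite lee_fin weight_ge0.
  - by apply/measurable_EFinP; exact: measurable_funS mV.
  - move=> x [/=]; rewrite !in_itv/= !andbT => x0 /negP; rewrite -leNgt => xM.
    by rewrite lee_fin ler_expR ler_wpM2l// mulr_ge0// ltW.
rewrite integral_cst//; apply: lte_mul_pinfty => //.
  by rewrite lee_fin weight_ge0.
by rewrite ltey_eq fin_num_measure.
Qed.

Lemma measurable_mass : measurable_fun [set: N] mass.
Proof.
apply: measurableT_comp; first exact: fine_measurable.
apply: measurable_epairing_state => [x|]; first by rewrite lee_fin weight_ge0.
by apply/measurable_EFinP; exact: measurable_weight.
Qed.

Lemma pairing_le_mass nu f (k : R) : bounded_measurable f -> 0 <= k ->
  (forall x, 0 < x -> 0 <= f x <= k * V x) -> pairing nu f <= k * mass nu.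
Proof.
move=> bf k0 fV; apply: (pairing_le_multiple (W := V)) => //.
- exact: measurable_weight.
- by move=> x; exact: weight_ge0.
- exact: massE.
Qed.

Lemma pairing_null f : pairing (null_measure R) f = 0.
Proof. by rewrite /pairing /Rintegral integral_measure_zero. Qed.

Variables (L : {finite_measure set N -> \bar R}).
Hypothesis HL2 : (\int[L]_(nu in nonnull R) (epairing nu (EFin \o V) ^+ 2) < +oo)%E.

Lemma integral_nonnull (F : N -> \bar R) : F (null_measure R) = 0%E ->
  (\int[L]_(nu in nonnull R) F nu = \int[L]_nu F nu)%E.
Proof.
move=> F0; rewrite integral_mkcond; congr integral; apply/funext => nu.
rewrite patchE; case: ifPn => //; rewrite notin_setE => /contrapT ->.
by rewrite F0.
Qed.

Let mass2_lt : (\int[L]_nu ((mass nu) ^+ 2)%:E < +oo)%E.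
Proof.
apply: le_lt_trans HL2; rewrite le_eqVlt; apply/orP; left; apply/eqP.
rewrite integral_nonnull; last first.
  by rewrite massE /mass /epairing integral_measure_zero expe2 mul0e.
by apply: eq_integral => nu _; rewrite massE -EFin_expe.
Qed.

Let LT : (L [set: N] < +oo)%E.
Proof. by rewrite ltey_eq fin_num_measure. Qed.

Lemma mass2_integrable : L.-integrable setT (EFin \o (fun nu => mass nu ^+ 2)).
Proof.
apply/integrableP; split.
  by apply/measurable_EFinP; apply: measurable_funX; exact: measurable_mass.
apply: le_lt_trans mass2_lt; rewrite le_eqVlt; apply/orP; left; apply/eqP.
by apply: eq_integral => nu _; rewrite /= ger0_norm// sqr_ge0.
Qed.

Let cst_integrable (k : R) : L.-integrable setT (EFin \o (fun=> k)).
Proof.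
apply: measurable_bounded_integrable => //.
exists `|k|; split; first exact: num_real.
by move=> r Mr x _; rewrite /= ltW.
Qed.

Lemma le_integrableR (F H : N -> R) : measurable_fun setT F ->
  L.-integrable setT (EFin \o H) -> (forall nu, 0 <= F nu <= H nu) ->
  L.-integrable setT (EFin \o F).
Proof.
move=> mF iH FH; apply: (le_integrable measurableT _ _ iH).
  exact/measurable_EFinP.
move=> nu _ /=; have /andP[h1 h2] := FH nu.
by rewrite lee_fin !ger0_norm// (le_trans h1).
Qed.

Lemma mass_integrable : L.-integrable setT (EFin \o mass).
Proof.
apply: (le_integrableR (H := fun nu => 1 + mass nu ^+ 2)).
- exact: measurable_mass.
- exact: (integrable_addR measurableT (cst_integrable 1) mass2_integrable).
- move=> nu; rewrite mass_ge0/=; have := sqr_ge0 (mass nu - 1).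
  by have := mass_ge0 nu; nra.
Qed.

Let l1 : R := \int[L]_nu mass nu.
Let l2 : R := \int[L]_nu (mass nu ^+ 2).

(** When [v] is the linear flow of [f], the rate at which immigration at lag [s] feeds
    the mean of [<Y_t, f>]. *)
Definition immigration_rate (v : R -> R -> R) (s : R) : R := \int[L]_nu pairing nu (v s).

Lemma psiE (u : R -> R) : psi L u = \int[L]_nu (1 - expR (- pairing nu u)).
Proof.
rewrite /psi /Rintegral integral_nonnull// pairing_null oppr0 expR0 subrr//.
Qed.

Lemma integral_time_measurable (F : RR * N -> R) : measurable_fun setT F ->
  (forall z, 0 <= F z) -> measurable_fun [set: RR] (fun s : RR => \int[L]_nu F (s, nu)).
Proof.
move=> mF F0; apply: measurableT_comp; first exact: fine_measurable.
apply: (@measurable_integral_on _ _ _ RR N L setT measurableT (EFin \o F)).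
  by move=> z; rewrite lee_fin.
exact/measurable_EFinP.
Qed.

Section rate_bounds.
Variables (u v : R -> R -> R) (c0 c1 A : R).
Hypotheses (lu : locally_bounded u) (lv : locally_bounded v).
Hypotheses (u0 : forall t x, 0 <= t -> 0 <= u t x) (v0 : forall t x, 0 <= t -> 0 <= v t x).
Hypotheses (c00 : 0 <= c0) (c10 : 0 <= c1) (A0 : 0 <= A).
Hypothesis uv : forall t x, 0 <= t -> 0 < x -> u t x <= v t x.
Hypothesis vV : forall t x, 0 <= t -> 0 < x -> v t x <= c0 * A * (expR (- (a * t)) * V x).
Hypothesis vu : forall t x, 0 <= t -> 0 < x ->
  v t x - u t x <= c1 * A ^+ 2 * (expR (- (a * t)) * V x).

Let e01 s : 0 <= s -> 0 <= expR (- (a * s)) <= 1.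
Proof. by move=> s0; rewrite expR_ge0/= -expR0 ler_expR oppr_le0 mulr_ge0// ltW. Qed.

Lemma pairing_v_le nu s : 0 <= s ->
  0 <= pairing nu (v s) <= c0 * A * expR (- (a * s)) * mass nu.
Proof.
move=> s0; apply/andP; split; first by apply: pairing_ge0 => x _; exact: v0.
apply: pairing_le_mass; first exact: locally_bounded_section.
  by rewrite mulr_ge0 ?expR_ge0// mulr_ge0.
by move=> x x0; rewrite v0//= -mulrA vV.
Qed.

Lemma pairing_uv nu s : 0 <= s ->
  0 <= pairing nu (u s) <= pairing nu (v s) /\
  pairing nu (v s) - pairing nu (u s) <= c1 * A ^+ 2 * expR (- (a * s)) * mass nu.
Proof.
move=> s0; have bu := locally_bounded_section lu s0; have bv := locally_bounded_section lv s0.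
split.
  apply/andP; split; first by apply: pairing_ge0 => x _; exact: u0.
  by apply: le_pairing => // x x0; exact: uv.
rewrite -pairingB//; apply: pairing_le_mass; first exact: bounded_measurableB.
  by rewrite mulr_ge0 ?expR_ge0// mulr_ge0 ?sqr_ge0.
by move=> x x0; rewrite subr_ge0 uv//= -mulrA vu.
Qed.

Lemma pairing_v_integrable s : 0 <= s -> L.-integrable setT (EFin \o (fun nu => pairing nu (v s))).
Proof.
move=> s0; apply: (le_integrableR (H := fun nu => c0 * A * expR (- (a * s)) * mass nu)).
- by apply: measurable_pairing_state; exact: locally_bounded_section.
- by have := integrableZl (mu := L) measurableT (c0 * A * expR (- (a * s))) mass_integrable.
- by move=> nu; exact: pairing_v_le.
Qed.

Let psi_integrable s : 0 <= s ->
  L.-integrable setT (EFin \o (fun nu => 1 - expR (- pairing nu (u s)))).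
Proof.
move=> s0; apply: (le_integrableR (H := fun=> 1)) => //.
  apply: measurable_funB; first exact: measurable_cst.
  apply: measurableT_comp => //; apply: measurable_funN.
  by apply: measurable_pairing_state; exact: locally_bounded_section.
move=> nu; rewrite gerBl expR_ge0 andbT subr_ge0 -expR0 ler_expR oppr_le0.
by have [/andP[]] := pairing_uv nu s0.
Qed.

Lemma immigration_rate_le s : 0 <= s ->
  0 <= immigration_rate v s <= c0 * A * l1 * expR (- (a * s)).
Proof.
move=> s0; apply/andP; split.
  by apply: Rintegral_ge0 => nu _; have /andP[] := pairing_v_le nu s0.
rewrite (_ : c0 * A * l1 * _ = c0 * A * expR (- (a * s)) * l1); last by ring.
rewrite -RintegralZl//; last exact: mass_integrable.
apply: le_Rintegral => //; first exact: pairing_v_integrable.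
  by have := integrableZl (mu := L) measurableT (c0 * A * expR (- (a * s))) mass_integrable.
by move=> nu _; have /andP[] := pairing_v_le nu s0.
Qed.

Lemma psi_bounds s : 0 <= s ->
  immigration_rate v s - (c1 * l1 + c0 ^+ 2 * l2) * A ^+ 2 * expR (- (a * s))
    <= psi L (u s) <= immigration_rate v s.
Proof.
move=> s0; rewrite psiE; apply/andP; split; last first.
  apply: le_Rintegral => //; [exact: psi_integrable|exact: pairing_v_integrable|].
  move=> nu _; have [/andP[h1 h2] _] := pairing_uv nu s0.
  by apply: le_trans h2; have /andP[] := expRN_le_quadratic h1; lra.
have iv := pairing_v_integrable s0.
have im := integrableZl (mu := L) measurableT (c1 * A ^+ 2 * expR (- (a * s))) mass_integrable.
have im2 := integrableZl (mu := L) measurableT (c0 ^+ 2 * A ^+ 2 * expR (- (a * s))) mass2_integrable.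
have -> : (c1 * l1 + c0 ^+ 2 * l2) * A ^+ 2 * expR (- (a * s)) =
  c1 * A ^+ 2 * expR (- (a * s)) * l1 + c0 ^+ 2 * A ^+ 2 * expR (- (a * s)) * l2 by ring.
rewrite /l1 /l2 -RintegralZl//; last exact: mass_integrable.
rewrite -RintegralZl//; last exact: mass2_integrable.
rewrite lerBlDr.
have ips := psi_integrable s0.
have imm := integrable_addR measurableT (f := fun nu => c1 * A ^+ 2 * expR (- (a * s)) * mass nu)
  (g := fun nu => c0 ^+ 2 * A ^+ 2 * expR (- (a * s)) * mass nu ^+ 2) im im2.
rewrite -(RintegralD measurableT im im2) -(RintegralD measurableT ips imm).
apply: le_Rintegral => //; first exact: (integrable_addR measurableT ips imm).
move=> nu _; have [/andP[h1 h2] h3] := pairing_uv nu s0.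
have /andP[_ h4] := expRN_le_quadratic h1.
have /andP[h5 h6] := pairing_v_le nu s0.
have h7 : pairing nu (u s) ^+ 2 <= (c0 * A * expR (- (a * s)) * mass nu) ^+ 2.
  by rewrite lerXn2r ?nnegrE// ?(le_trans h2)// (le_trans h5).
have /andP[x0 x1] := e01 s0.
set X := expR _ in h3 h6 h7 x0 x1 *.
have h8 : (c0 * A * X * mass nu) ^+ 2 <= c0 ^+ 2 * A ^+ 2 * X * mass nu ^+ 2.
  have -> : (c0 * A * X * mass nu) ^+ 2 = (c0 ^+ 2 * A ^+ 2 * mass nu ^+ 2) * X ^+ 2 by ring.
  have -> : c0 ^+ 2 * A ^+ 2 * X * mass nu ^+ 2 = (c0 ^+ 2 * A ^+ 2 * mass nu ^+ 2) * X by ring.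
  apply: ler_wpM2l; last by rewrite expr2 ler_piMl.
  by apply: mulr_ge0; [apply: mulr_ge0|]; exact: sqr_ge0.
lra.
Qed.

Lemma time_bounded_immigration_rate : time_bounded (immigration_rate v).
Proof.
split.
  apply: (eq_measurable_fun (fun s : RR => \int[L]_nu pairing nu (v (Num.max 0 s)))).
    by move=> s; rewrite inE/= in_itv/= andbT => s0; rewrite (max_idPr s0).
  apply: (@measurable_funS _ _ _ _ setT) => //.
  apply: (@integral_time_measurable (fun z : RR * N => pairing z.2 (v (Num.max 0 z.1)))).
    exact: measurable_pairing_time_state.
  by move=> z; apply: pairing_ge0 => x _; apply: v0; rewrite le_max lexx.
move=> T; exists (c0 * A * l1) => s /andP[s0 _].
have /andP[h1 h2] := immigration_rate_le s0.
rewrite ger0_norm//; apply: (le_trans h2); have /andP[_ x1] := e01 s0.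
apply: ler_piMr; last exact: x1.
apply: mulr_ge0; first exact: mulr_ge0.
by apply: Rintegral_ge0 => nu _; exact: mass_ge0.
Qed.

Lemma time_bounded_psi : time_bounded (fun s => psi L (u s)).
Proof.
split.
  apply: (eq_measurable_fun (fun s : RR => \int[L]_nu (1 - expR (- pairing nu (u (Num.max 0 s)))))).
    by move=> s; rewrite inE/= in_itv/= andbT => s0; rewrite (max_idPr s0) psiE.
  apply: (@measurable_funS _ _ _ _ setT) => //.
  apply: (@integral_time_measurable (fun z : RR * N => 1 - expR (- pairing z.2 (u (Num.max 0 z.1))))).
    apply: measurable_funB; first exact: measurable_cst.
    apply: measurableT_comp => //; apply: measurable_funN.
    exact: measurable_pairing_time_state.
  move=> z; rewrite subr_ge0 -expR0 ler_expR oppr_le0.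
  by apply: pairing_ge0 => x _; apply: u0; rewrite le_max lexx.
move=> T; have [_ /(_ T)[M hM]] := time_bounded_immigration_rate.
exists M => s sT; have /andP[s0 _] := sT.
have /andP[_ h] := psi_bounds s0.
rewrite ger0_norm; first by apply: (le_trans h); apply: le_trans (hM s sT); exact: ler_norm.
rewrite psiE; apply: Rintegral_ge0 => nu _; rewrite subr_ge0 -expR0 ler_expR oppr_le0.
by have [/andP[]] := pairing_uv nu s0.
Qed.

Lemma time_bounded_integrable (c : R -> R) t : time_bounded c ->
  mu.-integrable `]0, t]%classic (EFin \o c).
Proof.
move=> [mc bc]; have [M hM] := bc t; apply: (@itv_integrable _ _ _ M).
  apply: measurable_funS mc => //.
  by move=> s /=; rewrite !in_itv/= andbT => /andP[/ltW].
by move=> s /andP[s0 st]; apply: hM; rewrite (ltW s0).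
Qed.

(** [Phi] is the Laplace exponent and [m] its linearisation. The initial population
    contributes the error [v - u]; each immigrating population contributes this error
    and the square of its pairing, whence the second moment of the mass. *)
Lemma exponent_bounds nu t : 0 <= t ->
  let m := pairing nu (v t) + \int[mu]_(s in `]0, t]%classic) immigration_rate v s in
  let Phi := pairing nu (u t) + \int[mu]_(s in `]0, t]%classic) psi L (u s) in
  m - (c1 * mass nu + (c1 * l1 + c0 ^+ 2 * l2) / a) * A ^+ 2 <= Phi <= m.
Proof.
move=> t0; cbv zeta.
have aux (p q I J d1 d2 : R) : I <= J + d2 -> p - q <= d1 -> p + I - (d1 + d2) <= q + J.
  by lra.
have [/andP[_ h1] h2] := pairing_uv nu t0.
have ii := time_bounded_integrable t time_bounded_immigration_rate.
have ip := time_bounded_integrable t time_bounded_psi.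
have mI : measurable (`]0, t]%classic : set RR) by exact: measurable_itv.
have sub s : (`]0, t]%classic : set R) s -> 0 <= s by rewrite /= in_itv/= => /andP[/ltW].
apply/andP; split; last first.
  rewrite lerD//; apply: le_Rintegral => //.
  by move=> s /sub s0; have /andP[] := psi_bounds s0.
set k := (c1 * l1 + c0 ^+ 2 * l2).
have k0 : 0 <= k.
  rewrite /k addr_ge0// mulr_ge0 ?sqr_ge0//; apply: Rintegral_ge0 => n _; first exact: mass_ge0.
  exact: sqr_ge0.
have ie : mu.-integrable `]0, t]%classic (EFin \o (fun s => k * A ^+ 2 * expR (- (a * s)))).
  by apply: time_bounded_integrable; exact: time_bounded_exp.
have hI : \int[mu]_(s in `]0, t]%classic) immigration_rate v s <=
    \int[mu]_(s in `]0, t]%classic) psi L (u s) + k * A ^+ 2 / a.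
  apply: (@le_trans _ _ (\int[mu]_(s in `]0, t]%classic) (psi L (u s) + k * A ^+ 2 * expR (- (a * s))))).
    apply: le_Rintegral => //.
      exact: (@integrable_addR _ RR R mu _ (fun s => psi L (u s))
        (fun s => k * A ^+ 2 * expR (- (a * s))) mI ip ie).
    by move=> s /sub s0; have /andP[+ _] := psi_bounds s0; rewrite -/k; lra.
  rewrite (RintegralD mI ip ie) lerD2l.
  rewrite RintegralZl//; first by rewrite ler_wpM2l ?expR_integral_le// mulr_ge0 ?sqr_ge0.
  have := time_bounded_integrable t (@time_bounded_exp R a a0 1).
  by congr (_.-integrable _ _); apply/funext => s /=; rewrite mul1r.
have h3 : pairing nu (v t) - pairing nu (u t) <= c1 * A ^+ 2 * mass nu.
  apply: (le_trans h2); rewrite -mulrA ler_wpM2l ?mulr_ge0 ?sqr_ge0//.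
  by rewrite ler_piMl ?mass_ge0//; have /andP[] := e01 t0.
have -> : (c1 * mass nu + k / a) * A ^+ 2 = c1 * A ^+ 2 * mass nu + k * A ^+ 2 / a by ring.
exact: aux.
Qed.

End rate_bounds.

End state_moments.

(** * Extension of identities from indicators *)

Section integral_like.
Context d (T : measurableType d) (R : realType).
Implicit Types (Phi : (T -> \bar R) -> \bar R) (f g : T -> \bar R).

(** The three properties of an integral that carry an identity from indicators to
    nonnegative measurable functions. *)
Definition integral_like Phi :=
  [/\ forall f g, (forall x, (0 <= f x)%E) -> (forall x, (0 <= g x)%E) ->
        measurable_fun setT f -> measurable_fun setT g ->
        Phi (fun x => f x + g x)%E = (Phi f + Phi g)%E,
      forall (k : R) f, 0 <= k -> (forall x, (0 <= f x)%E) -> measurable_fun setT f ->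
        Phi (fun x => k%:E * f x)%E = (k%:E * Phi f)%E &
      forall (F : nat -> T -> \bar R) f, (forall n x, (0 <= F n x)%E) ->
        (forall n, measurable_fun setT (F n)) ->
        (forall x, {homo F^~ x : n m / (n <= m)%N >-> (n <= m)%E}) ->
        (forall x, F n x @[n --> \oo] --> f x) ->
        Phi (F n) @[n --> \oo] --> Phi f].

Import HBNNSimple.

Lemma integral_like_eq Phi1 Phi2 : integral_like Phi1 -> integral_like Phi2 ->
  (forall B, measurable B -> Phi1 (fun x => (\1_B x)%:E) = Phi2 (fun x => (\1_B x)%:E)) ->
  forall f, (forall x, (0 <= f x)%E) -> measurable_fun setT f -> Phi1 f = Phi2 f.
Proof.
move=> [D1 Z1 C1] [D2 Z2 C2] H f f0 mf.
have z Phi : (forall (k : R) f, 0 <= k -> (forall x, (0 <= f x)%E) -> measurable_fun setT f ->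
        Phi (fun x => k%:E * f x)%E = (k%:E * Phi f)%E) -> Phi (fun=> 0%E) = 0%E.
  move=> Z; have := Z 0 (fun=> 0%E) (lexx _) (fun=> lexx _) (measurable_cst _).
  by rewrite !mul0e.
have simple (s : {nnsfun T >-> R}) : Phi1 (EFin \o s) = Phi2 (EFin \o s).
  have sE : EFin \o s = (fun x => \sum_(y <- finmap.enum_fset (fset_set (range s))) (y%:E * (\1_(s @^-1` [set y]) x)%:E))%E.
    by apply/funext => x /=; rewrite [in LHS]fimfunE fsbig_finite//= -sumEFin.
  rewrite sE.
  have y0 y x : y \in finmap.enum_fset (fset_set (range s)) -> (0 <= y%:E * (\1_(s @^-1` [set y]) x)%:E)%E.
    move=> h; have e := in_fset_set (fimfunP s) y.
    have : y \in range s by rewrite -e; exact: h.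
    by rewrite inE => -[w _ <-]; rewrite mule_ge0 ?lee_fin.
  have mi y : measurable_fun setT (fun x => (\1_(s @^-1` [set y]) x)%:E : \bar R).
    by apply/measurable_EFinP; exact: measurable_indic.
  elim: (finmap.enum_fset (fset_set (range s))) y0 => [|y l IH] y0.
    by under eq_fun do rewrite big_nil; rewrite !z.
  have ysplit : (fun x => \sum_(j <- y :: l) (j%:E * (\1_(s @^-1` [set j]) x)%:E))%E =
     (fun x => y%:E * (\1_(s @^-1` [set y]) x)%:E + \sum_(j <- l) (j%:E * (\1_(s @^-1` [set j]) x)%:E))%E.
    by apply/funext => x; rewrite big_cons.
  have y1 : forall x, (0 <= y%:E * (\1_(s @^-1` [set y]) x)%:E)%E.
    by move=> x; apply: y0; rewrite mem_head.
  have l0 j x : j \in l -> (0 <= j%:E * (\1_(s @^-1` [set j]) x)%:E)%E.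
    by move=> jl; apply: y0; rewrite in_cons jl orbT.
  have l1 x : (0 <= \sum_(j <- l) (j%:E * (\1_(s @^-1` [set j]) x)%:E))%E.
    by rewrite big_seq; apply: sume_ge0 => j jl; exact: l0.
  have ml : measurable_fun setT (fun x => \sum_(j <- l) (j%:E * (\1_(s @^-1` [set j]) x)%:E))%E.
    by apply: emeasurable_sum => j; exact: measurable_funeM.
  rewrite ysplit D1//; last exact: measurable_funeM.
  rewrite D2//; last exact: measurable_funeM.
  rewrite IH//; congr (_ + _)%E.
  have [yn|yn] := leP 0 y.
    by rewrite Z1// Z2// H.
  rewrite (_ : (fun x => _) = (fun=> 0%E)) ?z//.
  by apply/funext => x; rewrite preimage_nnfun0// indic0 mule0.
pose F n : T -> \bar R := EFin \o nnsfun_approx measurableT mf n.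
have F0 n x : (0 <= F n x)%E by rewrite lee_fin.
have mF n : measurable_fun setT (F n) by exact/measurable_EFinP.
have ndF x : {homo F^~ x : n m / (n <= m)%N >-> (n <= m)%E}.
  by move=> n m nm; rewrite lee_fin; exact/lefP/nd_nnsfun_approx.
have cF x : F n x @[n --> \oo] --> f x by apply: cvg_nnsfun_approx.
have h1 := C1 F f F0 mF ndF cF; have h2 := C2 F f F0 mF ndF cF.
have E : (fun n => Phi1 (F n)) = (fun n => Phi2 (F n)) by apply/funext => n; exact: simple.
rewrite E in h1.
exact: (cvg_unique _ h1 h2).
Qed.

End integral_like.

Section integral_like_examples.
Context d1 d2 d3 (O : measurableType d1) (T : measurableType d2) (S : measurableType d3) (R : realType).
Variables (P : {measure set O -> \bar R}) (g : O -> \bar R).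
Hypotheses (g0 : forall w, (0 <= g w)%E) (mg : measurable_fun setT g).

(** For an infinite factor the sequence is either zero throughout or, by monotonicity,
    positive from some index on. *)
Lemma cvg_ge0_muleZl (u : nat -> \bar R) (l c : \bar R) : (0 <= c)%E ->
  (forall n, (0 <= u n)%E) -> {homo u : n m / (n <= m)%N >-> (n <= m)%E} ->
  u n @[n --> \oo] --> l -> (c * u n)%E @[n --> \oo] --> (c * l)%E.
Proof.
move=> c0 u0 ndu ul.
move: c c0 => [c| |]//= c0; first by apply: cvgeZl.
have [l0|l0] := eqVneq l 0%E.
  have uE n : u n = 0%E.
    apply/eqP; rewrite eq_le u0 andbT -l0.
    rewrite (cvg_unique _ ul (ereal_nondecreasing_cvgn ndu))//.
    by apply: ereal_sup_ubound; exists n.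
  rewrite l0 mule0 (_ : (fun n => _) = cst 0%E); first exact: cvg_cst.
  by apply/funext => n; rewrite uE mule0.
have lpos : (0 < l)%E.
  rewrite lt_neqAle eq_sym l0/= -(cvg_lim _ ul)//.
  by apply: lime_ge; [apply/cvg_ex; exists l|exact: nearW].
have [k hk] : exists k, (0 < u k)%E.
  apply: contrapT => /forallNP hN.
  have uE n : u n = 0%E.
    by apply/eqP; rewrite eq_le u0 andbT leNgt; apply/negP; exact: hN.
  move: lpos; rewrite -(cvg_lim _ ul)// (_ : u = cst 0%E) ?lim_cst ?ltxx//.
  by apply/funext => n; rewrite uE.
rewrite gt0_mulye//; apply: cvg_near_cst; near=> n.
rewrite gt0_mulye//; apply: lt_le_trans hk _; apply: ndu.
by near: n; exact: nbhs_infty_ge.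
Unshelve. all: by end_near. Qed.

Lemma integral_like_kernel (k : R.-ker T ~> S) (phi : O -> T) : measurable_fun setT phi ->
  integral_like (fun H : S -> \bar R => \int[P]_w (g w * \int[k (phi w)]_y H y))%E.
Proof.
move=> mphi.
have mI H : (forall x, (0 <= H x)%E) -> measurable_fun setT H ->
    measurable_fun setT (fun w => \int[k (phi w)]_y H y)%E.
  move=> H0 mH; apply: (@measurableT_comp _ _ _ _ _ _ (fun x => \int[k x]_y H y)%E _ phi) => //.
  by apply: measurable_fun_integral_kernel => // U mU; exact: measurable_kernel.
have I0 H w : (forall x, (0 <= H x)%E) -> (0 <= \int[k (phi w)]_y H y)%E.
  by move=> H0; apply: integral_ge0.
split.
- move=> f h f0 h0 mf mh; rewrite -ge0_integralD//.
  + by apply: eq_integral => w _; rewrite ge0_integralD// ge0_muleDr ?I0.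
  + by move=> w _; rewrite mule_ge0// I0.
  + by apply: emeasurable_funM => //; exact: mI.
  + by move=> w _; rewrite mule_ge0// I0.
  + by apply: emeasurable_funM => //; exact: mI.
- move=> c f c0 f0 mf; rewrite -ge0_integralZl//.
  + by apply: eq_integral => w _; rewrite ge0_integralZl// muleCA.
  + by apply: emeasurable_funM => //; exact: mI.
  + by move=> w _; rewrite mule_ge0// I0.
- move=> F f F0 mF ndF cF.
  have ndI w : {homo (fun n => \int[k (phi w)]_y F n y)%E : n m / (n <= m)%N >-> (n <= m)%E}.
    move=> n m nm; apply: ge0_le_integral => // y _; exact: ndF.
  have cI w : (\int[k (phi w)]_y F n y)%E @[n --> \oo] --> (\int[k (phi w)]_y f y)%E.
    have := @cvg_monotone_convergence _ _ _ (k (phi w)) setT measurableT F mF (fun n x _ => F0 n x) (fun x _ => ndF x).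
    congr (_ --> _); apply: eq_integral => x _; apply/cvg_lim => //; exact: cF.
  have := @cvg_monotone_convergence _ _ _ P setT measurableT
    (fun n w => g w * \int[k (phi w)]_y F n y)%E.
  rewrite (_ : (\int[P]_(x in setT) _)%E = (\int[P]_w (g w * \int[k (phi w)]_y f y))%E); last first.
    apply: eq_integral => w _; apply/cvg_lim => //.
    by apply: (cvg_ge0_muleZl (g0 w) _ (ndI w) (cI w)) => n; exact: I0.
  apply.
  + by move=> n; apply: emeasurable_funM => //; exact: mI.
  + by move=> n w _; rewrite mule_ge0// I0.
  + by move=> w _ n m nm; apply: lee_wpmul2l => //; exact: ndI.
Qed.

Lemma integral_like_image (phi : O -> T) : measurable_fun setT phi ->
  integral_like (fun F : T -> \bar R => \int[P]_w (g w * F (phi w)))%E.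
Proof.
move=> mphi.
have mI H : measurable_fun setT H -> measurable_fun setT (fun w => H (phi w) : \bar R)%E.
  by move=> mH; exact: measurableT_comp.
split.
- move=> f h f0 h0 mf mh; rewrite -ge0_integralD//.
  + by apply: eq_integral => w _; rewrite ge0_muleDr.
  + by move=> w _; rewrite mule_ge0.
  + by apply: emeasurable_funM => //; exact: mI.
  + by move=> w _; rewrite mule_ge0.
  + by apply: emeasurable_funM => //; exact: mI.
- move=> c f c0 f0 mf; rewrite -ge0_integralZl//.
  + by apply: eq_integral => w _; rewrite muleCA.
  + by apply: emeasurable_funM => //; exact: mI.
  + by move=> w _; rewrite mule_ge0.
- move=> F f F0 mF ndF cF.
  have := @cvg_monotone_convergence _ _ _ P setT measurableT
    (fun n w => g w * F n (phi w))%E.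
  rewrite (_ : (\int[P]_(x in setT) _)%E = (\int[P]_w (g w * f (phi w)))%E); last first.
    apply: eq_integral => w _; apply/cvg_lim => //.
    exact: (cvg_ge0_muleZl (g0 w) (fun n => F0 n _) (ndF (phi w)) (cF (phi w))).
  apply.
  + by move=> n; apply: emeasurable_funM => //; exact: mI.
  + by move=> n w _; rewrite mule_ge0.
  + by move=> w _ n m nm; apply: lee_wpmul2l => //; exact: ndF.
Qed.

End integral_like_examples.

(** * Laws of the process at one and at two times *)

Section markov_laws.
Variable R : realType.
Notation N := (int_measure R).
Context d (Omega : measurableType d).
Variables (P : probability Omega R) (Y : R -> Omega -> N).
Variables (Q : R -> R.-pker N ~> N) (sigma : N).
Hypothesis HY : markov_process P Y Q sigma.

Lemma process_measurable t : 0 <= t -> measurable_fun setT (Y t).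
Proof. by case: HY => + _ _; apply. Qed.

Lemma filtration_preimage r (A : set N) : 0 <= r -> measurable A ->
  natural_filtration Y r (Y r @^-1` A).
Proof.
move=> r0 mA; apply: sub_gen_smallest; exists r; first by rewrite /= in_itv/= r0/=.
by exists A => //; rewrite setTI.
Qed.

(** The Markov property at time 0, where the state is almost surely [sigma]. *)
Lemma one_time_law t (H : N -> \bar R) : 0 <= t -> (forall nu, (0 <= H nu)%E) ->
  measurable_fun setT H -> (\int[P]_w H (Y t w) = \int[Q t sigma]_nu H nu)%E.
Proof.
move=> t0 H0 mH; have mY := process_measurable t0.
rewrite -[RHS](@eq_measure_integral _ _ _ setT (Q t sigma) (pushforward P (Y t)) H).
  by rewrite ge0_integral_pushforward.
move=> B mB _; case: HY => _ Y0 /(_ 0 t setT B (lexx _) t0) h.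
have fT : natural_filtration Y 0 setT.
  by rewrite -(preimage_setT (Y 0)); exact: filtration_preimage.
have {}h := h fT mB; rewrite setTI add0r in h; apply: (etrans h).
have mk : measurable_fun setT (fun w => Q t (Y 0 w) B).
  apply: (@measurableT_comp _ _ _ _ _ _ (fun nu => Q t nu B) _ (Y 0)).
    exact: measurable_kernel.
  exact: process_measurable.
transitivity (\int[P]_w (cst (Q t sigma B) w))%E; last first.
  rewrite integral_cst// -[RHS]mule1; congr (_ * _)%E.
  exact: probability_setT.
apply: ge0_ae_eq_integral => //.
by apply: filterS Y0 => w Yw _ /=; rewrite Yw.
Qed.

(** The Markov property concerns indicators; it is extended first in the future
    variable, then in the past one. *)
Lemma two_time_law r t (F H : N -> \bar R) : 0 <= r -> 0 <= t ->
  (forall nu, (0 <= F nu)%E) -> measurable_fun setT F ->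
  (forall nu, (0 <= H nu)%E) -> measurable_fun setT H ->
  (\int[P]_w (F (Y r w) * H (Y (r + t) w)) =
   \int[P]_w (F (Y r w) * \int[Q t (Y r w)]_nu H nu))%E.
Proof.
move=> r0 t0 F0 mF H0 mH.
have mYr := process_measurable r0.
have mYs := process_measurable (addr_ge0 r0 t0).
have mK H' : (forall nu, (0 <= H' nu)%E) -> measurable_fun setT H' ->
    measurable_fun setT (fun w => \int[Q t (Y r w)]_nu H' nu)%E.
  move=> H'0 mH'; apply: (@measurableT_comp _ _ _ _ _ _ (fun x => \int[Q t x]_y H' y)%E _ (Y r)) => //.
  by apply: measurable_fun_integral_kernel => // U mU; exact: measurable_kernel.
(* indicator in the past, arbitrary function of the future *)
have step A : measurable A ->
  (\int[P]_w ((\1_A (Y r w))%:E * H (Y (r + t) w)) =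
   \int[P]_w ((\1_A (Y r w))%:E * \int[Q t (Y r w)]_nu H nu))%E.
  move=> mA.
  have mg : measurable_fun setT (fun w => (\1_A (Y r w))%:E : \bar R).
    apply/measurable_EFinP; apply: (@measurableT_comp _ _ _ _ _ _ (\1_A : N -> R) _ (Y r)) => //.
  have g0 w : (0 <= (\1_A (Y r w))%:E :> \bar R)%E by rewrite lee_fin.
  apply: (@integral_like_eq _ N R
    (fun H => \int[P]_w ((\1_A (Y r w))%:E * H (Y (r + t) w)))%E
    (fun H => \int[P]_w ((\1_A (Y r w))%:E * \int[Q t (Y r w)]_nu H nu))%E) => //.
  - exact: (integral_like_image P g0 mg mYs).
  - exact: (integral_like_kernel P g0 mg (Q t) mYr).
  - move=> B mB.
    have mAB : measurable (Y r @^-1` A `&` Y (r + t) @^-1` B).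
      by apply: measurableI; rewrite -[X in measurable X]setTI; [exact: mYr|exact: mYs].
    have mA' : measurable (Y r @^-1` A).
      by rewrite -[X in measurable X]setTI; exact: mYr.
    transitivity (P (Y r @^-1` A `&` Y (r + t) @^-1` B)).
      rewrite (_ : P _ = \int[P]_w (\1_(Y r @^-1` A `&` Y (r + t) @^-1` B) w)%:E)%E; last first.
        by rewrite integral_indic// setIT.
      apply: eq_integral => w _; rewrite -EFinM !indicE -natrM mulnb.
      rewrite (_ : (w \in _) = (Y r w \in A) && (Y (r + t) w \in B))//.
      by apply/idP/andP; rewrite !inE.
    case: HY => _ _ /(_ r t (Y r @^-1` A) B r0 t0 (filtration_preimage r0 mA) mB) ->.
    rewrite [LHS]integral_mkcond; apply: eq_integral => w _.
    rewrite patchE integral_indic// setIT.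
    case: ifPn => h.
      by rewrite indicE mem_set ?mul1e//; move: h; rewrite inE.
    by rewrite indicE memNset ?mul0e//; move: h; rewrite notin_setE.
apply: (@integral_like_eq _ N R
    (fun F => \int[P]_w (F (Y r w) * H (Y (r + t) w)))%E
    (fun F => \int[P]_w (F (Y r w) * \int[Q t (Y r w)]_nu H nu))%E) => //.
- under eq_fun do under eq_integral do rewrite muleC.
  apply: (integral_like_image P _ _ mYr) => //.
  exact: measurableT_comp mH mYs.
- under eq_fun do under eq_integral do rewrite muleC.
  apply: (integral_like_image P _ _ mYr) => //; last exact: mK.
  by move=> w; apply: integral_ge0.
Qed.

End markov_laws.

(** * Moments and covariances of the process *)

(** The inequality of arithmetic and geometric means with weight [e]. Below, [e] is
    the decay factor and [y] fluctuates on the scale [e], so both terms have size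
    [e]. *)
Lemma weighted_product_le (R : realType) (e x y m n k : R) : 0 < e ->
  x * (y + k) <= (e / 2 * (x - m) ^+ 2 + (2 * e)^-1 * (y - n) ^+ 2) +
    ((n + k) * x + (m * y + - (m * n))).
Proof.
move=> e0.
have : 0 <= (2 * e)^-1 * (e * (x - m) - (y - n)) ^+ 2.
  by rewrite mulr_ge0 ?sqr_ge0// invr_ge0 mulr_ge0// ltW.
have -> : (2 * e)^-1 * (e * (x - m) - (y - n)) ^+ 2 =
  e / 2 * (x - m) ^+ 2 + (2 * e)^-1 * (y - n) ^+ 2 - (x - m) * (y - n).
  by field; rewrite gt_eqF.
lra.
Qed.

Section process_moments.
Variable R : realType.
Notation RR := (measurableTypeR R).
Notation N := (int_measure R).
Notation mu := (@lebesgue_measure R).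
Variables (G : probability RR R) (beta : R -> R) (Psi : R -> R -> R) (a : R).
Hypothesis a0 : 0 < a.
Local Notation V := (weight a).
Variables (L : {finite_measure set N -> \bar R}).
Hypothesis HL2 : (\int[L]_(nu in nonnull R) (epairing nu (EFin \o V) ^+ 2) < +oo)%E.
Variables (c0 c1 : R).
Hypotheses (c00 : 0 <= c0) (c10 : 0 <= c1).
Hypothesis nonlinear_le : forall h u v, nonlinear_evolution G Psi h u ->
  linear_evolution G beta h v ->
  forall t x, 0 <= t -> 0 < x -> u t x <= v t x.
Hypothesis linear_le : forall h v A, linear_evolution G beta h v -> 0 <= A ->
  vanishes_off_pos h -> (forall x, 0 < x -> h x <= A * V x) ->
  forall t x, 0 <= t -> 0 < x -> v t x <= c0 * A * (expR (- (a * t)) * V x).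
Hypothesis quadratic_le : forall h u v A, nonlinear_evolution G Psi h u ->
  linear_evolution G beta h v -> 0 <= A ->
  vanishes_off_pos h -> (forall x, 0 < x -> h x <= A * V x) ->
  forall t x, 0 <= t -> 0 < x ->
    v t x - u t x <= c1 * A ^+ 2 * (expR (- (a * t)) * V x).
Hypothesis linear_scale : forall h v k, 0 <= k -> linear_evolution G beta h v ->
  linear_evolution G beta (fun x => k * h x) (fun t x => k * v t x).
Hypothesis linear_exists : forall h, bounded_borel_pos h ->
  exists v, linear_evolution G beta h v.
Variable Q : R -> R.-pker N ~> N.
Hypothesis HQ : forall h, bounded_borel_pos h -> exists u,
  nonlinear_evolution G Psi h u /\
  forall (t : R) (nu : N), 0 <= t ->
    \int[Q t nu]_nu' expR (- pairing nu' h) =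
    expR (- pairing nu (u t) - \int[mu]_(s in `]0, t]%classic) psi L (u s)).

Lemma bounded_borel_pos_measurable (h : R -> R) : bounded_borel_pos h -> bounded_measurable h.
Proof. by move=> [[_ mh [M hM]] _]; split => //; exists M => x _; exact: hM. Qed.

(** The mean of [<Y_t, f>] from the state [nu], if [v] is the linear flow of [f]. *)
Definition mean (v : R -> R -> R) (nu : N) (t : R) : R :=
  pairing nu (v t) + \int[mu]_(s in `]0, t]%classic) immigration_rate L v s.

(** Up to a factor, a bound on the variance of [<Y_t, f>] from [nu] for [f <= V],
    uniform in [t]. *)
Definition variance_constant (nu : N) : R :=
  c1 * mass a nu + (c1 * \int[L]_n mass a n + c0 ^+ 2 * \int[L]_n (mass a n ^+ 2)) / a.

Lemma variance_constant_ge0 nu : 0 <= variance_constant nu.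
Proof.
apply: addr_ge0; first by apply: mulr_ge0 => //; exact: mass_ge0.
apply: mulr_ge0; last by rewrite invr_ge0 ltW.
apply: addr_ge0; apply: mulr_ge0.
- exact: c10.
- by apply: Rintegral_ge0 => n _; exact: mass_ge0.
- exact: sqr_ge0.
- by apply: Rintegral_ge0 => n _; exact: sqr_ge0.
Qed.

Section one_function.
Variables (h : R -> R) (v : R -> R -> R) (A : R).
Hypotheses (Hh : bounded_borel_pos h) (Hv : linear_evolution G beta h v) (A0 : 0 <= A).
Hypothesis hA : forall x, 0 < x -> h x <= A * V x.

Let hoff : vanishes_off_pos h. Proof. by case: Hh => -[]. Qed.
Let h0 x : 0 <= h x. Proof. by case: Hh. Qed.
Let lv : locally_bounded v. Proof. by case: Hv. Qed.
Let v0 t x : 0 <= t -> 0 <= v t x. Proof. by case: Hv => _ + _; apply. Qed.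
Let vV := linear_le Hv A0 hoff hA.

Lemma time_bounded_rate : time_bounded (immigration_rate L v).
Proof. exact: (time_bounded_immigration_rate a0 HL2 lv v0 c00 A0 vV). Qed.

Lemma mean_ge0 nu t : 0 <= t -> 0 <= mean v nu t.
Proof.
move=> t0; apply: addr_ge0; first by apply: pairing_ge0 => x _; exact: v0.
apply: Rintegral_ge0 => s /=; rewrite in_itv/= => /andP[/ltW s0 _].
by have /andP[] := immigration_rate_le a0 HL2 lv v0 c00 A0 vV s0.
Qed.

Lemma meanZ (th : R) nu t : 0 <= t ->
  mean (fun t x => th * v t x) nu t = th * mean v nu t.
Proof.
move=> t0; rewrite /mean mulrDr; congr (_ + _).
  by rewrite pairingZ//; exact: locally_bounded_section.
rewrite -RintegralZl//; last exact: (time_bounded_integrable t time_bounded_rate).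
apply: eq_Rintegral => s; rewrite inE/= in_itv/= => /andP[/ltW s0 _].
rewrite /immigration_rate -RintegralZl//.
  apply: eq_Rintegral => nu' _; rewrite pairingZ//; exact: locally_bounded_section.
exact: (pairing_v_integrable a0 HL2 lv v0 c00 A0 vV s0).
Qed.

(** The Laplace exponent at [th * h] is linear in [th] up to a quadratic error, which
    determines the mean and bounds the variance. *)
Lemma transition_moments nu t : 0 <= t ->
  [/\ (Q t nu).-integrable setT (EFin \o (fun nu' => pairing nu' h)),
     \int[Q t nu]_nu' pairing nu' h = mean v nu t &
     (\int[Q t nu]_nu' ((pairing nu' h - mean v nu t) ^+ 2)%:E <=
       (8 * (variance_constant nu * A ^+ 2))%:E)%E].
Proof.
move=> t0.
have bh := bounded_borel_pos_measurable Hh.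
have mX := measurable_pairing_state bh.
have X0 (nu' : N) : 0 <= pairing nu' h by apply: pairing_ge0 => x _; exact: h0.
have m0 := mean_ge0 nu t0.
have C0 : 0 <= variance_constant nu * A ^+ 2.
  by apply: mulr_ge0; [exact: variance_constant_ge0|exact: sqr_ge0].
have lap (th : R) : 0 < th <= 1 -> exists Phi : R,
    th * mean v nu t - th ^+ 2 * (variance_constant nu * A ^+ 2) <= Phi <= th * mean v nu t /\
    \int[kernel_law (Q t) nu]_nu' expR (- (th * pairing nu' h)) = expR (- Phi).
  move=> /andP[th0 th1].
  have Hh' : bounded_borel_pos (fun x => th * h x).
    have [[_ mh [M hM]] _] := Hh; split.
      split; first by move=> x x0; rewrite hoff// mulr0.
        by apply: measurable_funM => //; exact: measurable_cst.
      exists M => x; rewrite normrM gtr0_norm//; apply: le_trans (hM x).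
      by rewrite ler_piMl.
    by move=> x; rewrite mulr_ge0// ltW.
  have [u [Hu uE]] := HQ Hh'.
  have Hv' := linear_scale (ltW th0) Hv.
  have A0' : 0 <= th * A by rewrite mulr_ge0// ltW.
  have hoff' : vanishes_off_pos (fun x => th * h x) by case: Hh' => -[].
  have hA' x : 0 < x -> th * h x <= th * A * V x.
    by move=> x0; rewrite -mulrA ler_wpM2l ?(ltW th0)// hA.
  have [lu u0 _] := Hu; have [lv' v0' _] := Hv'.
  exists (pairing nu (u t) + \int[mu]_(s in `]0, t]%classic) psi L (u s)); split.
    have := exponent_bounds a0 HL2 lu lv' u0 v0' c00 c10 A0' (nonlinear_le Hu Hv')
      (linear_le Hv' A0' hoff' hA') (quadratic_le Hu Hv' A0' hoff' hA') nu t0.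
    cbv zeta; rewrite -/(mean _ nu t) meanZ// -/(variance_constant nu).
    by rewrite exprMn mulrCA.
  rewrite opprD -(uE _ _ t0).
  apply: (@eq_Rintegral _ _ _ (Q t nu)) => nu' _.
  by rewrite pairingZ.
split.
- exact: (laplace_integrable mX X0 lap).
- exact: (laplace_mean mX X0 m0 C0 lap).
- exact: (laplace_variance mX X0 m0 C0 lap).
Qed.

End one_function.

Context d (Omega : measurableType d).
Variables (P : probability Omega R) (Y : R -> Omega -> N) (sigma : N).
Hypothesis HY : markov_process P Y Q sigma.

Section covariance.
Variables (f : R -> R) (v : R -> R -> R) (A : R).
Hypotheses (Hf : bounded_borel_pos f) (Hv : linear_evolution G beta f v) (A0 : 0 <= A).
Hypothesis fA : forall x, 0 < x -> f x <= A * V x.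

Let X t w := pairing (Y t w) f.

Let mpos h : bounded_borel_pos h -> measurable_fun setT (fun nu : N => (pairing nu h)%:E).
Proof.
move=> Hh; apply/measurable_EFinP; apply: measurable_pairing_state.
exact: bounded_borel_pos_measurable.
Qed.

Let pos h (nu : N) : bounded_borel_pos h -> (0 <= (pairing nu h)%:E)%E.
Proof. by move=> [_ h0]; rewrite lee_fin; apply: pairing_ge0 => x _; exact: h0. Qed.

Lemma process_moments h vh Ah r : bounded_borel_pos h -> linear_evolution G beta h vh ->
  0 <= Ah -> (forall x, 0 < x -> h x <= Ah * V x) -> 0 <= r ->
  (\int[P]_w (pairing (Y r w) h)%:E)%E = (mean vh sigma r)%:E /\
  (\int[P]_w ((pairing (Y r w) h - mean vh sigma r) ^+ 2)%:E <=
     (8 * (variance_constant sigma * Ah ^+ 2))%:E)%E.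
Proof.
move=> Hh Hvh Ah0 hAh r0.
have [i1 i2 i3] := transition_moments Hh Hvh Ah0 hAh sigma r0.
split.
  rewrite (one_time_law HY r0 (fun nu => pos nu Hh) (mpos Hh)) -i2.
  by rewrite /Rintegral fineK//; exact: integrable_fin_num.
apply: le_trans i3; rewrite -(one_time_law HY r0)//.
- by move=> nu; rewrite lee_fin sqr_ge0.
- apply/measurable_EFinP; apply: measurable_funX; apply: measurable_funB; last exact: measurable_cst.
  by apply: measurable_pairing_state; exact: bounded_borel_pos_measurable.
Qed.

Let measurable_X h r : bounded_borel_pos h -> 0 <= r ->
  measurable_fun setT (fun w => pairing (Y r w) h).
Proof.
move=> Hh r0; apply: (@measurableT_comp _ _ _ _ _ _ (fun nu : N => pairing nu h) _ (Y r)).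
  by apply: measurable_pairing_state; exact: bounded_borel_pos_measurable.
exact: (process_measurable HY).
Qed.

Let ge0_integrable (F : Omega -> R) (M : \bar R) : measurable_fun setT F ->
  (forall w, 0 <= F w) -> (\int[P]_w (F w)%:E <= M)%E -> (M < +oo)%E ->
  P.-integrable setT (EFin \o F).
Proof.
move=> mF F0 FM Moo; apply/integrableP; split; first exact/measurable_EFinP.
apply: le_lt_trans Moo; apply: le_trans FM; rewrite le_eqVlt; apply/orP; left; apply/eqP.
by apply: eq_integral => w _; rewrite /= ger0_norm.
Qed.

Definition covariance_constant : R :=
  4 * variance_constant sigma * A ^+ 2 * (1 + c0 ^+ 2).

Lemma covariance_constant_ge0 : 0 <= covariance_constant.
Proof.
have := variance_constant_ge0 sigma => h.
by rewrite !mulr_ge0 ?sqr_ge0// addr_ge0 ?sqr_ge0.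
Qed.

(** Given the state at [r], the mean at [r + t] is a constant plus [<Y_r, v t>], and
    [v t] is at most [expR (- (a * t))] times a multiple of [V]; so [<Y_r, v t>] has
    a standard deviation of that size. *)
Lemma covariance_decay r t : 0 <= r -> 0 <= t ->
  (\int[P]_w (X r w * X (r + t) w)%:E <=
   (mean v sigma r * mean v sigma (r + t) + covariance_constant * expR (- (a * t)))%:E)%E.
Proof.
move=> r0 t0.
have [lv v0 _] := Hv.
(* By the Markov property the conditional mean of [X (r + t)] is [H + k]. *)
pose h := v t.
have foff : vanishes_off_pos f by case: Hf => -[].
have Hh : bounded_borel_pos h.
  split; last by move=> x; exact: v0.
  have [off _ bv] := lv; split.
  - exact: off.
  - by case: (locally_bounded_section lv t0).
  - by have [M hM] := bv t; exists M => x; apply: hM; rewrite t0 lexx.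
have [vh Hvh] := linear_exists Hh.
pose e := expR (- (a * t)).
have e0 : 0 < e by exact: expR_gt0.
pose Ah := c0 * A * e.
have Ah0 : 0 <= Ah by rewrite !mulr_ge0// ltW.
have hAh x : 0 < x -> h x <= Ah * V x.
  by move=> x0; rewrite /Ah -mulrA; exact: (linear_le Hv A0 foff fA).
have [mh1 mh2] := process_moments Hh Hvh Ah0 hAh r0.
have [mf1 mf2] := process_moments Hf Hv A0 fA r0.
set mh := mean vh sigma r in mh1 mh2; set mf := mean v sigma r in mf1 mf2 *.
pose k := \int[mu]_(s in `]0, t]%classic) immigration_rate L v s.
have rt0 : 0 <= r + t by rewrite addr_ge0.
have [mrt _] := process_moments Hf Hv A0 fA rt0.
have inner w : (\int[Q t (Y r w)]_nu (pairing nu f)%:E)%E = (pairing (Y r w) h + k)%:E.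
  have [i1 i2 _] := transition_moments Hf Hv A0 fA (Y r w) t0.
  transitivity ((\int[Q t (Y r w)]_nu pairing nu f)%:E); last by exact: (congr1 EFin i2).
  by rewrite /Rintegral fineK; [|exact: (integrable_fin_num measurableT i1)].
have k0 : 0 <= k.
  apply: Rintegral_ge0 => s /=; rewrite in_itv/= => /andP[/ltW s0 _].
  by have /andP[] := immigration_rate_le a0 HL2 lv v0 c00 A0 (linear_le Hv A0 foff fA) s0.
pose H w := pairing (Y r w) h.
have mX := measurable_X Hf r0.
have mH := measurable_X Hh r0.
have X0 w : 0 <= X r w by rewrite -lee_fin; exact: pos.
have H0 w : 0 <= H w by rewrite -lee_fin; exact: pos.
have iX : P.-integrable setT (EFin \o X r).
  by apply: (ge0_integrable mX X0 (M := mf%:E)); [rewrite -mf1|rewrite ltry].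
have iH : P.-integrable setT (EFin \o H).
  by apply: (ge0_integrable mH H0 (M := mh%:E)); [rewrite -mh1|rewrite ltry].
have EX : \int[P]_w X r w = mf by exact: (congr1 fine mf1).
have EH : \int[P]_w H w = mh by exact: (congr1 fine mh1).
have PT : \int[P]_w (1 : R) = 1.
  by rewrite Rintegral_cst// mul1r; exact: (congr1 fine (probability_setT P)).
have i1 (c : R) : P.-integrable setT (EFin \o (fun=> c)).
  apply: measurable_bounded_integrable => //; first by rewrite ltey_eq fin_num_measure.
  exists `|c|; split; first exact: num_real.
  by move=> y cy w _ /=; rewrite ltW.
have Icst c : \int[P]_w c = c.
  by rewrite Rintegral_cst// (congr1 fine (probability_setT P)) mulr1.
have mrtE : mean v sigma (r + t) = mh + k.
  apply: EFin_inj; rewrite -mrt.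
  have := two_time_law HY (F := fun=> 1%E) (H := fun nu => (pairing nu f)%:E) r0 t0
    (fun=> lee01) (measurable_cst _) (fun nu => pos nu Hf) (mpos Hf).
  under eq_integral do rewrite mul1e.
  under [in RHS]eq_integral do rewrite mul1e inner.
  move=> ->; transitivity ((\int[P]_w (H w + k))%:E).
    exact: (esym (fineK (integrable_fin_num measurableT
      (@integrable_addR _ _ _ P _ H (fun=> k) measurableT iH (i1 k))))).
  have E : \int[P]_w (H w + k) = \int[P]_w H w + \int[P]_w k.
    exact: (RintegralD measurableT iH (i1 k)).
  exact: (congr1 EFin (etrans E (congr2 +%R EH (Icst k)))).
pose dX w := (X r w - mf) ^+ 2.
pose dH w := (H w - mh) ^+ 2.
have mdX : measurable_fun setT dX.
  by apply: measurable_funX; apply: measurable_funB => //; exact: measurable_cst.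
have mdH : measurable_fun setT dH.
  by apply: measurable_funX; apply: measurable_funB => //; exact: measurable_cst.
have idX : P.-integrable setT (EFin \o dX).
  by apply: (ge0_integrable mdX _ mf2); [move=> w; exact: sqr_ge0|rewrite ltry].
have idH : P.-integrable setT (EFin \o dH).
  by apply: (ge0_integrable mdH _ mh2); [move=> w; exact: sqr_ge0|rewrite ltry].
have VX : \int[P]_w dX w <= 8 * (variance_constant sigma * A ^+ 2).
  by rewrite -lee_fin /Rintegral fineK; [exact: mf2|exact: (integrable_fin_num measurableT idX)].
have VH : \int[P]_w dH w <= 8 * (variance_constant sigma * Ah ^+ 2).
  by rewrite -lee_fin /Rintegral fineK; [exact: mh2|exact: (integrable_fin_num measurableT idH)].
pose U w := (e / 2 * dX w + (2 * e)^-1 * dH w) + ((mh + k) * X r w + (mf * H w + - (mf * mh))).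
have j1 := integrableZl measurableT (e / 2) idX.
have j2 := integrableZl measurableT (2 * e)^-1 idH.
have j3 := integrableZl measurableT (mh + k) iX.
have j4 := integrableZl measurableT mf iH.
have j12 := @integrable_addR _ _ _ P _ (fun w => e / 2 * dX w) (fun w => (2 * e)^-1 * dH w) measurableT j1 j2.
have j45 := @integrable_addR _ _ _ P _ (fun w => mf * H w) (fun=> - (mf * mh)) measurableT j4 (i1 _).
have j345 := @integrable_addR _ _ _ P _ (fun w => (mh + k) * X r w) (fun w => mf * H w + - (mf * mh)) measurableT j3 j45.
have jU : P.-integrable setT (EFin \o U) := integrable_addR measurableT j12 j345.
have UE : \int[P]_w U w = (e / 2 * \int[P]_w dX w + (2 * e)^-1 * \int[P]_w dH w) + (mh + k) * mf.
  have E1 : \int[P]_w U w = \int[P]_w (e / 2 * dX w + (2 * e)^-1 * dH w) +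
      \int[P]_w ((mh + k) * X r w + (mf * H w + - (mf * mh))).
    exact: (RintegralD measurableT j12 j345).
  have E2 : \int[P]_w (e / 2 * dX w + (2 * e)^-1 * dH w) =
      \int[P]_w (e / 2 * dX w) + \int[P]_w ((2 * e)^-1 * dH w).
    exact: (RintegralD measurableT j1 j2).
  have E3 : \int[P]_w ((mh + k) * X r w + (mf * H w + - (mf * mh))) =
      \int[P]_w ((mh + k) * X r w) + \int[P]_w (mf * H w + - (mf * mh)).
    exact: (RintegralD measurableT j3 j45).
  have E4 : \int[P]_w (mf * H w + - (mf * mh)) = \int[P]_w (mf * H w) + \int[P]_w (- (mf * mh)).
    exact: (RintegralD measurableT j4 (i1 _)).
  have E5 : \int[P]_w (e / 2 * dX w) = e / 2 * \int[P]_w dX w.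
    exact: (RintegralZl _ measurableT idX).
  have E6 : \int[P]_w ((2 * e)^-1 * dH w) = (2 * e)^-1 * \int[P]_w dH w.
    exact: (RintegralZl _ measurableT idH).
  have E7 : \int[P]_w ((mh + k) * X r w) = (mh + k) * \int[P]_w X r w.
    exact: (RintegralZl _ measurableT iX).
  have E8 : \int[P]_w (mf * H w) = mf * \int[P]_w H w.
    exact: (RintegralZl _ measurableT iH).
  have E9 : mf * \int[P]_w H w + \int[P]_w (- (mf * mh)) = 0.
    exact: (etrans (congr2 (fun x y => mf * x + y) EH (Icst (- (mf * mh)))) (subrr _)).
  have E10 : \int[P]_w ((mh + k) * X r w + (mf * H w + - (mf * mh))) = (mh + k) * mf.
    apply: (etrans E3); apply: (etrans (congr2 +%R E7 (etrans E4 (congr1 (+%R^~ _) E8)))).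
    exact: (etrans (congr2 +%R (congr1 ( *%R (mh + k)) EX) E9) (addr0 _)).
  exact: (etrans E1 (congr2 +%R (etrans E2 (congr2 +%R E5 E6)) E10)).
have -> : (\int[P]_w (X r w * X (r + t) w)%:E = \int[P]_w (X r w * (H w + k))%:E)%E.
  have := two_time_law HY (F := fun nu => (pairing nu f)%:E) (H := fun nu => (pairing nu f)%:E) r0 t0
    (fun nu => pos nu Hf) (mpos Hf) (fun nu => pos nu Hf) (mpos Hf).
  by under [in RHS]eq_integral do rewrite inner.
apply: (@le_trans _ _ (\int[P]_w (U w)%:E)%E).
  apply: ge0_le_integral => //.
  - by move=> w _; rewrite lee_fin mulr_ge0// addr_ge0.
  - apply/measurable_EFinP; apply: measurable_funM => //.
    by apply: measurable_funD => //; exact: measurable_cst.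
  - by have /measurable_int := jU.
  - move=> w _; rewrite lee_fin /U /dX /dH.
    move: (X r w) (H w) => x y.
    exact: weighted_product_le.
have -> : (\int[P]_w (U w)%:E)%E = (\int[P]_w U w)%:E.
  exact: (esym (fineK (integrable_fin_num measurableT jU))).
rewrite UE lee_fin mrtE.
have b1 : e / 2 * \int[P]_w dX w <= e / 2 * (8 * (variance_constant sigma * A ^+ 2)).
  by rewrite ler_wpM2l// divr_ge0// ltW.
have b2 : (2 * e)^-1 * \int[P]_w dH w <= (2 * e)^-1 * (8 * (variance_constant sigma * Ah ^+ 2)).
  by rewrite ler_wpM2l// invr_ge0 mulr_ge0// ltW.
have b3 : e / 2 * (8 * (variance_constant sigma * A ^+ 2)) +
  (2 * e)^-1 * (8 * (variance_constant sigma * Ah ^+ 2)) = covariance_constant * e.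
  by rewrite /covariance_constant /Ah; field; rewrite gt_eqF.
rewrite -/e -b3 (mulrC (mh + k)) addrC lerD2l.
exact: lerD.
Qed.

End covariance.

End process_moments.

(** * A two-sided exponential integral *)

Section two_sided_exponential.
Variable R : realType.
Notation RR := (measurableTypeR R).
Notation mu := (@lebesgue_measure R).

Lemma integral_expR (k x y : R) : x < y ->
  (\int[mu]_(s in `[x, y]) (k * expR (k * s))%:E = (expR (k * y) - expR (k * x))%:E)%E.
Proof.
move=> xy.
have dF (s : R) : is_derive s 1 (fun s => expR (k * s)) (k * expR (k * s)).
  have h : is_derive s 1 ( *%R k) k.
    have := is_deriveZ k (is_derive_id s (1 : R)).
    by rewrite -[k *: (1 : R)]/(k * 1) mulr1.
  by rewrite mulrC; exact: (is_derive1_comp (f := expR) (g := *%R k)).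
have cF : continuous (fun s : R => expR (k * s)).
  move=> s; apply: differentiable_continuous; apply/derivable1_diffP.
  by case: (dF s).
rewrite (continuous_FTC2 (F := fun s => expR (k * s)) xy).
- by rewrite EFinB.
- apply: continuous_subspaceT => s; apply: cvgM; [exact: cvg_cst|exact: cF].
- split.
  + by move=> s _; case: (dF s).
  + exact: cvg_at_right_filter (cF x).
  + exact: cvg_at_left_filter (cF y).
- by move=> s _; rewrite derive1E; case: (dF s).
Qed.

Lemma two_sided_expR_integral_le (a r t : R) : 0 < a ->
  (\int[mu]_(s in `]0%R, t]) (expR (- (a * `|s - r|)))%:E <= (2 / a)%:E)%E.
Proof.
move=> a0.
pose T := `|r| + `|t| + 1.
have T0 : 0 < T by rewrite ltr_wpDl// addr_ge0.
have me : measurable_fun [set: RR] (fun s : RR => (expR (- (a * `|s - r|)))%:E).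
  apply/measurable_EFinP; apply: measurableT_comp => //; apply: measurable_funN.
  apply: measurable_funM; first exact: measurable_cst.
  by apply: measurableT_comp => //; apply: measurable_funB => //; exact: measurable_cst.
have e0 (s : R) : (0 <= (expR (- (a * `|s - r|)))%:E)%E by rewrite lee_fin expR_ge0.
(* On either side of [r] the integrand is [c * expR (k * s)] with [k = a] or [- a]. *)
have side (k x y c : R) : `|k| = a -> x < y -> (expR (k * y) - expR (k * x)) * c / k <= a^-1 ->
    (forall s, x <= s <= y -> expR (- (a * `|s - r|)) = expR (k * s) * c) ->
    (\int[mu]_(s in `[x, y]) (expR (- (a * `|s - r|)))%:E <= (a^-1)%:E)%E.
  move=> ka xy le E.
  have k0 : k != 0 by rewrite -normr_gt0 ka.
  rewrite (_ : (\int[mu]_(s in _) _ = \int[mu]_(s in `[x, y]) ((c / k)%:E * (k * expR (k * s))%:E))%E); last first.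
    apply: eq_integral => s; rewrite inE/= in_itv/= => /E ->.
    by rewrite -EFinM; congr EFin; field.
  rewrite integralZl//.
    rewrite integral_expR// -EFinM lee_fin; apply: le_trans le.
    by rewrite le_eqVlt; apply/orP; left; apply/eqP; ring.
  apply: continuous_compact_integrable; first exact: segment_compact.
  apply: continuous_subspaceT => s; apply: cvgM; first exact: cvg_cst.
  apply: continuous_comp; last exact: continuous_expR.
  by apply: cvgM; [exact: cvg_cst|exact: cvg_id].
have sub : `]0, t]%classic `<=` `[r - T, r]%classic `|` `]r, r + T]%classic.
  move=> s /=; rewrite !in_itv/= /T => /andP[s0 st].
  have := ler_norm r; have := ler_norm t; have := ler_norm (- r); rewrite normrN => h1 h2 h3.
  have h4 := normr_ge0 t.
  by case: (lerP s r) => sr; [left|right]; apply/andP; split; lra.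
apply: (@le_trans _ _ (\int[mu]_(s in (`[(r - T)%R, r] `|` `]r, (r + T)%R])%classic) (expR (- (a * `|s - r|)))%:E)%E).
  apply: ge0_subset_integral => //.
  - by apply: measurableU; exact: measurable_itv.
  - exact: measurable_funS me.
rewrite ge0_integral_setU//; last 2 first.
- exact: measurable_funS me.
- apply/disj_setPS => s [] /=; rewrite !in_itv/= => /andP[_ sr] /andP[rs _].
  by move: (le_lt_trans sr rs); rewrite ltxx.
have -> : (2 / a)%:E = (a^-1%:E + a^-1%:E)%E by rewrite -EFinD; congr EFin; ring.
apply: leeD.
  apply: (side a _ _ (expR (- (a * r)))).
  - by rewrite gtr0_norm.
  - by rewrite ltrBlDr ltrDl.
  - rewrite -[leRHS]mul1r; apply: ler_wpM2r; first by rewrite invr_ge0 ltW.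
    by rewrite mulrBl -!expRD subrr expR0 gerBl expR_ge0.
  - move=> s /andP[_ sr]; rewrite -expRD ler0_norm ?subr_le0//; congr expR; ring.
apply: (@le_trans _ _ (\int[mu]_(s in `[r, (r + T)%R]) (expR (- (a * `|s - r|)))%:E)%E).
  apply: ge0_subset_integral => //.
  - exact: measurable_funS me.
  - by move=> s /=; rewrite !in_itv/= => /andP[/ltW -> ->].
apply: (side (- a) _ _ (expR (a * r))).
- by rewrite normrN gtr0_norm.
- by rewrite ltrDl.
- rewrite invrN mulrN -mulNr -[leRHS]mul1r.
  apply: ler_wpM2r; first by rewrite invr_ge0 ltW.
  by rewrite mulrBl -!expRD [- a * r]mulNr addNr expR0 opprB gerBl expR_ge0.
- move=> s /andP[rs _]; rewrite -expRD ger0_norm ?subr_ge0//; congr expR; ring.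
Qed.

End two_sided_exponential.

(** * Second moment of a time integral *)

Lemma measurable_flip d1 d2 d3 (T1 : measurableType d1) (T2 : measurableType d2)
    (T3 : measurableType d3) (f : T1 * T2 -> T3) :
  measurable_fun [set: T1 * T2] f ->
  measurable_fun [set: T2 * T1] (fun z => f (z.2, z.1)).
Proof.
move=> mf; apply: (measurableT_comp mf).
by apply: measurable_fun_pair; [exact: measurable_snd|exact: measurable_fst].
Qed.

Section second_moment.
Variable R : realType.
Notation RR := (measurableTypeR R).
Notation mu := (@lebesgue_measure R).
Context d (Omega : measurableType d).
Variables (P : probability Omega R) (X : R -> Omega -> R) (m : R -> R).
Variables (a B C : R).
Hypotheses (a0 : 0 < a) (C0 : 0 <= C).
Hypothesis X0 : forall t w, 0 <= X t w.
Hypothesis mX : measurable_fun [set: RR * Omega] (fun z => X z.1 z.2).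
Hypothesis EX : forall t, (\int[P]_w (X t w)%:E = (m t)%:E)%E.
Hypothesis mB : forall t, m t <= B.
Hypothesis covX : forall r t, 0 <= r -> 0 <= t ->
  (\int[P]_w (X r w * X (r + t) w)%:E <= (m r * m (r + t) + C * expR (- (a * t)))%:E)%E.

(** Possibly infinite until its expectation is computed. *)
Definition time_integral (t : R) (w : Omega) : \bar R :=
  (\int[mu]_(s in `]0%R, t]) (X s w)%:E)%E.

Definition mean_integral (t : R) : R := \int[mu]_(s in `]0, t]%classic) m s.

Let mI (t : R) : measurable (`]0, t]%classic : set RR).
Proof. exact: measurable_itv. Qed.

Let XE0 t w : (0 <= (X t w)%:E)%E. Proof. by rewrite lee_fin. Qed.

Let mXE : measurable_fun [set: RR * Omega] (fun z => (X z.1 z.2)%:E).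
Proof. exact/measurable_EFinP. Qed.

Let mXs : measurable_fun [set: Omega * RR] (fun z => (X z.2 z.1)%:E).
Proof. exact: (measurable_flip mXE). Qed.

Lemma sections_measurable t : measurable_fun [set: Omega] (X t).
Proof. exact: (measurable_fun_pair2 (f := fun z : RR * Omega => X z.1 z.2) t mX). Qed.

Lemma paths_measurable w : measurable_fun [set: RR] (fun t : RR => X t w).
Proof. exact: (measurable_fun_pair1 (f := fun z : RR * Omega => X z.1 z.2) w mX). Qed.

Lemma time_integral_measurable t : measurable_fun setT (time_integral t).
Proof.
exact: (measurable_integral_on mu (mI t) (f := fun z : Omega * RR => (X z.2 z.1)%:E)
  (fun z => XE0 z.2 z.1) mXs).
Qed.

Lemma time_integral_ge0 t w : (0 <= time_integral t w)%E.
Proof. by apply: integral_ge0 => s _; exact: XE0. Qed.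

Lemma mean_function_ge0 t : 0 <= m t.
Proof. by rewrite -lee_fin -EX; apply: integral_ge0 => w _; exact: XE0. Qed.

Lemma mean_function_measurable : measurable_fun [set: RR] (m : RR -> R).
Proof.
apply/measurable_EFinP.
have -> : EFin \o (m : RR -> R) = (fun t : RR => \int[P]_(w in setT) (X t w)%:E)%E.
  by apply/funext => t /=; rewrite EX.
exact: (measurable_integral_on P measurableT (f := fun z : RR * Omega => (X z.1 z.2)%:E)
  (fun z => XE0 z.1 z.2) mXE).
Qed.

Lemma mean_function_integrable t : mu.-integrable `]0, t]%classic (EFin \o m).
Proof.
apply: (@itv_integrable _ m t B); first exact: measurable_funS mean_function_measurable.
by move=> s _; rewrite ger0_norm ?mean_function_ge0.
Qed.

Lemma mean_integralE t : (\int[mu]_(s in `]0%R, t]) (m s)%:E)%E = (mean_integral t)%:E.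
Proof. exact: (esym (fineK (integrable_fin_num (mI t) (mean_function_integrable t)))). Qed.

Lemma mean_integral_ge0 t : 0 <= mean_integral t.
Proof. by apply: Rintegral_ge0 => s _; exact: mean_function_ge0. Qed.

Lemma expectation_time_integral t : (\int[P]_w time_integral t w = (mean_integral t)%:E)%E.
Proof.
rewrite -mean_integralE.
have := tonelli_on P mu measurableT (mI t) (f := fun z : Omega * RR => (X z.2 z.1)%:E)
  (fun z => XE0 z.2 z.1) mXs.
move=> /= h; apply: (etrans h).
by apply: eq_integral => s _; exact: EX.
Qed.

Lemma covariance_le r s : 0 <= r -> 0 <= s ->
  (\int[P]_w (X r w * X s w)%:E <= (m r * m s + C * expR (- (a * `|s - r|)))%:E)%E.
Proof.
move=> r0 s0; case: (lerP r s) => rs.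
  have := covX r0 (t := s - r); rewrite subr_ge0 => /(_ rs).
  by rewrite addrC subrK.
have := covX s0 (t := r - s); rewrite subr_ge0 => /(_ (ltW rs)).
rewrite addrC subrK [m s * _]mulrC.
by under eq_integral do rewrite mulrC.
Qed.

(** One of the two time variables is integrated here, by Tonelli's theorem, and the
    other one in [second_moment_time_integral]. *)
Lemma expectation_product_time_integral r t : 0 <= r ->
  (\int[P]_w ((X r w)%:E * time_integral t w) <=
   (m r * mean_integral t + C * (2 / a))%:E)%E.
Proof.
move=> r0.
have mXX : measurable_fun [set: Omega * RR] (fun z => (X r z.1 * X z.2 z.1)%:E).
  apply/measurable_EFinP; apply: measurable_funM; last exact/measurable_EFinP.
  exact: measurableT_comp (sections_measurable r) measurable_fst.
have XX0 (z : Omega * RR) : (0 <= (X r z.1 * X z.2 z.1)%:E)%E by rewrite lee_fin mulr_ge0.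
have -> : (\int[P]_w ((X r w)%:E * time_integral t w) =
    \int[P]_w \int[mu]_(s in `]0%R, t]) (X r w * X s w)%:E)%E.
  apply: eq_integral => w _; rewrite /time_integral -ge0_integralZl//.
  apply/measurable_EFinP; exact: measurable_funS (paths_measurable w).
have := tonelli_on P mu measurableT (mI t) XX0 mXX; move=> /= ->.
have me : measurable_fun [set: RR] (fun s : RR => (expR (- (a * `|s - r|)))%:E).
  apply/measurable_EFinP; apply: measurableT_comp => //; apply: measurable_funN.
  apply: measurable_funM; first exact: measurable_cst.
  by apply: measurableT_comp => //; apply: measurable_funB => //; exact: measurable_cst.
have mb1 : measurable_fun [set: RR] (fun s : RR => ((m r)%:E * (m s)%:E)%E).
  by apply: measurable_funeM; apply/measurable_EFinP; exact: mean_function_measurable.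
have mb2 := measurable_funeM C%:E me.
have mbound := emeasurable_funD mb1 mb2.
apply: (@le_trans _ _ (\int[mu]_(s in `]0%R, t])
    ((m r)%:E * (m s)%:E + C%:E * (expR (- (a * `|s - r|)))%:E))%E).
  apply: ge0_le_integral.
  - exact: mI.
  - by move=> s _; apply: integral_ge0 => w _; exact: (XX0 (w, s)).
  - have mXX' := measurable_flip mXX.
    have := measurable_integral_on P measurableT (fun z : RR * Omega => XX0 (z.2, z.1)) mXX'.
    exact: measurable_funS.
  - exact: measurable_funS mbound.
  - move=> s /=; rewrite in_itv/= => /andP[s0 _].
    by rewrite -!EFinM -EFinD; apply: covariance_le => //; exact: ltW.
rewrite ge0_integralD; last 5 first.
- exact: mI.
- by move=> s _; rewrite -EFinM lee_fin mulr_ge0 ?mean_function_ge0.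
- exact: measurable_funS mb1.
- by move=> s _; rewrite -EFinM lee_fin mulr_ge0 ?expR_ge0.
- exact: measurable_funS mb2.
rewrite ge0_integralZl; last 4 first.
- exact: mI.
- by apply/measurable_EFinP; exact: measurable_funS mean_function_measurable.
- by move=> s _; rewrite lee_fin mean_function_ge0.
- by rewrite lee_fin mean_function_ge0.
rewrite ge0_integralZl; last 4 first.
- exact: mI.
- exact: measurable_funS me.
- by move=> s _; rewrite lee_fin expR_ge0.
- by rewrite lee_fin.
rewrite mean_integralE EFinD !EFinM; apply: leeD2l; apply: lee_wpmul2l; first by rewrite lee_fin.
by rewrite -EFinM; exact: two_sided_expR_integral_le.
Qed.

Lemma second_moment_time_integral t : 0 <= t ->
  (\int[P]_w (time_integral t w * time_integral t w) <=
   (mean_integral t ^+ 2 + C * (2 / a) * t)%:E)%E.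
Proof.
move=> t0.
have mZ := time_integral_measurable t.
have mXZ : measurable_fun [set: Omega * RR] (fun z => ((X z.2 z.1)%:E * time_integral t z.1)%E).
  apply: emeasurable_funM; first exact: mXs.
  exact: (measurableT_comp mZ (@measurable_fst _ _ Omega RR)).
have XZ0 (z : Omega * RR) : (0 <= (X z.2 z.1)%:E * time_integral t z.1)%E.
  by apply: mule_ge0; [exact: XE0|exact: time_integral_ge0].
have -> : (\int[P]_w (time_integral t w * time_integral t w) =
    \int[P]_w \int[mu]_(s in `]0%R, t]) ((X s w)%:E * time_integral t w))%E.
  apply: eq_integral => w _; rewrite {1}/time_integral muleC -ge0_integralZl//.
  - by apply: eq_integral => s _; rewrite muleC.
  - by apply/measurable_EFinP; exact: measurable_funS (paths_measurable w).
  - exact: time_integral_ge0.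
have := tonelli_on P mu measurableT (mI t) XZ0 mXZ; move=> /= ->.
apply: (@le_trans _ _ (\int[mu]_(s in `]0%R, t])
    ((mean_integral t)%:E * (m s)%:E + (C * (2 / a))%:E))%E).
  apply: ge0_le_integral.
  - exact: mI.
  - by move=> s _; apply: integral_ge0 => w _; exact: (XZ0 (w, s)).
  - have := measurable_integral_on P measurableT (fun z : RR * Omega => XZ0 (z.2, z.1)) (measurable_flip mXZ).
    exact: measurable_funS.
  - apply: emeasurable_funD; last exact: measurable_cst.
    apply: measurable_funeM; apply/measurable_EFinP.
    exact: measurable_funS mean_function_measurable.
  - move=> s /=; rewrite in_itv/= => /andP[s0 _].
    rewrite -!EFinM -EFinD [mean_integral t * _]mulrC.
    exact: expectation_product_time_integral (ltW s0).
have k0 : 0 <= C * (2 / a) by rewrite mulr_ge0// divr_ge0// ltW.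
rewrite ge0_integralD; last 5 first.
- exact: mI.
- by move=> s _; rewrite -EFinM lee_fin mulr_ge0 ?mean_function_ge0 ?mean_integral_ge0.
- apply: measurable_funeM; apply/measurable_EFinP.
  exact: measurable_funS mean_function_measurable.
- by move=> s _; rewrite lee_fin.
- exact: measurable_cst.
rewrite ge0_integralZl; last 4 first.
- exact: mI.
- by apply/measurable_EFinP; exact: measurable_funS mean_function_measurable.
- by move=> s _; rewrite lee_fin mean_function_ge0.
- by rewrite lee_fin mean_integral_ge0.
rewrite mean_integralE expr2 EFinD -EFinM leeD2l//.
rewrite (integral_cst mu (mI t)) [leRHS]EFinM; apply: lee_wpmul2l; first by rewrite lee_fin.
rewrite /= lebesgue_measure_itv/= lte_fin; case: ifP => // _.
by rewrite -EFinB subr0.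
Qed.

(** The centred square is bounded without first knowing that the time integral is
    finite: with [z] the real part of [Z], [(z - M) ^+ 2 + 2 * M * Z <= Z ^+ 2 + M ^+ 2]
    also holds when [Z] is infinite. *)
Lemma variance_time_integral t : 0 <= t ->
  (\int[P]_w ((fine (time_integral t w) - mean_integral t) ^+ 2)%:E <=
   (C * (2 / a) * t)%:E)%E.
Proof.
move=> t0.
have mZ := time_integral_measurable t.
have M0 := mean_integral_ge0 t.
set M := mean_integral t in M0 *.
have mD : measurable_fun setT (fun w => ((fine (time_integral t w) - M) ^+ 2)%:E).
  apply/measurable_EFinP; apply: measurable_funX; apply: measurable_funB; last exact: measurable_cst.
  exact: measurableT_comp.
have D0 w : (0 <= ((fine (time_integral t w) - M) ^+ 2)%:E)%E by rewrite lee_fin sqr_ge0.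
have : (\int[P]_w ((fine (time_integral t w) - M) ^+ 2)%:E + (2 * M ^+ 2)%:E <=
    (M ^+ 2 + C * (2 / a) * t)%:E + (M ^+ 2)%:E)%E.
  apply: (@le_trans _ _ (\int[P]_w (((fine (time_integral t w) - M) ^+ 2)%:E +
      (2 * M)%:E * time_integral t w))%E).
    rewrite ge0_integralD; last 5 first.
    - exact: measurableT.
    - by move=> w _.
    - exact: mD.
    - by move=> w _; apply: mule_ge0; [rewrite lee_fin mulr_ge0|exact: time_integral_ge0].
    - exact: measurable_funeM.
    rewrite ge0_integralZl; last 4 first.
    - exact: measurableT.
    - exact: mZ.
    - by move=> w _; exact: time_integral_ge0.
    - by rewrite lee_fin mulr_ge0.
    by rewrite expectation_time_integral -/M -EFinM expr2 mulrA.
  apply: (@le_trans _ _ (\int[P]_w (time_integral t w * time_integral t w + (M ^+ 2)%:E))%E).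
    apply: ge0_le_integral.
    - exact: measurableT.
    - by move=> w _; apply: adde_ge0 => //; apply: mule_ge0; [rewrite lee_fin mulr_ge0|exact: time_integral_ge0].
    - by apply: emeasurable_funD => //; exact: measurable_funeM.
    - by apply: emeasurable_funD; [exact: emeasurable_funM|exact: measurable_cst].
    - move=> w _; have := time_integral_ge0 t w.
      case: (time_integral t w) => [z z0| _|//] /=.
        by rewrite -!EFinM -!EFinD lee_fin le_eqVlt; apply/orP; left; apply/eqP; ring.
      by rewrite mulyy addye// leey.
  rewrite ge0_integralD; last 5 first.
  - exact: measurableT.
  - by move=> w _; apply: mule_ge0; exact: time_integral_ge0.
  - exact: emeasurable_funM.
  - by move=> w _; rewrite lee_fin sqr_ge0.
  - exact: measurable_cst.
  rewrite (integral_cst P measurableT); rewrite /= (@probability_setT _ _ _ P) mule1.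
  by apply: leeD2r; exact: second_moment_time_integral.
have -> : ((M ^+ 2 + C * (2 / a) * t)%:E + (M ^+ 2)%:E = (C * (2 / a) * t)%:E + (2 * M ^+ 2)%:E)%E.
  by rewrite -!EFinD; congr EFin; ring.
by rewrite leeD2rE.
Qed.

End second_moment.

(** * Interpolation between squares *)

Section interpolation.
Variable R : realType.

Definition square_time (n : nat) : R := n.+1%:R ^+ 2.

Lemma square_time_gt0 n : 0 < square_time n.
Proof. by rewrite exprn_gt0. Qed.

Lemma square_time_ratio_cvg : square_time n.+1 / square_time n @[n --> \oo] --> (1 : R).
Proof.
have h : (1 + harmonic n : R) ^+ 2 @[n --> \oo] --> (1 + 0 : R) ^+ 2.
  have h1 : (1 + harmonic n : R) @[n --> \oo] --> (1 + 0 : R).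
    by apply: cvgD; [exact: cvg_cst|exact: cvg_harmonic].
  by rewrite expr2; under eq_fun do rewrite expr2; exact: cvgM.
rewrite addr0 expr1n in h; apply: cvg_trans h; apply: near_eq_cvg.
near=> n; rewrite /square_time /harmonic -exprVn -exprMn; congr (_ ^+ 2).
rewrite -[n.+2]addn1 natrD mulrDl divff ?mul1r//.
Unshelve. all: by end_near.
Qed.

(** Between two consecutive squares a nondecreasing function moves by at most the
    ratio of the squares, and this ratio tends to one. *)
Lemma squares_interpolation (z : R -> R) (l : R) :
  (forall s t, 0 <= s -> s <= t -> 0 <= z s <= z t) ->
  (square_time n)^-1 * z (square_time n) @[n --> \oo] --> l ->
  t^-1 * z t @[t --> +oo] --> l.
Proof.
move=> zmono yl.
pose q n := square_time n.+1 / square_time n.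
have q0 n : 0 < q n by rewrite divr_gt0 ?square_time_gt0.
pose y n := (square_time n)^-1 * z (square_time n).
have up : y n.+1 * q n @[n --> \oo] --> l.
  rewrite -[l]mulr1; apply: cvgM; last exact: square_time_ratio_cvg.
  by rewrite (cvg_shiftS y).
have dn : y n / q n @[n --> \oo] --> l.
  rewrite -[l]mulr1; apply: cvgM => //.
  rewrite -[X in _ --> X]invr1; apply: cvgV; first exact: oner_neq0.
  exact: square_time_ratio_cvg.
apply/cvgrPdist_lt => e e0.
move/cvgrPdist_lt : up => /(_ e e0) [n1 _ up].
move/cvgrPdist_lt : dn => /(_ e e0) [n2 _ dn].
near=> t.
have t1 : 1 <= t by near: t; exact: nbhs_pinfty_ge.
have tn : square_time (maxn n1 n2) <= t by near: t; apply: nbhs_pinfty_ge; exact: num_real.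
have t0 : 0 < t by exact: lt_le_trans t1.
have st0 : 0 <= Num.sqrt t by exact: sqrtr_ge0.
have /andP[k1 k2] := truncn_itv st0.
set k := Num.trunc _ in k1 k2.
have k0 : (0 < k)%N.
  rewrite lt0n; apply/eqP => kE; move: k2; rewrite kE => s1.
  move: t1; rewrite leNgt -[t]sqr_sqrtr ?(ltW t0)// => /negP; apply.
  by rewrite expr_lt1.
pose n := k.-1.
have kn : k = n.+1 by rewrite prednK.
have ln : square_time n <= t.
  rewrite /square_time -kn -[leRHS]sqr_sqrtr ?(ltW t0)//.
  by rewrite lerXn2r// ?nnegrE.
have un : t < square_time n.+1.
  rewrite /square_time -kn -[ltLHS]sqr_sqrtr ?(ltW t0)//.
  by rewrite ltrXn2r// ?nnegrE.
have nn : (maxn n1 n2 <= n)%N.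
  rewrite leqNgt; apply/negP => nlt.
  have : square_time n.+1 <= square_time (maxn n1 n2).
    by rewrite /square_time lerXn2r ?nnegrE// ler_nat.
  by move=> h; move: (lt_le_trans un (le_trans h tn)); rewrite ltxx.
have := up n; have := dn n; move=> /=.
move=> /(_ (leq_trans (leq_maxr _ _) nn)) d1 /(_ (leq_trans (leq_maxl _ _) nn)) d2.
have sn0 := square_time_gt0 n; have sn10 := square_time_gt0 n.+1.
have U : t^-1 * z t <= y n.+1 * q n.
  have -> : y n.+1 * q n = (square_time n)^-1 * z (square_time n.+1).
    by rewrite /y /q; field; rewrite !gt_eqF.
  have /andP[z0 z1] := zmono _ _ (ltW t0) (ltW un).
  apply: ler_pM => //; first by rewrite invr_ge0 ltW.
  by rewrite lef_pV2.
have D : y n / q n <= t^-1 * z t.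
  have -> : y n / q n = (square_time n.+1)^-1 * z (square_time n).
    by rewrite /y /q; field; rewrite !gt_eqF.
  have /andP[z0 z1] := zmono _ _ (ltW sn0) ln.
  apply: ler_pM => //; first by rewrite invr_ge0 ltW.
  by rewrite lef_pV2// ltW.
move: d1 d2; rewrite !ltr_norml => /andP[d1 d2] /andP[d3 d4].
apply/andP; split; lra.
Unshelve. all: by end_near.
Qed.

Lemma summable_cvg0 (f : nat -> R) : (forall n, 0 <= f n) ->
  (\sum_(0 <= n <oo) (f n)%:E < +oo)%E -> f n @[n --> \oo] --> 0.
Proof.
move=> f0 foo.
apply: cvg_series_cvg_0; apply: nondecreasing_is_cvgn.
  by apply/nondecreasing_seqP => n; rewrite /series/= big_nat_recr//= lerDl.
exists (fine (\sum_(0 <= n <oo) (f n)%:E)%E) => _ [n _ <-].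
rewrite -lee_fin fineK; last first.
  by rewrite ge0_fin_numE//; apply: nneseries_ge0 => k _ _; rewrite lee_fin.
rewrite /series/= -sumEFin.
by apply: nneseries_lim_ge => k _ _; rewrite lee_fin.
Qed.

Lemma sum_inv_squares_lty (c : R) : 0 <= c ->
  (\sum_(0 <= n <oo) (c / square_time n)%:E < +oo)%E.
Proof.
move=> c0; apply: (@le_lt_trans _ _ (2 * c)%:E); last exact: ltry.
apply: lime_le.
  by apply: is_cvg_nneseries => n _ _; rewrite lee_fin divr_ge0// ltW// square_time_gt0.
near=> n; rewrite sumEFin lee_fin.
(* [c / n ^+ 2 <= 2 * c / n - 2 * c / n.+1] for [n = k.+1], which telescopes. *)
pose g (k : nat) : R := - (2 * c / k.+1%:R).
apply: (@le_trans _ _ (\sum_(0 <= k < n) (g k.+1 - g k))).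
  apply: ler_sum => k _; rewrite /g /square_time.
  have k0 : 0 < k.+1%:R :> R by [].
  have k1 : 1 <= k.+1%:R :> R by rewrite ler1n.
  rewrite -[k.+2]addn1 natrD; move: (k.+1%:R) k0 k1 => x x0 x1.
  rewrite opprK -subr_ge0.
  have -> : - (2 * c / (x + 1)) + 2 * c / x - c / x ^+ 2 = c * (x - 1) / (x ^+ 2 * (x + 1)).
    by field; rewrite !gt_eqF//; lra.
  apply: divr_ge0; first by rewrite mulr_ge0// subr_ge0.
  by rewrite mulr_ge0 ?sqr_ge0//; lra.
rewrite telescope_sumr// /g divr1 opprK addrC gerBl.
by rewrite divr_ge0// mulr_ge0.
Unshelve. all: by end_near.
Qed.

End interpolation.

(** * A strong law for decaying covariances *)

Lemma ge0_integral_lty_ae d (T : measurableType d) (R : realType)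
    (P : {measure set T -> \bar R}) (F : T -> \bar R) :
  measurable_fun setT F -> (forall w, (0 <= F w)%E) ->
  (\int[P]_w F w < +oo)%E -> {ae P, forall w, (F w < +oo)%E}.
Proof.
move=> mF F0 Foo.
have iF : P.-integrable setT F.
  apply/integrableP; split => //; apply: le_lt_trans Foo.
  by rewrite le_eqVlt; apply/orP; left; apply/eqP; apply: eq_integral => w _; rewrite gee0_abs.
have := integrable_ae measurableT iF; apply: filterS => w /(_ I).
by rewrite ge0_fin_numE.
Qed.

Lemma cvg0_sqr (R : realType) (x : nat -> R) :
  x n ^+ 2 @[n --> \oo] --> 0 -> x n @[n --> \oo] --> 0.
Proof.
move=> h; apply/norm_cvg0P.
have -> : (fun n => `|x n|) = (fun n => Num.sqrt (x n ^+ 2)).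
  by apply/funext => n; rewrite sqrtr_sqr.
rewrite -[X in _ --> X]sqrtr0.
exact: (cvg_comp _ _ h (@sqrt_continuous R 0)).
Qed.

Section strong_law.
Variable R : realType.
Notation RR := (measurableTypeR R).
Notation mu := (@lebesgue_measure R).
Context d (Omega : measurableType d).
Variables (P : probability Omega R) (X : R -> Omega -> R) (m : R -> R).
Variables (a B C l K : R).
Hypotheses (a0 : 0 < a) (C0 : 0 <= C).
Hypothesis X0 : forall t w, 0 <= X t w.
Hypothesis mX : measurable_fun [set: RR * Omega] (fun z => X z.1 z.2).
Hypothesis EX : forall t, (\int[P]_w (X t w)%:E = (m t)%:E)%E.
Hypothesis mB : forall t, m t <= B.
Hypothesis covX : forall r t, 0 <= r -> 0 <= t ->
  (\int[P]_w (X r w * X (r + t) w)%:E <= (m r * m (r + t) + C * expR (- (a * t)))%:E)%E.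
Hypothesis Ml : forall t, 0 <= t -> `|mean_integral m t - l * t| <= K.

Local Notation Z := (time_integral X).
Local Notation M := (mean_integral m).
Local Notation tau := (@square_time R).

(** The sum over [n] of the squared deviations of the averages at the times [n ^+ 2]
    has a finite expectation, so almost surely these deviations tend to 0. *)
Lemma strong_law : {ae P, forall w,
  (forall t, 0 <= t -> Z t w \is a fin_num) /\ t^-1 * fine (Z t w) @[t --> +oo] --> l}.
Proof.
have mZ := time_integral_measurable X0 mX.
have Z0 := time_integral_ge0 X0.
pose D n w := ((fine (Z (tau n) w) - M (tau n)) / tau n) ^+ 2.
have D0 n w : 0 <= D n w by exact: sqr_ge0.
have mD n : measurable_fun setT (fun w => (D n w)%:E).
  apply/measurable_EFinP; apply: measurable_funX; apply: measurable_funM; last exact: measurable_cst.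
  by apply: measurable_funB; [exact: measurableT_comp (mZ _)|exact: measurable_cst].
pose c := C * (2 / a).
have c0 : 0 <= c by rewrite mulr_ge0// divr_ge0// ltW.
have ED n : (\int[P]_w (D n w)%:E <= (c / tau n)%:E)%E.
  have tn := square_time_gt0 R n.
  have -> : (\int[P]_w (D n w)%:E =
      \int[P]_w (((tau n)^-1 ^+ 2)%:E * ((fine (Z (tau n) w) - M (tau n)) ^+ 2)%:E))%E.
    by apply: eq_integral => w _; rewrite -EFinM /D exprMn mulrC.
  rewrite ge0_integralZl; last 4 first.
  - exact: measurableT.
  - apply/measurable_EFinP; apply: measurable_funX.
    by apply: measurable_funB; [exact: measurableT_comp (mZ _)|exact: measurable_cst].
  - by move=> w _; rewrite lee_fin sqr_ge0.
  - by rewrite lee_fin sqr_ge0.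
  have -> : c / tau n = (tau n)^-1 ^+ 2 * (c * tau n) by field; rewrite gt_eqF.
  rewrite [leRHS]EFinM; apply: lee_wpmul2l; first by rewrite lee_fin sqr_ge0.
  exact: (variance_time_integral a0 C0 X0 mX EX mB covX (ltW tn)).
have sumD : {ae P, forall w, (\sum_(0 <= n <oo) (D n w)%:E < +oo)%E}.
  apply: ge0_integral_lty_ae.
  - by apply: ge0_emeasurable_sum => [n w _ _|n _]; [rewrite lee_fin|exact: mD].
  - by move=> w; apply: nneseries_ge0 => n _ _; rewrite lee_fin.
  rewrite integral_nneseries//; last by move=> n w _; rewrite lee_fin.
  apply: le_lt_trans (sum_inv_squares_lty c0).
  by apply: lee_nneseries => n _; [move=> _; apply: integral_ge0 => w _; rewrite lee_fin|exact: ED].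
have finZ : {ae P, forall w, forall n, (Z (tau n) w < +oo)%E}.
  apply: ae_foralln => n; apply: ge0_integral_lty_ae.
  - exact: mZ.
  - exact: Z0.
  - by rewrite (expectation_time_integral X0 mX EX mB) ltry.
near=> w.
have Sw : (\sum_(0 <= n <oo) (D n w)%:E < +oo)%E by near: w.
have Fw : forall n, (Z (tau n) w < +oo)%E by near: w.
have Zmono s t : 0 <= s -> s <= t -> (Z s w <= Z t w)%E.
  move=> s0 st; apply: ge0_subset_integral.
  - exact: (measurable_itv `]0, s]).
  - exact: (measurable_itv `]0, t]).
  - apply/measurable_EFinP; exact: measurable_funS (paths_measurable mX w).
  - by move=> r _; rewrite lee_fin.
  - by move=> r /=; rewrite !in_itv/= => /andP[-> rs]; exact: le_trans st.
have Zfin t : 0 <= t -> Z t w \is a fin_num.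
  move=> t0; rewrite ge0_fin_numE//.
  have /andP[_ tn] := truncn_itv t0.
  apply: le_lt_trans (Fw (Num.trunc t)); apply: Zmono => //.
  apply: (le_trans (ltW tn)); rewrite /square_time expr2 ler_peMl//.
  by rewrite ler1n.
split => //; apply: (@squares_interpolation _ (fun t => fine (Z t w))).
  move=> s t s0 st; rewrite fine_ge0//= fine_le//; first exact: Zfin.
    by apply: Zfin; exact: le_trans st.
  exact: Zmono.
have E0 : (fine (Z (tau n) w) - M (tau n)) / tau n @[n --> \oo] --> 0.
  by apply: cvg0_sqr; exact: (summable_cvg0 (fun n => D0 n w) Sw).
have M0 : M (tau n) / tau n - l @[n --> \oo] --> 0.
  have K0 : 0 <= K by apply: le_trans (Ml (lexx 0)).
  apply/norm_cvg0P; apply: (@squeeze_cvgr _ _ _ _ (fun=> 0) (fun n => K * harmonic n)).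
  - near=> n; rewrite normr_ge0/=.
    have tn := square_time_gt0 R n.
    have -> : M (tau n) / tau n - l = (M (tau n) - l * tau n) / tau n.
      by field; rewrite gt_eqF.
    rewrite normrM normfV (gtr0_norm tn) /harmonic.
    apply: ler_pM => //; first by rewrite invr_ge0 ltW.
      exact: Ml (ltW tn).
    rewrite lef_pV2 ?posrE//; rewrite /square_time expr2 ler_peMl//.
    by rewrite ler1n.
  - exact: cvg_cst.
  - rewrite -[X in _ --> X](mulr0 K); apply: cvgM; [exact: cvg_cst|exact: cvg_harmonic].
have h : (fine (Z (tau n) w) - M (tau n)) / tau n + (M (tau n) / tau n - l) + l @[n --> \oo] --> 0 + 0 + l.
  by apply: cvgD; [exact: cvgD|exact: cvg_cst].
rewrite !add0r in h; apply: cvg_trans h; apply: near_eq_cvg; near=> n.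
have tn := square_time_gt0 R n.
by rewrite /=; field; rewrite gt_eqF.
Unshelve. all: by end_near.
Qed.

End strong_law.

(** * The potential of the linear flow *)

Section potential.
Variable R : realType.
Notation RR := (measurableTypeR R).
Notation N := (int_measure R).
Notation mu := (@lebesgue_measure R).
Variables (a : R) (a0 : 0 < a).
Local Notation V := (weight a).
Variables (L : {finite_measure set N -> \bar R}).
Hypothesis HL2 : (\int[L]_(nu in nonnull R) (epairing nu (EFin \o V) ^+ 2) < +oo)%E.
Variables (v : R -> R -> R) (k : R).
Hypotheses (lv : locally_bounded v) (v0 : forall t x, 0 <= t -> 0 <= v t x) (k0 : 0 <= k).
Hypothesis vV : forall t x, 0 <= t -> 0 < x -> v t x <= k * (expR (- (a * t)) * V x).

Local Notation half := (`]0%R, +oo[%classic).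

(** [Pi_oo f] when [v] is the linear flow of [f]. *)
Definition potential (x : R) : R := \int[mu]_(s in `]0, +oo[%classic) v s x.

Let w (s x : R) : R := v (Num.max 0 s) x.

Let w0 s x : 0 <= w s x. Proof. by apply: v0; rewrite le_max lexx. Qed.

Let wE s x : 0 < s -> w s x = v s x.
Proof. by move=> s0; rewrite /w (max_idPr (ltW s0)). Qed.

Let mw : measurable_fun [set: RR * RR] (fun z => (w z.1 z.2)%:E).
Proof. by apply/measurable_EFinP; exact: locally_bounded_ext. Qed.

Let mhalf : measurable (half : set RR). Proof. exact: measurable_itv. Qed.

Let potentialwE x : (\int[mu]_(s in half) (v s x)%:E = \int[mu]_(s in half) (w s x)%:E)%E.
Proof. by apply: eq_integral => s; rewrite inE/= in_itv/= andbT => s0; rewrite wE. Qed.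

Let epotential_le x : 0 < x -> (\int[mu]_(s in half) (v s x)%:E <= (k / a * V x)%:E)%E.
Proof.
move=> x0; have kV : 0 <= k * V x by rewrite mulr_ge0 ?weight_ge0.
apply: (@le_trans _ _ (\int[mu]_(s in half) ((k * V x)%:E * (expR (- (a * s)))%:E))%E).
  rewrite potentialwE; apply: ge0_le_integral.
  - exact: mhalf.
  - by move=> s _; rewrite lee_fin.
  - apply: (measurable_funS _ (@subsetT _ _)) => //.
    exact: (measurable_fun_pair1 (f := fun z : RR * RR => (w z.1 z.2)%:E) x mw).
  - apply: measurable_funeM; apply/measurable_EFinP.
    exact: measurable_funS (measurable_decay a).
  - move=> s; rewrite /= in_itv/= andbT => s0; rewrite wE// -EFinM lee_fin.
    by apply: (le_trans (vV (ltW s0) x0)); rewrite mulrCA mulrC.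
rewrite ge0_integralZl; last 4 first.
- exact: mhalf.
- by apply/measurable_EFinP; exact: measurable_funS (measurable_decay a).
- by move=> s _; rewrite lee_fin expR_ge0.
- by rewrite lee_fin.
have -> : k / a * V x = k * V x * a^-1 by ring.
rewrite [leRHS]EFinM; apply: lee_wpmul2l; first by rewrite lee_fin.
exact: integral_expR_pos_le.
Qed.

Let epotential_ge0 x : (0 <= \int[mu]_(s in half) (v s x)%:E)%E.
Proof. by rewrite potentialwE; apply: integral_ge0 => s _; rewrite lee_fin. Qed.

Lemma potentialE x : 0 < x -> (\int[mu]_(s in half) (v s x)%:E = (potential x)%:E)%E.
Proof.
move=> x0; rewrite /potential /Rintegral fineK// ge0_fin_numE//.
by apply: le_lt_trans (epotential_le x0) _; rewrite ltry.
Qed.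

Lemma potential_ge0 x : 0 <= potential x.
Proof. exact: fine_ge0. Qed.

Lemma potential_le x : 0 < x -> potential x <= k / a * V x.
Proof. by move=> x0; rewrite -lee_fin -potentialE//; exact: epotential_le. Qed.

Lemma time_integrable_potential x : 0 < x -> mu.-integrable half (EFin \o v ^~ x).
Proof.
move=> x0; apply/integrableP; split.
  apply: (eq_measurable_fun (fun s : RR => (w s x)%:E)).
    by move=> s; rewrite inE/= in_itv/= andbT => s0; rewrite /= wE.
  apply: (measurable_funS _ (@subsetT _ _)) => //.
  exact: (measurable_fun_pair1 (f := fun z : RR * RR => (w z.1 z.2)%:E) x mw).
apply: (@le_lt_trans _ _ (potential x)%:E); last exact: ltry.
rewrite -potentialE// le_eqVlt; apply/orP; left; apply/eqP.
by apply: eq_integral => s; rewrite inE/= in_itv/= andbT => s0; rewrite /= ger0_norm// v0// ltW.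
Qed.

Lemma measurable_potential : measurable_fun [set: RR] (potential : RR -> R).
Proof.
rewrite (_ : (potential : RR -> R) = fine \o (fun x : RR => \int[mu]_(s in half) (w s x)%:E)%E).
  apply: measurableT_comp; first exact: fine_measurable.
  have wE0 (z : RR * RR) : (0 <= (w z.2 z.1)%:E)%E by rewrite lee_fin.
  exact: (measurable_integral_on mu mhalf wE0 (measurable_flip mw)).
by apply/funext => x; rewrite /potential /Rintegral potentialwE.
Qed.

Lemma epairing_potential (nu : N) : (0 <= epairing nu (EFin \o potential) <= (k / a * mass a nu)%:E)%E.
Proof.
have ka : 0 <= k / a by rewrite divr_ge0// ltW.
apply/andP; split; first by apply: epairing_ge0 => x _; rewrite lee_fin potential_ge0.
rewrite EFinM -(massE a0) /epairing -ge0_integralZl; last 4 first.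
- exact: mhalf.
- by apply/measurable_EFinP; exact: measurable_funS (@measurable_weight R a).
- by move=> x _; rewrite lee_fin weight_ge0.
- by rewrite lee_fin.
apply: ge0_le_integral => //.
- by move=> x _; rewrite lee_fin potential_ge0.
- by apply/measurable_EFinP; exact: measurable_funS measurable_potential.
- apply: measurable_funeM; apply/measurable_EFinP; exact: measurable_funS (@measurable_weight R a).
- move=> x; rewrite /= in_itv/= andbT => x0; rewrite -EFinM lee_fin; exact: potential_le.
Qed.

Lemma pairing_potentialE (nu : N) : (pairing nu potential)%:E = epairing nu (EFin \o potential).
Proof.
have /andP[h1 h2] := epairing_potential nu.
rewrite /pairing /Rintegral fineK// ge0_fin_numE//.
by apply: le_lt_trans h2 _; rewrite ltry.
Qed.

Lemma potential_integrable (nu : N) : nu.-integrable half (EFin \o potential).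
Proof.
have /andP[h1 h2] := epairing_potential nu.
apply/integrableP; split; first by apply/measurable_EFinP; exact: measurable_funS measurable_potential.
apply: (@le_lt_trans _ _ (k / a * mass a nu)%:E); last exact: ltry.
apply: le_trans h2; rewrite le_eqVlt; apply/orP; left; apply/eqP.
by apply: eq_integral => x _; rewrite /= ger0_norm// potential_ge0.
Qed.

Lemma pairing_potential_integrable :
  L.-integrable setT (EFin \o (fun nu : N => pairing nu potential)).
Proof.
apply: (le_integrableR (H := fun nu => k / a * mass a nu)).
- apply/measurable_EFinP.
  rewrite (_ : EFin \o _ = (fun nu : N => epairing nu (EFin \o potential))); last first.
    by apply/funext => nu; rewrite /= pairing_potentialE.
  apply: measurable_epairing_state => [x|]; first by rewrite lee_fin potential_ge0.
  by apply/measurable_EFinP; exact: measurable_potential.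
- by have := integrableZl (mu := L) measurableT (k / a) (mass_integrable a0 HL2).
- move=> nu; have := epairing_potential nu.
  by rewrite -pairing_potentialE !lee_fin.
Qed.

Let vV' t x : 0 <= t -> 0 < x -> v t x <= k * 1 * (expR (- (a * t)) * V x).
Proof. by rewrite mulr1; exact: vV. Qed.

(** Two applications of Tonelli's theorem: over age and time, then over the
    immigrating populations and time. *)
Lemma integral_immigration_rate :
  (\int[mu]_(s in half) (immigration_rate L v s)%:E =
   (\int[L]_(nu in nonnull R) pairing nu potential)%:E)%E.
Proof.
have mp : measurable_fun [set: RR * N] (fun z => (pairing z.2 (w z.1))%:E).
  by apply/measurable_EFinP; exact: measurable_pairing_time_state.
have p0 (z : RR * N) : (0 <= (pairing z.2 (w z.1))%:E)%E.
  by rewrite lee_fin; apply: pairing_ge0 => x _; exact: w0.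
transitivity (\int[mu]_(s in half) \int[L]_(nu in setT) (pairing nu (w s))%:E)%E.
  apply: eq_integral => s; rewrite inE/= in_itv/= andbT => s0.
  have i1 := pairing_v_integrable a0 HL2 lv v0 k0 ler01 vV' (ltW s0).
  rewrite /w (max_idPr (ltW s0)).
  exact: (fineK (integrable_fin_num measurableT i1)).
have := tonelli_on mu L mhalf measurableT p0 mp; move=> /= ->.
transitivity (\int[L]_nu (pairing nu potential)%:E)%E; last first.
  rewrite /Rintegral integral_nonnull; last by rewrite pairing_null.
  exact: (esym (fineK (integrable_fin_num measurableT pairing_potential_integrable))).
apply: eq_integral => nu _; rewrite pairing_potentialE /epairing.
transitivity (\int[mu]_(s in half) \int[nu]_(x in half) (w s x)%:E)%E.
  apply: eq_integral => s _.
  by rewrite pairingE//; apply: (locally_bounded_section lv); rewrite le_max lexx.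
have := tonelli_on mu nu mhalf mhalf (f := fun z : RR * RR => (w z.1 z.2)%:E) _ mw.
move=> /= ->; last by move=> z; rewrite lee_fin.
apply: eq_integral => x; rewrite inE/= in_itv/= andbT => x0.
by rewrite -potentialwE potentialE.
Qed.

End potential.

(** * Nonnegative test functions *)

(** The deviation of the mean from its limit is integrable over all times. *)
Lemma mean_integral_close (R : realType) (m : R -> R) (l K c t : R) : 0 < c -> 0 <= t ->
  (@lebesgue_measure R).-integrable `]0, t]%classic (EFin \o m) ->
  (forall s, 0 < s -> `|m s - l| <= K * expR (- (c * s))) ->
  `|mean_integral m t - l * t| <= K / c.
Proof.
move=> c0 t0 im mK.
pose mu := @lebesgue_measure R.
have mI : measurable (`]0, t]%classic : set (measurableTypeR R)) by exact: measurable_itv.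
have il : mu.-integrable `]0, t]%classic (EFin \o (fun=> l : R)).
  by apply: (@itv_integrable _ _ _ `|l|) => //; exact: measurable_cst.
have K0 : 0 <= K.
  have := mK 1 ltr01; move=> h; rewrite -(pmulr_lge0 _ (expR_gt0 (- (c * 1)))).
  exact: le_trans h.
have ie : mu.-integrable `]0, t]%classic (EFin \o (fun s => K * expR (- (c * s)))).
  by apply: time_bounded_integrable; exact: time_bounded_exp.
have iD : mu.-integrable `]0, t]%classic (EFin \o (fun s => m s - l)).
  have := integrableB mI im il; congr (_.-integrable _ _); exact/funext.
have -> : mean_integral m t - l * t = \int[mu]_(s in `]0, t]%classic) (m s - l).
  rewrite (RintegralB mI im il) Rintegral_cst//; congr (_ - _ * _).
  rewrite /= lebesgue_measure_itv/= lte_fin; case: ifPn => [_|]; first by rewrite -EFinB subr0.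
  by rewrite -leNgt => h; apply/eqP; rewrite eq_le t0 h.
apply: (le_trans (le_normr_Rintegral mI iD)).
apply: (@le_trans _ _ (\int[mu]_(s in `]0, t]%classic) (K * expR (- (c * s))))).
  apply: le_Rintegral => //.
    have := integrable_norm iD; congr (_.-integrable _ _); exact/funext.
  by move=> s; rewrite /= in_itv/= => /andP[s0 _]; exact: mK.
have ie1 : mu.-integrable `]0, t]%classic (EFin \o (fun s => expR (- (c * s)))).
  have := time_bounded_integrable t (@time_bounded_exp R c c0 1).
  by congr (_.-integrable _ _); apply/funext => s /=; rewrite mul1r.
rewrite (RintegralZl _ mI ie1); apply: ler_wpM2l => //; exact: expR_integral_le.
Qed.

Section nonneg_time_average.
Variable R : realType.
Notation RR := (measurableTypeR R).
Notation N := (int_measure R).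
Notation mu := (@lebesgue_measure R).
Variables (G : probability RR R) (beta : R -> R) (Psi : R -> R -> R) (a : R).
Hypothesis a0 : 0 < a.
Local Notation V := (weight a).
Variables (L : {finite_measure set N -> \bar R}).
Hypothesis HL2 : (\int[L]_(nu in nonnull R) (epairing nu (EFin \o V) ^+ 2) < +oo)%E.
Variables (c0 c1 : R).
Hypotheses (c00 : 0 <= c0) (c10 : 0 <= c1).
Hypothesis nonlinear_le : forall h u v, nonlinear_evolution G Psi h u ->
  linear_evolution G beta h v ->
  forall t x, 0 <= t -> 0 < x -> u t x <= v t x.
Hypothesis linear_le : forall h v A, linear_evolution G beta h v -> 0 <= A ->
  vanishes_off_pos h -> (forall x, 0 < x -> h x <= A * V x) ->
  forall t x, 0 <= t -> 0 < x -> v t x <= c0 * A * (expR (- (a * t)) * V x).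
Hypothesis quadratic_le : forall h u v A, nonlinear_evolution G Psi h u ->
  linear_evolution G beta h v -> 0 <= A ->
  vanishes_off_pos h -> (forall x, 0 < x -> h x <= A * V x) ->
  forall t x, 0 <= t -> 0 < x ->
    v t x - u t x <= c1 * A ^+ 2 * (expR (- (a * t)) * V x).
Hypothesis linear_scale : forall h v k, 0 <= k -> linear_evolution G beta h v ->
  linear_evolution G beta (fun x => k * h x) (fun t x => k * v t x).
Hypothesis linear_exists : forall h, bounded_borel_pos h ->
  exists v, linear_evolution G beta h v.
Variable Q : R -> R.-pker N ~> N.
Hypothesis HQ : forall h, bounded_borel_pos h -> exists u,
  nonlinear_evolution G Psi h u /\
  forall (t : R) (nu : N), 0 <= t ->
    \int[Q t nu]_nu' expR (- pairing nu' h) =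
    expR (- pairing nu (u t) - \int[mu]_(s in `]0, t]%classic) psi L (u s)).

Context d (Omega : measurableType d).
Variables (P : probability Omega R) (Y : R -> Omega -> N) (sigma : N).
Hypothesis HY : markov_process P Y Q sigma.
Hypothesis HYright : forall w t, 0 <= t -> Y s w @[s --> t^'+] --> Y t w.
Variables (f : R -> R) (v : R -> R -> R) (A : R).
Hypotheses (Hf : bounded_borel_pos f) (Hv : linear_evolution G beta f v) (A0 : 0 <= A).
Hypothesis fA : forall x, 0 < x -> f x <= A * V x.

Let lv : locally_bounded v. Proof. by case: Hv. Qed.
Let v0 t x : 0 <= t -> 0 <= v t x. Proof. by case: Hv => _ + _; apply. Qed.
Let foff : vanishes_off_pos f. Proof. by case: Hf => -[]. Qed.
Let vV := linear_le Hv A0 foff fA.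
Let k0 : 0 <= c0 * A. Proof. exact: mulr_ge0. Qed.

Let l : R := \int[L]_(nu in nonnull R) pairing nu (potential v).
Let l1 : R := \int[L]_nu mass a nu.
Let K1 : R := c0 * A * mass a sigma + c0 * A * l1 * (2 / a).

Let l10 : 0 <= l1. Proof. by apply: Rintegral_ge0 => nu _; exact: mass_ge0. Qed.

Let imm s := immigration_rate L v s.

Let imm_le s : 0 <= s -> 0 <= imm s <= c0 * A * l1 * expR (- (a * s)).
Proof. exact: (immigration_rate_le a0 HL2 lv v0 c00 A0 vV). Qed.

Let imm_measurable : measurable_fun (`]0, +oo[%classic : set RR) (imm : RR -> R).
Proof.
have [mi _] := time_bounded_immigration_rate a0 HL2 lv v0 c00 A0 vV.
by apply: measurable_funS mi => // s /=; rewrite !in_itv/= !andbT => /ltW.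
Qed.

Let imm_total := integral_immigration_rate a0 HL2 lv v0 k0 vV.

Let imm_integrable : mu.-integrable `]0, +oo[%classic (EFin \o imm).
Proof.
apply/integrableP; split; first exact/measurable_EFinP.
apply: (@le_lt_trans _ _ l%:E); last exact: ltry.
rewrite /l -imm_total le_eqVlt; apply/orP; left; apply/eqP.
apply: eq_integral => s; rewrite inE/= in_itv/= andbT => s0.
by have /andP[h _] := imm_le (ltW s0); exact: (congr1 EFin (ger0_norm h)).
Qed.

(** The missing immigration is the tail of an exponentially decaying function. Half of
    the rate is kept and the other half makes the tail integrable. *)
Lemma mean_asymptotics s : 0 <= s ->
  `|mean L v sigma s - l| <= K1 * expR (- (a / 2 * s)).
Proof.
move=> s0.
have e1 : expR (- (a * s)) <= expR (- (a / 2 * s)).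
  have ap : 0 < a by exact: a0.
  by rewrite ler_expR lerN2; apply: ler_wpM2r; [exact: s0|lra].
have tail := Rintegral_itvB imm_integrable (x := s).
have := tail; rewrite !bnd_simp => /(_ s0 isT) {}tail.
pose T := \int[mu]_(r in `]s, +oo[%classic) imm r.
have lE : l = \int[mu]_(r in `]0, s]%classic) imm r + T.
  rewrite /T -tail addrC subrK.
  exact: (esym (congr1 fine imm_total)).
have ms : measurable (`]s, +oo[%classic : set RR) by exact: measurable_itv.
have sub : `]s, +oo[%classic `<=` `]0, +oo[%classic.
  by move=> r /=; rewrite !in_itv/= !andbT; exact: le_lt_trans.
have T0 : 0 <= T.
  apply: Rintegral_ge0 => r /=; rewrite in_itv/= andbT => sr.
  by have /andP[] := imm_le (ltW (le_lt_trans s0 sr)).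
have kl : 0 <= c0 * A * l1 by rewrite mulr_ge0.
have T1 : T <= c0 * A * l1 * (2 / a) * expR (- (a / 2 * s)).
  rewrite -lee_fin /T /Rintegral fineK; last first.
    have mp : measurable (`]0, +oo[%classic : set RR) by exact: measurable_itv.
    exact: (integrable_fin_num ms (integrableS mp ms sub imm_integrable)).
  apply: (@le_trans _ _ (\int[mu]_(r in `]s, +oo[%classic)
      ((c0 * A * l1 * expR (- (a / 2 * s)))%:E * (expR (- (a / 2 * r)))%:E))%E).
    apply: ge0_le_integral.
    - exact: ms.
    - move=> r /=; rewrite in_itv/= andbT => sr; rewrite lee_fin.
      by have /andP[] := imm_le (ltW (le_lt_trans s0 sr)).
    - by apply/measurable_EFinP; exact: measurable_funS imm_measurable.
    - apply: measurable_funeM; apply/measurable_EFinP.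
      exact: measurable_funS (measurable_decay (a / 2)).
    - move=> r /=; rewrite in_itv/= andbT => sr; rewrite -EFinM lee_fin.
      have /andP[_ h] := imm_le (ltW (le_lt_trans s0 sr)).
      apply: (le_trans h); rewrite -[leRHS]mulrA; apply: ler_wpM2l => //.
      rewrite -expRD ler_expR; have h1 : s <= r by exact: ltW.
      have ap : 0 < a by exact: a0.
      nra.
  rewrite ge0_integralZl; last 4 first.
  - exact: ms.
  - by apply/measurable_EFinP; exact: measurable_funS (measurable_decay (a / 2)).
  - by move=> r _; rewrite lee_fin expR_ge0.
  - by rewrite lee_fin mulr_ge0 ?expR_ge0.
  rewrite [X in (_ <= X%:E)%E]mulrAC [leRHS]EFinM; apply: lee_wpmul2l; first by rewrite lee_fin mulr_ge0 ?expR_ge0.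
  rewrite -[2 / a]invf_div; apply: integral_expR_on_le => //.
  by rewrite divr_gt0.
have /andP[p0 p1] := pairing_v_le a0 lv v0 c00 A0 vV sigma s0.
have p2 : pairing sigma (v s) <= c0 * A * mass a sigma * expR (- (a / 2 * s)).
  apply: (le_trans p1); rewrite [leLHS]mulrAC; apply: ler_wpM2l e1.
  by rewrite mulr_ge0// mass_ge0.
rewrite (_ : mean L v sigma s - l = pairing sigma (v s) - T); last first.
  by rewrite lE /mean opprD addrA addrK.
rewrite /K1 mulrDl ler_norml; apply/andP; split; lra.
Qed.

Let mt t := mean L v sigma (Num.max 0 t).
Let X t w := pairing (Y (Num.max 0 t) w) f.

Let m0 t : 0 <= Num.max 0 t :> R. Proof. by rewrite le_max lexx. Qed.

Let Xmoment t : (\int[P]_w (X t w)%:E = (mt t)%:E)%E.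
Proof.
by have [] := process_moments a0 HL2 c00 c10 nonlinear_le linear_le quadratic_le linear_scale HQ HY
  Hf Hv A0 fA (m0 t).
Qed.

Let mt_close t : `|mt t - l| <= K1 * expR (- (a / 2 * Num.max 0 t)).
Proof. exact: mean_asymptotics. Qed.

Let K10 : 0 <= K1.
Proof.
apply: addr_ge0; apply: mulr_ge0.
- exact: k0.
- exact: mass_ge0.
- exact: (mulr_ge0 k0 l10).
- by apply: divr_ge0 => //; exact: ltW.
Qed.

Let mt_bounded t : mt t <= `|l| + K1.
Proof.
have h := mt_close t.
have e1 : expR (- (a / 2 * Num.max 0 t)) <= 1.
  by rewrite -expR0 ler_expR oppr_le0 mulr_ge0// divr_ge0// ltW.
have := ler_norm (mt t - l); have := ler_norm l.
have := ler_wpM2l K10 e1; rewrite mulr1; lra.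
Qed.

Let X_measurable : measurable_fun [set: RR * Omega] (fun z => X z.1 z.2).
Proof.
have mY : forall t, 0 <= t -> measurable_fun setT (Y t) by case: HY.
pose kY (z : RR * Omega) : {finite_measure set RR -> \bar R} := Y (Num.max 0 z.1) z.2.
apply: (@measurable_pairing _ _ _ kY).
  move=> B mB; exact: (right_continuous_process_measurable mY HYright).
exact: bounded_borel_pos_measurable.
Qed.

(** The local integrability of the path is recorded too, because the two parts of a
    signed function have to be subtracted under the time integral. *)
Lemma nonneg_time_average_cvg : {ae P, forall w,
  (forall t, 0 <= t -> mu.-integrable `]0, t]%classic (fun s => (pairing (Y s w) f)%:E)) /\
  t^-1 * Z_pairing Y f t w @[t --> +oo] --> l}.
Proof.
have X0 t w : 0 <= X t w.
  by apply: pairing_ge0 => x _; case: Hf => _; apply.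
pose C := covariance_constant a L c0 c1 sigma A.
have C0 : 0 <= C by exact: covariance_constant_ge0.
have covX r t : 0 <= r -> 0 <= t ->
    (\int[P]_w (X r w * X (r + t) w)%:E <= (mt r * mt (r + t) + C * expR (- (a * t)))%:E)%E.
  move=> r0 t0; rewrite /X /mt (max_idPr r0) (max_idPr (addr_ge0 r0 t0)).
  exact: (covariance_decay a0 HL2 c00 c10 nonlinear_le linear_le quadratic_le linear_scale linear_exists HQ HY
    Hf Hv A0 fA r0 t0).
have Ml t : 0 <= t -> `|mean_integral mt t - l * t| <= K1 / (a / 2).
  move=> t0; apply: mean_integral_close => //; first by rewrite divr_gt0.
    exact: (mean_function_integrable X0 X_measurable Xmoment mt_bounded t).
  by move=> s s0; have := mt_close s; rewrite (max_idPr (ltW s0)).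
have := strong_law a0 C0 X0 X_measurable Xmoment mt_bounded covX Ml.
have XY w s : 0 < s -> X s w = pairing (Y s w) f.
  by move=> s0; rewrite /X (max_idPr (ltW s0)).
apply: filterS => w [fin lim]; split.
  move=> t t0; have mI : measurable (`]0, t]%classic : set RR) by exact: measurable_itv.
  apply: (eq_integrable mI (fun s => (X s w)%:E)).
    by move=> s; rewrite inE/= in_itv/= => /andP[s0 _]; rewrite XY.
  apply/integrableP; split.
    by apply/measurable_EFinP; exact: measurable_funS (paths_measurable X_measurable w).
  have h : (time_integral X t w < +oo)%E by rewrite -ge0_fin_numE ?fin// time_integral_ge0.
  apply: le_lt_trans h; rewrite le_eqVlt; apply/orP; left; apply/eqP.
  by apply: eq_integral => s _; exact: (congr1 EFin (ger0_norm (X0 s w))).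
apply: cvg_trans lim; apply: near_eq_cvg; near=> t.
congr (_ * _); rewrite /Z_pairing /Rintegral /time_integral; congr fine.
by apply: eq_integral => s; rewrite inE/= in_itv/= => /andP[s0 _]; exact: (congr1 EFin (XY w s s0)).
Unshelve. all: by end_near.
Qed.

End nonneg_time_average.

(** * Signed test functions *)

Section signed_evolution.
Variable R : realType.
Notation RR := (measurableTypeR R).
Notation N := (int_measure R).
Notation mu := (@lebesgue_measure R).
Variables (G : probability RR R) (beta : R -> R) (b : R).
Hypothesis mbeta : measurable_fun [set: RR] (beta : RR -> R).
Hypotheses (beta_ge0 : forall x, 0 <= beta x) (beta_le : forall x, beta x <= b).

(** The linear equation without a sign constraint, as satisfied by [pi_t f]. *)
Definition signed_evolution (f : R -> R) (v : R -> R -> R) :=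
  locally_bounded v /\
  forall t x, 0 <= t -> 0 < x ->
    v t x = f (x - t) + convt beta (fun r => pairing G (v r)) t x.

Let beta_norm x : `|beta x| <= b. Proof. by rewrite ger0_norm. Qed.

Lemma signed_evolutionB f g v w : signed_evolution f v -> signed_evolution g w ->
  signed_evolution (fun x => f x - g x) (fun t x => v t x - w t x).
Proof.
move=> [lv Hv] [lw Hw]; split; first exact: locally_boundedB.
move=> t x t0 x0; rewrite Hv// Hw//.
have bv := time_bounded_pairing G lv; have bw := time_bounded_pairing G lw.
have -> : convt beta (fun r => pairing G (fun y => v r y - w r y)) t x =
    convt beta (fun r => pairing G (v r) + (-1) * pairing G (w r)) t x.
  apply: eq_Rintegral => s; rewrite inE/= in_itv/= => /andP[_ st].
  have ts : 0 <= t - s by rewrite subr_ge0.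
  by rewrite mulN1r pairingB//; exact: locally_bounded_section.
rewrite (convtD _ _ mbeta beta_norm bv (time_boundedZ (-1) bw)) (convtZ _ _ _ mbeta beta_norm bw).
by rewrite mulN1r opprD addrACA.
Qed.

Variables (a phi : R).
Hypothesis beta_off : forall x, x <= 0 -> beta x = 0.
Hypotheses (a0 : 0 < a) (Hphi : epairing G (total_exp_conv beta a) = phi%:E) (phi_lt1 : phi < 1).
Hypothesis HGV : (epairing G (EFin \o weight a) < +oo)%E.

(** The difference of two solutions satisfies the equation with no transport term, and
    the maximum principle applies to it and to its opposite. *)
Lemma signed_evolution_unique f v w : signed_evolution f v -> signed_evolution f w ->
  forall t x, 0 <= t -> v t x = w t x.
Proof.
move=> Hv Hw t x t0.
have zero p q y : signed_evolution f p -> signed_evolution f q -> 0 < y -> p t y - q t y <= 0.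
  move=> Hp Hq y0; have [lpq E] := signed_evolutionB Hp Hq.
  apply: (renewal_maximum mbeta beta_ge0 beta_le beta_off a0 Hphi phi_lt1 HGV lpq) => //.
  by move=> r z r0 z0; rewrite E// subrr add0r.
have [x0|x0] := leP x 0.
  by case: Hv => -[-> // _ _ _]; case: Hw => -[-> // _ _ _].
by apply/eqP; rewrite eq_le -subr_le0 zero//= -subr_le0 zero.
Qed.

End signed_evolution.

Section signed_potential.
Variable R : realType.
Notation RR := (measurableTypeR R).
Notation N := (int_measure R).
Notation mu := (@lebesgue_measure R).
Variables (a : R) (a0 : 0 < a).
Local Notation V := (weight a).
Variables (L : {finite_measure set N -> \bar R}).
Hypothesis HL2 : (\int[L]_(nu in nonnull R) (epairing nu (EFin \o V) ^+ 2) < +oo)%E.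
Variables (v w : R -> R -> R) (k c : R).
Hypotheses (lv : locally_bounded v) (v0 : forall t x, 0 <= t -> 0 <= v t x) (k0 : 0 <= k).
Hypothesis vV : forall t x, 0 <= t -> 0 < x -> v t x <= k * (expR (- (a * t)) * V x).
Hypotheses (lw : locally_bounded w) (w0 : forall t x, 0 <= t -> 0 <= w t x) (c0 : 0 <= c).
Hypothesis wV : forall t x, 0 <= t -> 0 < x -> w t x <= c * (expR (- (a * t)) * V x).

Let mhalf : measurable (`]0, +oo[%classic : set RR). Proof. exact: measurable_itv. Qed.

Lemma pairing_potentialB (z : R -> R -> R) :
  (forall t x, 0 <= t -> z t x = v t x - w t x) ->
  \int[L]_(nu in nonnull R) pairing nu (potential z) =
  \int[L]_(nu in nonnull R) pairing nu (potential v) -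
  \int[L]_(nu in nonnull R) pairing nu (potential w).
Proof.
move=> zE.
have toT (h : R -> R) : \int[L]_(nu in nonnull R) pairing nu h = \int[L]_nu pairing nu h.
  by apply: (congr1 fine); apply: (integral_nonnull L (F := fun nu => (pairing nu h)%:E)); rewrite pairing_null.
rewrite (toT (potential z)) (toT (potential v)) (toT (potential w)).
have iv := pairing_potential_integrable a0 HL2 lv v0 k0 vV.
have iw := pairing_potential_integrable a0 HL2 lw w0 c0 wV.
rewrite -(RintegralB measurableT iv iw).
apply: eq_Rintegral => nu _.
have jv := potential_integrable a0 lv v0 k0 vV nu.
have jw := potential_integrable a0 lw w0 c0 wV nu.
rewrite /pairing -(RintegralB mhalf jv jw).
apply: eq_Rintegral => x; rewrite inE/= in_itv/= andbT => x0.
have hv := time_integrable_potential a0 lv v0 k0 vV x0.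
have hw := time_integrable_potential a0 lw w0 c0 wV x0.
rewrite /potential -(RintegralB mhalf hv hw).
by apply: eq_Rintegral => s; rewrite inE/= in_itv/= andbT => s0; rewrite zE// ltW.
Qed.

End signed_potential.

Lemma Z_pairingB (R : realType) d (Omega : measurableType d) (Y : R -> Omega -> int_measure R)
    (f g h : R -> R) (t : R) (w : Omega) :
  bounded_measurable f -> bounded_measurable g -> (forall x, h x = f x - g x) ->
  (@lebesgue_measure R).-integrable `]0, t]%classic (fun s => (pairing (Y s w) f)%:E) ->
  (@lebesgue_measure R).-integrable `]0, t]%classic (fun s => (pairing (Y s w) g)%:E) ->
  Z_pairing Y h t w = Z_pairing Y f t w - Z_pairing Y g t w.
Proof.
move=> bf bg hE jf jg.
have mI : measurable (`]0, t]%classic : set (measurableTypeR R)) by exact: measurable_itv.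
rewrite /Z_pairing -(RintegralB mI jf jg).
apply: eq_Rintegral => s _; rewrite -pairingB//.
by congr pairing; exact/funext.
Qed.

Section tilting.
Variable R : realType.
Notation RR := (measurableTypeR R).
Notation mu := (@lebesgue_measure R).
Variables (G : probability RR R) (beta : R -> R).
Hypothesis mbeta : measurable_fun [set: RR] (beta : RR -> R).
Hypotheses (beta_ge0 : forall x, 0 <= beta x).

Local Notation half := (`]0%R, +oo[%classic).
Let T c := total_exp_conv beta c.

Let marg (c : R) : measurable_fun [set: RR * RR] (fun z => (beta (z.1 - z.2) * expR (c * z.2))%:E).
Proof. exact: measurable_total_exp_conv_arg. Qed.

Let arg0 (c : R) (z : RR * RR) : (0 <= (beta (z.1 - z.2) * expR (c * z.2))%:E)%E.
Proof. by rewrite lee_fin mulr_ge0 ?expR_ge0. Qed.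

Let mhalf : measurable (half : set RR). Proof. exact: measurable_itv. Qed.

Let mT (c : R) : measurable_fun [set: RR] (T c : RR -> \bar R).
Proof. exact: (measurable_integral_on mu mhalf (arg0 c) (marg c)). Qed.

Let T0 c x : (0 <= T c x)%E. Proof. by apply: integral_ge0 => s _; exact: (arg0 c (x, s)). Qed.

(** Convexity of [c |-> expR (c * s)], integrated against [beta] and [G]. *)
Lemma tilted_mass_midpoint (c : R) :
  (2%:E * epairing G (total_exp_conv beta (c / 2)) <=
   epairing G (total_exp_conv beta 0) + epairing G (total_exp_conv beta c))%E.
Proof.
have mTh (e : R) : measurable_fun (half : set RR) (T e : RR -> \bar R) by exact: measurable_funS (mT e).
rewrite /epairing -(ge0_integralD _ mhalf (fun x _ => T0 0 x) (mTh 0) (fun x _ => T0 c x) (mTh c)).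
rewrite -(ge0_integralZl _ mhalf (mTh (c / 2)) (fun x _ => T0 (c / 2) x)); last by rewrite lee_fin.
apply: ge0_le_integral.
- exact: mhalf.
- by move=> x _; apply: mule_ge0 => //; exact: T0.
- by apply: measurable_funeM; exact: mTh.
- by apply: emeasurable_funD; exact: mTh.
move=> x _; rewrite /T /total_exp_conv.
have ms (e : R) : measurable_fun (half : set RR) (fun s : RR => (beta (x - s) * expR (e * s))%:E).
  apply: (measurable_funS _ (@subsetT _ _)) => //.
  exact: (measurable_fun_pair2 (f := fun z : RR * RR => (beta (z.1 - z.2) * expR (e * z.2))%:E) x (marg e)).
have s0 (e : R) (s : R) : half s -> (0 <= (beta (x - s) * expR (e * s))%:E)%E.
  by move=> _; exact: (arg0 e (x, s)).
rewrite -(ge0_integralD _ mhalf (s0 0) (ms 0) (s0 c) (ms c)).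
rewrite -(ge0_integralZl _ mhalf (ms (c / 2)) (s0 (c / 2))); last by rewrite lee_fin.
apply: ge0_le_integral.
- exact: mhalf.
- by move=> s hs; apply: mule_ge0 => //; exact: s0.
- by apply: measurable_funeM; exact: ms.
- by apply: emeasurable_funD; exact: ms.
move=> s _; rewrite -EFinM -EFinD lee_fin mul0r expR0 -mulrDr mulrCA.
apply: ler_wpM2l => //.
have -> : c * s = c / 2 * s + c / 2 * s by field.
by rewrite expRD; have := sqr_ge0 (expR (c / 2 * s) - 1); nra.
Qed.

End tilting.

(** * Convergence of the time averages *)

Lemma positive_negative_parts (R : realDomainType) (y : R) :
  y = Num.max y 0 - Num.max (- y) 0.
Proof. by have [h|h] := lerP y 0; have [h'|h'] := lerP (- y) 0; lra. Qed.

Theorem theorem6p4 (R : realType)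
  (alpha : R -> R) (p : R -> nat -> R)
  (G : probability (measurableTypeR R) R)
  (L : {finite_measure set (int_measure R) -> \bar R})
  (Q : R -> R.-pker (int_measure R) ~> (int_measure R))
  (Halpha : C1_pos alpha)
  (Hp : offspring_law p)
  (HG : continuous_distribution G)
  (HL : no_null_mass L)
  (HQ : branching_semigroup alpha p G L Q)
  (Hi : (\int[@lebesgue_measure R]_(s in `]0%R, +oo[%classic)
           mean_kernel alpha p G s < 1)%E)
  (alpha1 : R) (Halpha1 : 0 < alpha1)
  (Hii_dri : directly_Riemann_integrable
     (fun t => expR (alpha1 * t) * (1 - dist_fun G t)))
  (Hii_malthus : (\int[@lebesgue_measure R]_(s in `]0%R, +oo[%classic)
     ((expR (alpha1 * s))%:E * mean_kernel alpha p G s) = 1)%E)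
  (Hiii_G : (\int[G]_(x in `]0%R, +oo[%classic) (expR (2 * alpha1 * x))%:E < +oo)%E)
  (Hiii_g : (ereal_sup [set gen2 p x | x in `]0%R, +oo[%classic] < +oo)%E)
  (Hiv : (\int[L]_(nu in nonnull R)
     ((\int[nu]_(x in `]0%R, +oo[%classic) (expR (alpha1 * x))%:E) ^+ 2) < +oo)%E)
  (sigma : int_measure R)
  (d : measure_display) (Omega : measurableType d)
  (P : probability Omega R) (Y : R -> Omega -> int_measure R)
  (HY : markov_process P Y Q sigma)
  (HYcadlag : cadlag Y)
  (f : R -> R) (Hf : bounded_borel f)
  (pif : R -> R -> R) (Hpif : pi_solution alpha p G f pif) :
  {ae P, forall w,
    t^-1 * Z_pairing Y f t w @[t --> +oo] -->
    \int[L]_(nu in nonnull R)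
      pairing nu (fun x => \int[@lebesgue_measure R]_(s in `]0, +oo[%classic) pif s x)}.
Proof.
pose beta := birth_rate alpha p; pose Psi := branching_term alpha p.
pose a := alpha1 / 2.
have a0 : 0 < a by rewrite divr_gt0.
have [b b0 beta_le] := birth_rate_bounded Halpha Hp.
have [K K0 Psi_ge] := branching_term_ge Halpha Hp Hiii_g.
have [B B0 Psi_bounded] := branching_term_bounded Halpha Hp.
have mbeta := birth_rate_measurable Halpha Hp.
have beta_ge0 := birth_rate_ge0 Halpha Hp.
have beta_off := birth_rate_off p Halpha.
have Psi_ge0 := branching_term_ge0 Halpha Hp.
have Psi_le := branching_term_le Halpha Hp.
have GT : G `]0, +oo[%classic = 1%E by case: HG.
have VE (x : R) : weight a x = expR (alpha1 * x).
  by rewrite /weight /a; congr expR; field.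
have mhalf : measurable (`]0, +oo[%classic : set (measurableTypeR R)) by exact: measurable_itv.
have mV := @measurable_weight R a.
have V20 x : (0 <= (weight a x ^+ 2)%:E)%E by rewrite lee_fin sqr_ge0.
have V0 x : (0 <= (weight a x)%:E)%E by rewrite lee_fin weight_ge0.
pose V2 (x : R) : R := weight a x ^+ 2.
have GV2 : (epairing G (EFin \o V2) < +oo)%E.
  apply: le_lt_trans Hiii_G; rewrite le_eqVlt; apply/orP; left; apply/eqP.
  by apply: eq_integral => x _; rewrite /= /V2 VE expr2 -expRD; congr (expR _)%:E; ring.
have GV : (epairing G (EFin \o weight a) < +oo)%E.
  apply: le_lt_trans GV2; apply: ge0_le_integral.
  - exact: mhalf.
  - by move=> x _; exact: V0.
  - by apply/measurable_EFinP; exact: measurable_funS mV.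
  - by apply/measurable_EFinP; apply: measurable_funX; exact: measurable_funS mV.
  - move=> x; rewrite /= in_itv/= andbT => x0; rewrite lee_fin /V2 expr2 ler_peMl ?weight_ge0//.
    by rewrite VE -expR0 ler_expR mulr_ge0// ltW.
have GV_ge0 : (0 <= epairing G (EFin \o weight a))%E by apply: epairing_ge0 => x _; exact: V0.
have GV2_ge0 : (0 <= epairing G (EFin \o V2))%E by apply: epairing_ge0 => x _; exact: V20.
have HgV : epairing G (EFin \o weight a) = (fine (epairing G (EFin \o weight a)))%:E.
  by rewrite fineK// ge0_fin_numE.
have HgV2 : epairing G (EFin \o V2) =
    (fine (epairing G (EFin \o V2)))%:E.
  by rewrite fineK// ge0_fin_numE.
set gV := fine _ in HgV; set gV2 := fine _ in HgV2.
have gV20 : 0 <= gV2 by exact: fine_ge0.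
have Tge0 : (0 <= epairing G (total_exp_conv beta a))%E.
  apply: epairing_ge0 => x _; apply: integral_ge0 => s _.
  by rewrite lee_fin mulr_ge0 ?expR_ge0.
(* The tilted mass is at most the average of the offspring mean and of 1. *)
have Tlt : (epairing G (total_exp_conv beta a) < 1)%E.
  have := tilted_mass_midpoint G mbeta beta_ge0 alpha1.
  rewrite (epairing_total_exp_conv G 0 mbeta beta_ge0 beta_off).
  rewrite (epairing_total_exp_conv G alpha1 mbeta beta_ge0 beta_off).
  rewrite [X in (_ <= _ + X)%E](_ : _ = 1%E); last exact: Hii_malthus.
  rewrite [X in (_ <= X + _)%E](_ : _ = \int[@lebesgue_measure R]_(s in `]0%R, +oo[%classic)
           mean_kernel alpha p G s)%E; last first.
    by apply: eq_integral => s _; rewrite mul0r expR0 mul1e.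
  move=> h; have : (2%:E * epairing G (total_exp_conv beta a) < 1 + 1)%E.
    by apply: (le_lt_trans h); rewrite lteD2rE.
  rewrite -/a; case: (epairing G (total_exp_conv beta a)) Tge0 => [r r0| _|//].
    by rewrite -EFinM -EFinD !lte_fin; lra.
  by rewrite mulry gtr0_sg// mul1e.
have Hphi : epairing G (total_exp_conv beta a) = (fine (epairing G (total_exp_conv beta a)))%:E.
  by rewrite fineK// ge0_fin_numE//; apply: lt_trans Tlt _; rewrite ltry.
set phi := fine _ in Hphi.
have phi_lt1 : phi < 1 by rewrite -lte_fin -Hphi.
have HL2 : (\int[L]_(nu in nonnull R) (epairing nu (EFin \o weight a) ^+ 2) < +oo)%E.
  rewrite (_ : (EFin \o weight a) = (fun x => (expR (alpha1 * x))%:E)); first exact: Hiv.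
  by apply/funext => x /=; rewrite VE.
(* [c1] is the constant of [linear_sub_nonlinear_le] for a flow bounded by [c0 * A]. *)
pose c0 := comparison_constant G b a phi.
pose c1 := c0 * ((b + K) * (c0 ^+ 2 * (gV2 + gV ^+ 2)) / a).
have c00 : 0 <= c0 by apply: le_trans ler01 _; exact: comparison_constant_ge1.
have c10 : 0 <= c1.
  apply: mulr_ge0 => //; apply: divr_ge0; last exact: ltW.
  apply: mulr_ge0; first by rewrite addr_ge0// ltW.
  by apply: mulr_ge0; [exact: sqr_ge0|rewrite addr_ge0 ?sqr_ge0].
have mPsi (D : set (measurableTypeR R)) (x z : measurableTypeR R -> R) : measurable D ->
    measurable_fun D x -> measurable_fun D z -> (forall s, D s -> 0 <= z s <= 1) ->
    measurable_fun D (fun s => Psi (x s) (z s)).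
  exact: branching_term_measurable.
have nonlinear_le := nonlinear_le_linear mbeta beta_ge0 beta_le beta_off a0 GT Hphi phi_lt1 HgV mPsi
  Psi_bounded Psi_le.
have linear_le := linear_evolution_le mbeta beta_ge0 beta_le beta_off a0 Hphi phi_lt1 HgV.
have quadratic_le (h : R -> R) u v A : nonlinear_evolution G Psi h u ->
    linear_evolution G beta h v -> 0 <= A -> vanishes_off_pos h ->
    (forall x, 0 < x -> h x <= A * weight a x) ->
    forall t x, 0 <= t -> 0 < x -> v t x - u t x <= c1 * A ^+ 2 * (expR (- (a * t)) * weight a x).
  move=> Hu Hv A0 hoff hA t x t0 x0.
  have := linear_sub_nonlinear_le mbeta beta_ge0 beta_le beta_off b0 a0 GT Hphi phi_lt1 HgV HgV2 mPsi
    Psi_bounded Psi_ge0 Psi_le K0 Psi_ge Hu Hv (mulr_ge0 c00 A0) (fun t x => linear_le _ _ _ Hv A0 hoff hA t x) t0 x0.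
  rewrite -/c0; congr (_ <= _ * _); rewrite /c1 exprMn; ring.
have linear_scale h v k := @linear_evolutionZ _ G _ _ mbeta beta_ge0 beta_le h v k.
have linear_exists (h : R -> R) : bounded_borel_pos h -> exists v, linear_evolution G beta h v.
  move=> Hh; have [[_ _ [M hM]] h0] := Hh.
  have M0 : 0 <= M by apply: le_trans (hM 0).
  apply: (linear_evolution_exists G mbeta beta_ge0 beta_le b0 Hh M0) => x.
  by apply: le_trans (hM x); exact: ler_norm.
have HQ' (h : R -> R) : bounded_borel_pos h -> exists u, nonlinear_evolution G Psi h u /\
    forall (t : R) (nu : int_measure R), 0 <= t ->
    \int[Q t nu]_nu' expR (- pairing nu' h) =
    expR (- pairing nu (u t) - \int[@lebesgue_measure R]_(s in `]0, t]%classic) psi L (u s)).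
  move=> Hh; have [_ /(_ h Hh)[u [[lu u0 uE] uQ]]] := HQ.
  by exists u; split.
have HYright w t : 0 <= t -> Y s w @[s --> t^'+] --> Y t w.
  by move=> t0; have [+ _] := HYcadlag w; apply.
have [foff mf [M hM]] := Hf.
pose fp x := Num.max (f x) 0; pose fn x := Num.max (- f x) 0.
have fE x : f x = fp x - fn x by exact: positive_negative_parts.
have M0 : 0 <= M by apply: le_trans (hM 0).
have part (h : R -> R) : vanishes_off_pos h -> measurable_fun [set: measurableTypeR R] (h : measurableTypeR R -> R) ->
    (forall x, `|h x| <= M) -> bounded_borel_pos (fun x => Num.max (h x) 0) /\
    (forall x, 0 < x -> Num.max (h x) 0 <= M * weight a x).
  move=> hoff mh hM'.
  have h1 x : Num.max (h x) 0 <= M.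
    by rewrite ge_max M0 andbT; apply: le_trans (hM' x); exact: ler_norm.
  have h0 x : 0 <= Num.max (h x) 0 by rewrite le_max lexx orbT.
  split; last first.
    move=> x x0; apply: (le_trans (h1 x)); rewrite ler_peMr// VE -expR0 ler_expR.
    by rewrite mulr_ge0// ltW.
  split => //; split.
  - by move=> x x0; rewrite hoff// maxxx.
  - by apply: measurable_maxr => //; exact: measurable_cst.
  - by exists M => x; rewrite ger0_norm.
have [Hfp fpA] : bounded_borel_pos fp /\ (forall x, 0 < x -> fp x <= M * weight a x).
  exact: part f foff mf hM.
have [Hfn fnA] : bounded_borel_pos fn /\ (forall x, 0 < x -> fn x <= M * weight a x).
  apply: (part (fun x => - f x)).
  - by move=> x x0; rewrite foff// oppr0.
  - exact: measurable_funN.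
  - by move=> x; rewrite normrN.
have [vp Hvp] := linear_exists _ Hfp.
have [vn Hvn] := linear_exists _ Hfn.
have case_p := nonneg_time_average_cvg a0 HL2 c00 c10 nonlinear_le linear_le quadratic_le linear_scale linear_exists
  HQ' HY HYright Hfp Hvp M0 fpA.
have case_n := nonneg_time_average_cvg a0 HL2 c00 c10 nonlinear_le linear_le quadratic_le linear_scale linear_exists
  HQ' HY HYright Hfn Hvn M0 fnA.
have [lp vp0 Ep] := Hvp; have [ln vn0 En] := Hvn.
have Hdiff : signed_evolution G beta f (fun t x => vp t x - vn t x).
  have := signed_evolutionB mbeta beta_ge0 beta_le (conj lp Ep) (conj ln En).
  by congr (signed_evolution _ _ _ _); apply/funext => x; rewrite fE.
have Hpif' : signed_evolution G beta f pif by exact: Hpif.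
have pifE t x : 0 <= t -> pif t x = vp t x - vn t x.
  move=> t0; exact: (signed_evolution_unique mbeta beta_ge0 beta_le beta_off a0 Hphi phi_lt1 GV Hpif' Hdiff x t0).
have kM : 0 <= c0 * M by exact: mulr_ge0.
have fpoff : vanishes_off_pos fp by case: Hfp => -[].
have fnoff : vanishes_off_pos fn by case: Hfn => -[].
have -> : \int[L]_(nu in nonnull R)
      pairing nu (fun x => \int[@lebesgue_measure R]_(s in `]0, +oo[%classic) pif s x) =
    \int[L]_(nu in nonnull R) pairing nu (potential vp) -
    \int[L]_(nu in nonnull R) pairing nu (potential vn).
  exact: (pairing_potentialB a0 HL2 lp vp0 kM (linear_le _ _ _ Hvp M0 fpoff fpA)
    ln vn0 kM (linear_le _ _ _ Hvn M0 fnoff fnA) pifE).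
apply: filterS2 case_p case_n => w [ip limp] [jn limn].
apply: cvg_trans (cvgB limp limn); apply: near_eq_cvg; near=> t.
have t0 : 0 <= t by near: t; exact: nbhs_pinfty_ge.
rewrite /= -mulrBr; congr (_ * _); apply: esym; apply: Z_pairingB => //.
- exact: bounded_borel_pos_measurable.
- exact: bounded_borel_pos_measurable.
- exact: ip.
- exact: jn.
Unshelve. all: by end_near.
Qed.
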